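(* Suppose that either (a) $n\in\mathbb N$ is arbitrary and $\alpha_1=\cdots=\alpha_n=\alpha>0$; or (b) $n=2$ and $\alpha_1,\alpha_2$ are distinct and strictly positive. Then for all $x_1,\dots,x_n\in\mathbb R$ there exists a unique Nash equilibrium $(X_1^*,\dots,X_n^* )$ for mean-variance optimization with infinite time horizon, and it is also a Nash equilibrium for CARA utility maximization with infinite time horizon. In case (a), $X_i^*(t)=(x_i-\overline x_n)e^{\theta_-t}+\overline x_ne^{\rho_-t}$, where $\overline x_n=\frac1n\sum_{j=1}^nx_j$, $\theta_-=\frac{\gamma}{2\lambda}-\frac{\sqrt{\gamma^2+4\alpha\sigma^2\lambda}}{2\lambda}$ and $\rho_-=-\frac{(n-1)\gamma}{2(n+1)\lambda}-\frac{\sqrt{(n-1)^2\gamma^2+4(n+1)\alpha\sigma^2\lambda}}{2(n+1)\lambda}$. In case (b), the equation $$\tau^4-\frac{2\gamma}{3\lambda}\tau^3-\frac{\gamma^2+2\lambda\sigma^2(\alpha_1+\alpha_2)}{3\lambda^2}\tau^2+\frac{\sigma^4\alpha_1\alpha_2}{3\lambda^2}=0$$ has precisely two distinct roots $\tau_1,\tau_2$ in $(-\infty,0)$, and $X_1^*$ and $X_2^*$ are linear combinations of $e^{\tau_1t}$ and $e^{\tau_2t}$.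
   Context: Let $(\Omega,\mathcal F,(\mathcal F_t)_{t\ge0},\mathbb P)$ carry a standard $(\mathcal F_t)$-Brownian motion $W$; constants $S_0\in\mathbb R$, $\sigma\neq0$, $\gamma\ge0$, $\lambda>0$. The unaffected price is $S^0(t)=S_0+\sigma W(t)$, $t\ge0$. For $x\in\mathbb R$, $\mathscr X(x,\infty)$ is the set of processes $(X(t))_{t\ge0}$ that are adapted, have $X(0)=x$, are absolutely continuous with $X(t)=X(0)+\int_0^t\dot X(s)ds$ for a progressively measurable $\dot X$ with $\int_0^\infty\dot X(t)^2dt<\infty$ a.s., are bounded, and satisfy $\mathbb E[\int_0^\infty X(t)^2dt]<\infty$ and $\lim_{t\uparrow\infty}X(t)^2t\log\log t=0$ a.s. $\mathscr X_{\det}(x,\infty)$ denotes its deterministic elements. When $n$ agents use $X_i\in\mathscr X(x_i,\infty)$, the price is $S^{X_1,\dots,X_n}(t)=S^0(t)+\gamma\sum_{j=1}^n(X_j(t)-X_j(0))+\lambda\sum_{j=1}^n\dot X_j(t)$ and agent $i$'s revenues are the a.s. limit $\mathscr R(X_i|\mathbf X_{-i})=-\lim_{T\uparrow\infty}\int_0^T\dot X_i(t)S^{X_1,\dots,X_n}(t)dt$, $\mathbf X_{-i}=\{X_j:j\ne i\}$. A Nash equilibrium for mean-variance optimization with infinite horizon (initial positions $x_i$, risk aversions $\alpha_i$) is a collection $X_i^*\in\mathscr X_{\det}(x_i,\infty)$ such that each $X_i^*$ maximizes $X\mapsto\mathbb E[\mathscr R(X|\mathbf X^*_{-i})]-\frac{\alpha_i}2\mathrm{var}(\mathscr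 R(X|\mathbf X^*_{-i}))$ over $\mathscr X_{\det}(x_i,\infty)$ (agent $i$ uses $X$, agents $j\ne i$ use $X_j^*$). With $u_\alpha(x)=\frac1\alpha(1-e^{-\alpha x})$ for $\alpha>0$, a Nash equilibrium for CARA utility maximization with infinite horizon is a collection $X_i^*\in\mathscr X(x_i,\infty)$ such that each $X_i^*$ maximizes $X\mapsto\mathbb E[u_{\alpha_i}(\mathscr R(X|\mathbf X^*_{-i}))]$ over $\mathscr X(x_i,\infty)$. *)

(* Defs.v *)
From HB Require Import structures.
From mathcomp Require Import all_boot all_order all_algebra.
From mathcomp Require Import all_classical all_reals all_analysis.
Set Implicit Arguments. Unset Strict Implicit. Unset Printing Implicit Defensive.
Import Order.TTheory GRing.Theory Num.Theory.
Import numFieldNormedType.Exports.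
Local Open Scope classical_set_scope.
Local Open Scope ring_scope.

Section Model.
Context {R : realType} {d : measure_display} {T : measurableType d}.
Variable (P : probability T R).

Definition filtration (F : R -> set (set T)) :=
  (forall t, 0 <= t -> sigma_algebra setT (F t)) /\
  (forall t, 0 <= t -> F t `<=` measurable) /\
  (forall s t, 0 <= s -> s <= t -> F s `<=` F t).

Definition measurable_wrt (G : set (set T)) (f : T -> R) :=
  forall B : set R, measurable B -> G (f @^-1` B).

Definition brownian (F : R -> set (set T)) (W : R -> T -> R) :=
  (forall w, W 0 w = 0) /\
  (forall w, {within [set u : R | (0 <= u)%R], continuous (fun t => W t w)}) /\
  (forall t, 0 <= t -> measurable_wrt (F t) (W t)) /\
  (forall s t, 0 <= s -> s < t -> forall (A : set T) (B : set R),
     F s A -> measurable B ->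
     P (A `&` ((fun w => W t w - W s w) @^-1` B)) =
       (P A * normal_prob 0 (Num.sqrt (t - s)) B)%E).

Definition adapted (F : R -> set (set T)) (X : R -> T -> R) :=
  forall t, 0 <= t -> measurable_wrt (F t) (X t).

Definition prog_measurable (F : R -> set (set T)) (Xd : R -> T -> R) :=
  forall t, 0 <= t -> forall B : set R, measurable B ->
    <<s [set AC : set (R * T) | exists (A : set R) (C : set T),
          [/\ measurable A, A `<=` `[0, t], F t C & AC = A `*` C] ]>>
      [set p : R * T | 0 <= p.1 <= t /\ B (Xd p.1 p.2)].

Definition admissible (F : R -> set (set T)) (x : R) (X : R -> T -> R) :=
  [/\ adapted F X /\ (forall w, X 0 w = x),
      (exists Xd : R -> T -> R,
         [/\ prog_measurable F Xd,
             (forall w t, 0 <= t ->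
                lebesgue_measure.-integrable `[0, t] (fun s => (Xd s w)%:E) /\
                X t w = X 0 w + \int[lebesgue_measure]_(s in `[0, t]) Xd s w) &
             {ae P, forall w, (\int[lebesgue_measure]_(s in [set u : R | (0 <= u)%R])
                                  ((Xd s w) ^+ 2)%:E < +oo)%E}]),
      (exists C : R, forall t w, 0 <= t -> `|X t w| <= C),
      (\int[P]_w (\int[lebesgue_measure]_(t in [set u : R | (0 <= u)%R]) ((X t w) ^+ 2)%:E)
          < +oo)%E &
      {ae P, forall w, (fun t => (X t w) ^+ 2 * t * ln (ln t)) @ +oo --> 0}].

Definition deterministic (X : R -> T -> R) :=
  forall t w1 w2, 0 <= t -> X t w1 = X t w2.

Definition admissible_det (F : R -> set (set T)) (x : R) (X : R -> T -> R) :=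
  admissible F x X /\ deterministic X.

Definition dot (X : R -> T -> R) (t : R) (w : T) : R :=
  derive1 (fun s => X s w) t.

Variables (S0 sigma gamma lambda : R) (W : R -> T -> R).

Definition price {n : nat} (Xs : 'I_n -> R -> T -> R) (t : R) (w : T) : R :=
  S0 + sigma * W t w + gamma * (\sum_(j < n) (Xs j t w - Xs j 0 w))
     + lambda * (\sum_(j < n) dot (Xs j) t w).

Definition revenue {n : nat} (Xs : 'I_n -> R -> T -> R) (i : 'I_n) (w : T) : R :=
  - lim ((\int[lebesgue_measure]_(t in `[0, Tm]) (dot (Xs i) t w * price Xs t w))
          @[Tm --> +oo]).

Definition upd {n : nat} (Xs : 'I_n -> R -> T -> R) (i : 'I_n) (Y : R -> T -> R) :
  'I_n -> R -> T -> R := fun j => if j == i then Y else Xs j.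

Definition mv_objective (alpha : R) (Z : T -> R) : \bar R :=
  ('E_P[Z] - (alpha / 2)%:E * variance P Z)%E.

Definition cara (alpha : R) (r : R) : R := alpha^-1 * (1 - expR (- (alpha * r))).

Definition nash_mv (F : R -> set (set T)) {n : nat} (x alpha : 'I_n -> R)
    (Xs : 'I_n -> R -> T -> R) :=
  forall i, admissible_det F (x i) (Xs i) /\
    forall Y, admissible_det F (x i) Y ->
      (mv_objective (alpha i) (revenue (upd Xs i Y) i)
         <= mv_objective (alpha i) (revenue Xs i))%E.

Definition nash_cara (F : R -> set (set T)) {n : nat} (x alpha : 'I_n -> R)
    (Xs : 'I_n -> R -> T -> R) :=
  forall i, admissible F (x i) (Xs i) /\
    forall Y, admissible F (x i) Y ->
      ('E_P[fun w => cara (alpha i) (revenue (upd Xs i Y) i w)]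
         <= 'E_P[fun w => cara (alpha i) (revenue Xs i w)])%E.

Definition unique_nash_mv_and_cara (F : R -> set (set T)) {n : nat}
    (x alpha : 'I_n -> R) (Xs : 'I_n -> R -> T -> R) :=
  [/\ nash_mv F x alpha Xs,
      (forall Ys, nash_mv F x alpha Ys ->
         forall i t w, 0 <= t -> Ys i t w = Xs i t w) &
      nash_cara F x alpha Xs].

End Model.

(* Main.v *)
(** For a bounded absolutely continuous strategy [Y] with derivative [f], the
    stochastic integral of [Y] is defined path by path through integration by parts,
    [M_t = Y_t W_t - int_0^t W f]; it is a limit of Riemann sums with bounded adapted
    integrands, so [exp (a M_t - a^2 Q_t / 2)], [Q_t = int_0^t Y^2], has mean one.
    A Ville inequality gives the almost sure convergence of [M] where [Q] converges and,
    applied to [Y = 1], the law-of-the-iterated-logarithm growth that makes [Y_t W_t]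
    vanish.  Hence the revenue is almost surely a path functional of [Y] plus
    [sigma M_oo], where [M_oo] is Gaussian for deterministic [Y].

    Against deterministic opponents the mean-variance objective is a concave quadratic
    functional of [Y], and the Euler-Lagrange equation makes it fall short of its maximum
    by exactly [lambda |f - f*|^2 + (alpha sigma^2 / 2) |Y - X*|^2].  Adding the
    deviation inequalities of two equilibria, the cross terms add up to boundary terms
    and [- lambda |sum_i (f_i - f_i^* )|^2], which forces uniqueness.  For exponential
    utility, the convexity of [exp] compares an adapted deviation with [X*] after a change
    of measure on [0, S]; the error is [int_S^oo |X*|].

    The Euler-Lagrange system is linear with constant coefficients.  For equal risk
    aversions it decouples into the deviations from the mean and the mean; for two agents its
    characteristic polynomial is the determinant of a symmetric matrix whose null vectors at
    the two negative roots are independent. *)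
Require Import Defs.
From HB Require Import structures.
From mathcomp Require Import all_boot all_order all_algebra.
From mathcomp Require Import all_classical all_reals all_analysis.
From mathcomp Require Import measurable_realfun ring lra.
Set Implicit Arguments.
Unset Strict Implicit.
Unset Printing Implicit Defensive.
Import Order.TTheory GRing.Theory Num.Theory.
Import numFieldNormedType.Exports.
Local Open Scope classical_set_scope.
Local Open Scope ring_scope.

(** * Integrals of possibly nonmeasurable functions *)

(** The delicate point is the CARA part. For an adapted [Y] the total variance [Q_oo] is only known
    to be integrable, so the exponential martingale need not keep mean one up to time infinity, and
    Fatou errs in the wrong direction: optimality needs a lower bound on the mean of
    [exp (- alpha R)]. The way out is that concavity leaves the extra loss
    [(alpha sigma^2 / 2) |Y - X*|^2], which compensates the variance accumulated by [Y] after a time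
    [S], up to a multiple of the tail of [|X*|]. What remains is the martingale at the finite time
    [S], which is square integrable, and the later increment enters only linearly.

    The law of [M_oo] is never identified as such. For deterministic [Y] the identities
    [E exp (b Z - b^2 q / 2) = 1], for all real [b], yield the mean through the tangent line of
    [exp] and the variance through elementary inequalities between [x^2] and [2 cosh x - 2]. *)

Section NonmeasurableIntegrals.
Context {d : measure_display} {T : measurableType d} {R : realType}.
Variables (mu : {measure set T -> \bar R}) (D : set T).
Import HBNNSimple.
Local Open Scope ereal_scope.

(* The integral of an arbitrary function is a supremum over the simple functions below it, so
   monotonicity needs no measurability; the measurability of the revenue is thus never needed. *)
Lemma ge0_le_integral_ae (f g : T -> \bar R) :
  (forall x, D x -> 0 <= f x) -> (forall x, D x -> 0 <= g x) ->
  {ae mu, forall x, D x -> f x <= g x} ->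
  \int[mu]_(x in D) f x <= \int[mu]_(x in D) g x.
Proof.
move=> f0 g0 [N [mN N0 fgN]].
rewrite integral_mkcond [leRHS]integral_mkcond.
have pge0 h : (forall x, D x -> 0 <= h x) -> forall x, 0 <= (h \_ D) x.
  by move=> h0 x; rewrite patchE; case: ifPn => // /set_mem; exact: h0.
rewrite ge0_integralTE; last exact: pge0.
rewrite [leRHS]ge0_integralTE; last exact: pge0.
apply: ge_ereal_sup => _ [h /= hf <-].
rewrite -integralT_nnsfun.
(* Off [N] the simple function [h] lies below [g]; setting it to zero on the null set [N] keeps it
   simple and keeps its integral. *)
rewrite (ge0_negligible_integral _ _ _ _ N0)//; last 2 first.
  - exact/measurable_EFinP.
  - by move=> x _; rewrite lee_fin.
rewrite integral_mkcond.
have -> : (EFin \o h) \_ (setT `\` N) = EFin \o proj_nnsfun h (measurableC mN).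
  apply/funext => x; rewrite patchE /= in_setD in_setT/= mindicE in_setC.
  by case: (x \in N); rewrite /= ?mulr0 ?mulr1.
rewrite integralT_nnsfun.
apply: ereal_sup_ubound; exists (proj_nnsfun h (measurableC mN)) => //= x.
rewrite mindicE in_setC; have [xN|xN] := boolP (x \in N).
  by rewrite mulr0 pge0.
rewrite mulr1; apply: (le_trans (hf x)); rewrite !patchE; case: ifPn => // /set_mem xD.
apply: contrapT => nfg; move: xN; rewrite notin_setE; apply; apply: fgN => /= H.
exact/nfg/H.
Qed.

Lemma le_integral_ae (f g : T -> \bar R) :
  {ae mu, forall x, D x -> f x <= g x} ->
  \int[mu]_(x in D) f x <= \int[mu]_(x in D) g x.
Proof.
move=> fg; rewrite integralE [leRHS]integralE; apply: leeB.
- apply: ge0_le_integral_ae => //; apply: filterS fg => x fg Dx.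
  by rewrite !funeposE ge_max le_max fg//= le_max lexx orbT.
- apply: ge0_le_integral_ae => //; apply: filterS fg => x fg Dx.
  by rewrite !funenegE ge_max le_max leeN2 fg//= le_max lexx orbT.
Qed.

Lemma eq_integral_ae (f g : T -> \bar R) :
  {ae mu, forall x, D x -> f x = g x} ->
  \int[mu]_(x in D) f x = \int[mu]_(x in D) g x.
Proof.
move=> fg; apply/eqP; rewrite eq_le !le_integral_ae//.
- by apply: filterS fg => x fg Dx; rewrite fg.
- by apply: filterS fg => x fg Dx; rewrite fg.
Qed.

End NonmeasurableIntegrals.

(** * Limits under bounded second moments *)

Section UniformIntegrability.
Context {d : measure_display} {T : measurableType d} {R : realType}.
Variables (P : probability T R).
Local Open Scope ereal_scope.

Lemma cvg_fine_limn_esup (u : nat -> R) (l : R) : u n @[n --> \oo] --> l ->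
  fine (limn_esup (fun n => (u n)%:E)) = l.
Proof.
move=> ul; have ul' : (u n)%:E @[n --> \oo] --> l%:E.
  by apply: cvg_EFin => //; exact: nearW.
by rewrite (cvg_limn_einf_sup ul').2.
Qed.

Lemma measurable_fine_limn_esup (f : nat -> T -> R) :
  (forall n, measurable_fun setT (f n)) ->
  measurable_fun setT (fun w => fine (limn_esup (fun n => (f n w)%:E))).
Proof.
move=> mf; apply: measurableT_comp => //.
by apply: measurable_fun_limn_esup => n; exact/measurable_EFinP.
Qed.

Lemma ge0_cvge0P (u : nat -> \bar R) : (forall n, 0 <= u n) ->
  u n @[n --> \oo] --> 0 <-> (forall e : R, (0 < e)%R -> \forall n \near \oo, u n <= e%:E).
Proof.
move=> u0; split=> [/fine_cvgP[uf ul] e e0|H].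
  near=> n.
  have ufn : u n \is a fin_num by near: n.
  rewrite -(fineK ufn) lee_fin; apply: ltW.
  by near: n; apply: (cvgr_lt 0%R ul).
apply/fine_cvgP; split.
  apply: filterS (H 1%R ltr01) => n un1.
  by rewrite ge0_fin_numE// (le_lt_trans un1)// ltry.
apply/cvgrPdist_le => e e0; apply: filterS (H e e0) => n un.
have uf : u n \is a fin_num by rewrite ge0_fin_numE// (le_lt_trans un)// ltry.
by rewrite sub0r normrN ger0_norm ?fine_ge0//= -lee_fin fineK.
Unshelve. all: by end_near. Qed.

Lemma fatou_ae (f : T -> R) (fn : nat -> T -> R) (K : \bar R) :
  (forall n, measurable_fun setT (fn n)) -> (forall n w, (0 <= fn n w)%R) ->
  {ae P, forall w, fn n w @[n --> \oo] --> f w} ->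
  (forall n, \int[P]_w (fn n w)%:E <= K) -> \int[P]_w (f w)%:E <= K.
Proof.
move=> mfn fn0 cf fK.
apply: (@le_trans _ _ (\int[P]_w limn_einf (fun n => (fn n w)%:E))).
  apply: le_integral_ae => //; apply: filterS cf => w cw _.
  have /cvg_limn_einf_sup[-> //] : (fn n w)%:E @[n --> \oo] --> (f w)%:E.
  by apply: cvg_EFin => //; exact: nearW.
apply: le_trans; first apply: fatou => //.
  by move=> n; exact/measurable_EFinP.
by move=> n w _; rewrite lee_fin.
rewrite limn_einf_lim; apply: lime_le.
  exact: is_cvg_einfs.
apply: nearW => n; apply: le_trans (fK n).
by apply: ereal_inf_lbound; exists n => /=.
Qed.

Lemma ge0_integral_le (f g : T -> R) : (forall w, (0 <= f w)%R) ->
  (forall w, (f w <= g w)%R) -> \int[P]_w (f w)%:E <= \int[P]_w (g w)%:E.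
Proof. by move=> f0 fg; apply: le_integral_ae => //; apply: nearW => w _; rewrite lee_fin. Qed.

Section L2bounded.
Variables (f g : T -> R) (fn : nat -> T -> R) (K : R).
Hypotheses (mf : measurable_fun setT f) (mg : measurable_fun setT g).
Hypothesis mfn : forall n, measurable_fun setT (fn n).
Hypothesis cf : {ae P, forall w, fn n w @[n --> \oo] --> f w}.
Hypothesis fnK : forall n, \int[P]_w ((fn n w) ^+ 2)%:E <= K%:E.
Hypothesis g2 : \int[P]_w ((g w) ^+ 2)%:E < +oo.

Lemma limit_L2bounded : \int[P]_w ((f w) ^+ 2)%:E <= K%:E.
Proof.
apply: (@fatou_ae _ (fun n w => (fn n w) ^+ 2)%R) => //.
- by move=> n; exact: measurable_funX.
- by move=> n w; rewrite sqr_ge0.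
- by apply: filterS cf => w cw; rewrite expr2; under eq_cvg do rewrite expr2; exact: cvgM.
Qed.

Let h n w := `|fn n w - f w|%R.

Let mh n : measurable_fun setT (h n).
Proof. by apply: measurableT_comp => //; exact: measurable_funB. Qed.

Let h2 n : \int[P]_w ((h n w) ^+ 2)%:E <= (4 * K)%:E.
Proof.
apply: (@le_trans _ _ (\int[P]_w (2 * (fn n w) ^+ 2 + 2 * (f w) ^+ 2)%R%:E)).
  apply: ge0_integral_le => w; first by rewrite sqr_ge0.
  rewrite /h real_normK ?num_real//.
  by rewrite -subr_ge0; have -> : (2 * fn n w ^+ 2 + 2 * f w ^+ 2 - (fn n w - f w) ^+ 2
    = (fn n w + f w) ^+ 2)%R; [ring|rewrite sqr_ge0].
under eq_integral do rewrite EFinD !(EFinM 2%R).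
have m2 (u : T -> R) : measurable_fun setT u ->
    measurable_fun setT (fun w => ((u w) ^+ 2)%:E).
  by move=> mu; apply/measurable_EFinP; exact: measurable_funX.
rewrite ge0_integralD//=; last 4 first.
- by move=> w _; rewrite -EFinM lee_fin mulr_ge0// sqr_ge0.
- by apply: emeasurable_funM => //; exact: m2.
- by move=> w _; rewrite -EFinM lee_fin mulr_ge0// sqr_ge0.
- by apply: emeasurable_funM => //; exact: m2.
rewrite !ge0_integralZl//=; last 4 first.
- exact: m2.
- by move=> w _; rewrite lee_fin sqr_ge0.
- exact: m2.
- by move=> w _; rewrite lee_fin sqr_ge0.
have -> : (4 * K)%:E = 2%:E * K%:E + 2%:E * K%:E by rewrite -!EFinM -EFinD; congr EFin; ring.
apply: leeD; apply: lee_wpmul2l; rewrite ?lee_fin//.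
exact: limit_L2bounded.
Qed.

(** Young's inequality with a small weight: [|g h| <= c h^2 + min (|g| h, g^2 / (4 c))]. The first
    term has integral at most [4 c K]; the second tends to zero and is dominated by [g^2 / (4 c)].
    Bounded second moments thus replace a dominating function for [fn]. *)
Lemma cvg_L2bounded : \int[P]_w (`|g w * (fn n w - f w)|)%:E @[n --> \oo] --> 0.
Proof.
apply/ge0_cvge0P => [n|e e0]; first by apply: integral_ge0 => w _; rewrite lee_fin.
have K0 : (0 <= K)%R.
  rewrite -lee_fin; apply: le_trans (fnK 0%N).
  by apply: integral_ge0 => w _; rewrite lee_fin sqr_ge0.
(* Chosen so that [c * (4 * K) <= e / 2]; the [+ 1] covers [K = 0]. *)
pose c := (e / (8 * (K + 1)))%R.
have c0 : (0 < c)%R by rewrite divr_gt0// mulr_gt0// ltr_wpDl.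
pose v n w := Num.min (`|g w| * h n w)%R ((g w) ^+ 2 / (4 * c))%R.
have mv n : measurable_fun setT (v n).
  apply: measurable_minr; apply: measurable_funM => //.
  - exact: measurableT_comp.
  - exact: measurable_funX.
have v0 n w : (0 <= v n w)%R.
  by rewrite /v le_min; apply/andP; split; [rewrite mulr_ge0// /h|
    rewrite divr_ge0 ?sqr_ge0// ltW// mulr_gt0].
have : \int[P]_w (v n w)%:E @[n --> \oo] --> \int[P]_w (cst 0 w).
  have [] := @dominated_convergence _ T R P setT measurableT
    (fun n w => (v n w)%:E) (cst 0) (fun w => ((g w) ^+ 2 / (4 * c))%:E).
  - by move=> n; exact/measurable_EFinP.
  - exact: measurable_cst.
  - apply: filterS cf => w cw _; apply: cvg_EFin; first exact: nearW.
    apply/cvgrPdist_le => e' e'0.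
    have /cvgrPdist_le/(_ (e' / (`|g w| + 1))%R) : fn n w @[n --> \oo] --> f w by [].
    have g1 : (0 < `|g w| + 1)%R by rewrite ltr_wpDl.
    rewrite divr_gt0// => /(_ isT); apply: filterS => n Hn /=.
    rewrite sub0r normrN ger0_norm//.
    apply: (@le_trans _ _ (`|g w| * h n w)%R); first by rewrite /v ge_min lexx.
    rewrite /h distrC; move: Hn; rewrite ler_pdivlMr// => Hn.
    apply: le_trans Hn; rewrite mulrC ler_wpM2l// lerDl//.
  - apply/integrableP; split.
      apply/measurable_EFinP; apply: measurable_funM => //; exact: measurable_funX.
    under eq_integral => w _.
      rewrite gee0_abs ?lee_fin ?divr_ge0 ?sqr_ge0//; last by rewrite ltW// mulr_gt0.
      rewrite mulrC EFinM; over.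
    rewrite ge0_integralZl//=.
    + by apply: lte_mul_pinfty => //; rewrite lee_fin invr_ge0 ltW// mulr_gt0.
    + by apply/measurable_EFinP; exact: measurable_funX.
    + by move=> w _; rewrite lee_fin sqr_ge0.
    + by rewrite lee_fin invr_ge0 ltW// mulr_gt0.
  - apply: nearW => w n _; rewrite gee0_abs ?lee_fin//.
    by rewrite /v ge_min lexx orbT.
  - by move=> _ _.
rewrite integral0 => /ge0_cvge0P => /(_ _)/wrap[n|].
  by apply: integral_ge0 => w _; rewrite lee_fin.
move=> /(_ (e / 2)%R); rewrite divr_gt0// => /(_ isT); apply: filterS => n Hn.
apply: (@le_trans _ _ (\int[P]_w (c * (h n w) ^+ 2 + v n w)%R%:E)).
  apply: ge0_integral_le => w //; rewrite normrM -/(h n w) /v.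
  have h0 : (0 <= h n w)%R by rewrite /h normr_ge0.
  have [_|_] := leP (`|g w| * h n w)%R (g w ^+ 2 / (4 * c))%R.
    by rewrite lerDr mulr_ge0 ?sqr_ge0// ltW.
  rewrite -subr_ge0 -[(g w ^+ 2)%R]real_normK ?num_real//.
  have -> : (c * h n w ^+ 2 + `|g w| ^+ 2 / (4 * c) - `|g w| * h n w =
    (2 * c * h n w - `|g w|) ^+ 2 / (4 * c))%R by field; rewrite gt_eqF.
  by rewrite divr_ge0 ?sqr_ge0// ltW// mulr_gt0.
under eq_integral do rewrite EFinD (EFinM c).
rewrite ge0_integralD//=; last 4 first.
- by move=> w _; rewrite -EFinM lee_fin mulr_ge0 ?sqr_ge0// ltW.
- by apply: emeasurable_funM => //; apply/measurable_EFinP; exact: measurable_funX.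
- by move=> w _; rewrite lee_fin.
- exact/measurable_EFinP.
rewrite ge0_integralZl//=; last 3 first.
- by apply/measurable_EFinP; exact: measurable_funX.
- by move=> w _; rewrite lee_fin sqr_ge0.
- by rewrite lee_fin ltW.
have -> : e%:E = (e / 2)%:E + (e / 2)%:E by rewrite -EFinD -splitr.
apply: leeD => //; apply: (@le_trans _ _ (c%:E * (4 * K)%:E)).
  by apply: lee_wpmul2l => //; rewrite lee_fin ltW.
rewrite -EFinM lee_fin /c mulrAC ler_pdivrMr ?mulr_gt0 ?ltr_wpDl//.
nra.
Qed.

(** Carries martingale identities to the limit: with [g = 1] and [c = 1] it preserves mean one, with
    [g] an exponential martingale and [c = 0] it preserves orthogonality. *)
Lemma L2bounded_integral_eq (c : R) :
  (forall n, \int[P]_w (g w * fn n w)%:E = c%:E) ->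
  P.-integrable setT (fun w => (g w * f w)%:E) /\ \int[P]_w (g w * f w)%:E = c%:E.
Proof.
move=> fnc.
have int (u : T -> R) : measurable_fun setT u -> \int[P]_w ((u w) ^+ 2)%:E < +oo ->
    P.-integrable setT (fun w => (g w * u w)%:E).
  move=> mu u2; apply/integrableP; split.
    by apply/measurable_EFinP; exact: measurable_funM.
  apply: (@le_lt_trans _ _ (\int[P]_w ((g w) ^+ 2 + (u w) ^+ 2)%:E)).
    apply: ge0_integral_le => w //.
    rewrite normrM -[(g w ^+ 2)%R]real_normK ?num_real//.
    rewrite -[(u w ^+ 2)%R]real_normK ?num_real//.
    have := sqr_ge0 (`|g w| - `|u w|)%R.
    have := normr_ge0 (g w); have := normr_ge0 (u w); nra.
  under eq_integral do rewrite EFinD.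
  rewrite ge0_integralD//=.
  - by rewrite lte_add_pinfty.
  - by move=> w _; rewrite lee_fin sqr_ge0.
  - by apply/measurable_EFinP; exact: measurable_funX.
  - by move=> w _; rewrite lee_fin sqr_ge0.
  - by apply/measurable_EFinP; exact: measurable_funX.
have intf : P.-integrable setT (fun w => (g w * f w)%:E).
  by apply: int => //; rewrite (le_lt_trans limit_L2bounded)// ltry.
split=> //.
have lf : \int[P]_w (g w * f w)%:E \is a fin_num by exact: integrable_fin_num.
have close e : (0 < e)%R -> `|c%:E - \int[P]_w (g w * f w)%:E| <= e%:E.
  move=> e0; have /ge0_cvge0P := cvg_L2bounded.
  move=> /(_ _ _ e0)/wrap[n|]; first by apply: integral_ge0 => w _; rewrite lee_fin.
  move=> [n _ /(_ n (leqnn n))]; apply: le_trans => /=.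
  have intfn : P.-integrable setT (fun w => (g w * fn n w)%:E).
    by apply: int => //; rewrite (le_lt_trans (fnK n))// ltry.
  rewrite -(fnc n) -integralB//.
  apply: le_trans; first apply: le_abse_integral => //.
    by apply: emeasurable_funB; [exact: measurable_int intfn|exact: measurable_int intf].
  apply: le_integral_ae => //; apply: nearW => w _ /=; rewrite lee_fin.
  by rewrite mulrBr.
move: close; rewrite -(fineK lf) => close; congr EFin.
apply/eqP; rewrite eq_sym -subr_eq0 -normr_le0; apply/ler_addgt0Pr => e e0.
by rewrite add0r -lee_fin; exact: close.
Qed.

End L2bounded.

End UniformIntegrability.

(** * Exponential martingales *)

Section GaussianExponential.
Context {R : realType}.
Local Open Scope ereal_scope.

Lemma ge0_integral_normal_prob (m s : R) (f : R -> \bar R) :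
  (forall x, 0 <= f x) -> measurable_fun setT f ->
  \int[normal_prob m s]_x f x =
  \int[lebesgue_measure]_x (f x * (normal_pdf m s x)%:E).
Proof.
move=> f0 mf.
have dom := normal_prob_dominates m s.
rewrite -(@Radon_Nikodym_SigmaFinite.change_of_variables _ _ R (normal_prob m s)
  lebesgue_measure dom)//.
apply: ae_eq_integral => //.
- apply: emeasurable_funM => //.
  exact: measurable_int (Radon_Nikodym_SigmaFinite.f_integrable dom).
- by apply: emeasurable_funM => //; apply/measurable_EFinP; exact: measurable_normal_pdf.
- apply: ae_eqe_mul2l => /=.
  apply: integral_ae_eq => //.
  + exact: Radon_Nikodym_SigmaFinite.f_integrable.
  + by apply/measurable_EFinP; exact: measurable_normal_pdf.
  + by move=> E _ mE; rewrite -Radon_Nikodym_SigmaFinite.f_integral.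
Qed.

Lemma normal_exponential_integral (v t : R) : (0 < t)%R ->
  \int[normal_prob 0 (Num.sqrt t)]_y (expR (v * y - v ^+ 2 * t / 2))%:E = 1.
Proof.
move=> t0; rewrite ge0_integral_normal_prob; last 2 first.
- by move=> y; rewrite lee_fin expR_ge0.
- apply/measurable_EFinP; apply: measurableT_comp => //.
  by apply: measurable_funB => //; exact: measurable_funM.
(* Completing the square turns the integrand into the normal density with mean [v * t] and the same
   variance. *)
rewrite -(integral_normal_pdf (v * t)%R (Num.sqrt t)).
apply: eq_integral => y _; rewrite -EFinM; congr EFin.
have st : Num.sqrt t != 0%R by rewrite gt_eqF// sqrtr_gt0.
rewrite !normal_pdfE// mulrCA; congr (_ * _)%R.
rewrite /normal_fun -expRD; congr expR.
rewrite sqr_sqrtr ?ltW//; field.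
by rewrite gt_eqF.
Qed.

End GaussianExponential.

Section BrownianExponential.
Context {R : realType} {d : measure_display} {T : measurableType d}.
Variables (P : probability T R) (F : R -> set (set T)) (W : R -> T -> R).
Hypotheses (HF : filtration F) (HW : brownian P F W).
Local Open Scope ereal_scope.

Let Ft t := g_sigma_algebraType (F t).

Lemma filtration_measurableE t : (0 <= t)%R ->
  (measurable : set (set (Ft t))) = F t.
Proof. by case: HF => sF _ t0; exact: measurable_g_measurableTypeE (sF t t0). Qed.

(** [F t] is only a set of sets. Regarding [T] as the measurable type generated by it turns
    adaptedness into [measurable_fun], with all its closure properties. *)
Definition fmeas t (f : T -> R) := measurable_fun [set: Ft t] (f : Ft t -> R).

Lemma fmeasP t f : (0 <= t)%R -> measurable_wrt (F t) f <-> fmeas t f.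
Proof.
move=> t0; split => [mf _ B mB|mf B mB].
  by rewrite setTI filtration_measurableE//; exact: mf.
by rewrite -filtration_measurableE// -[X in measurable X]setTI; exact: mf.
Qed.

Lemma fmeas_le (s t : R) (f : T -> R) : (0 <= s)%R -> (s <= t)%R -> fmeas s f -> fmeas t f.
Proof.
move=> s0 st mf _ B mB; rewrite filtration_measurableE ?(le_trans s0)//.
apply: HF.2.2 st _ _ => //; rewrite -filtration_measurableE//; exact: mf.
Qed.

Lemma fmeas_measurable t f : (0 <= t)%R -> fmeas t f -> measurable_fun [set: T] f.
Proof.
move=> t0 mf _ B mB; apply: (HF.2.1 t t0).
by rewrite -filtration_measurableE//; exact: mf.
Qed.

Lemma brownian_fmeas t : (0 <= t)%R -> fmeas t (W t).
Proof. by move=> t0; apply/fmeasP => //; case: HW => _ [_ [/(_ t t0)]]. Qed.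

Lemma brownian_measurable t : (0 <= t)%R -> measurable_fun [set: T] (W t).
Proof. by move=> t0; exact: fmeas_measurable (brownian_fmeas t0). Qed.

Section Increment.
Variables s t : R.
Hypotheses (s0 : (0 <= s)%R) (st : (s < t)%R).

Let RR : measurableType _ := measurableTypeR R.
Let t0 : (0 <= t)%R := le_trans s0 (ltW st).
Let xi w := (W t w - W s w)%R.

Let mxi : measurable_fun [set: T] xi.
Proof. by apply: measurable_funB; exact: brownian_measurable. Qed.

Let jd (w : T) : Ft s * RR := (w, xi w).

Let idF (w : T) : Ft s := w.

Let mid : measurable_fun [set: T] idF.
Proof.
by move=> _ B mB; rewrite setTI; apply: (HF.2.1 s s0); rewrite -filtration_measurableE.
Qed.

Let mjd : measurable_fun [set: T] jd.
Proof. by apply/measurable_fun_pairP; split. Qed.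

HB.instance Definition _ := isMeasurableFun.Build _ _ _ _ _ mid.
HB.instance Definition _ := isMeasurableFun.Build _ _ _ _ _ mjd.

(** Independence as a product law: the pair of the identity into [Ft s] and the increment has, on
    rectangles and hence everywhere, the law of [P] restricted to [F s] times the normal law.
    Tonelli then integrates out the increment first. *)
Lemma brownian_increment_integral (f : T * R -> \bar R) :
  (forall z, 0 <= f z) -> measurable_fun [set: Ft s * RR] (f : Ft s * RR -> \bar R) ->
  \int[P]_w f (w, xi w) =
  \int[P]_w (\int[normal_prob 0 (Num.sqrt (t - s))]_y f (w, y)).
Proof.
move=> f0 mf.
pose Ps : probability (Ft s) R := distribution P idF.
pose J : probability (Ft s * RR)%type R := distribution P jd.
pose N : probability RR R := normal_prob 0 (Num.sqrt (t - s)).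
have JE X : measurable X -> (Ps \x N) X = J X.
  apply: (@product_measure_unique _ _ (Ft s) RR R Ps N J) => A B mA mB.
  have FA : F s A by rewrite -filtration_measurableE.
  case: HW => _ [_ [_ ind]].
  by rewrite /J /Ps /distribution /pushforward /N /= -(ind s t s0 st A B FA mB).
transitivity (\int[J]_z f z).
  by rewrite (ge0_integral_distribution jd)//.
rewrite (@eq_measure_integral _ _ _ _ (Ps \x N)); last first.
  by move=> A mA _; exact/esym/JE.
rewrite (@fubini_tonelli1 _ _ _ _ _ Ps N f)//.
rewrite /fubini_F /Ps (ge0_integral_distribution idF)//.
- exact: measurable_fun_fubini_tonelli_F.
- by move=> w; apply: integral_ge0.
Qed.

End Increment.

Lemma fmeasD t f g : fmeas t f -> fmeas t g -> fmeas t (fun w => f w + g w)%R.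
Proof. by rewrite /fmeas => mf mg; exact: measurable_funD. Qed.

Lemma fmeasM t f g : fmeas t f -> fmeas t g -> fmeas t (fun w => f w * g w)%R.
Proof. by rewrite /fmeas => mf mg; exact: measurable_funM. Qed.

Lemma fmeasB t f g : fmeas t f -> fmeas t g -> fmeas t (fun w => f w - g w)%R.
Proof. by rewrite /fmeas => mf mg; exact: measurable_funB. Qed.

Lemma fmeasX t f k : fmeas t f -> fmeas t (fun w => f w ^+ k)%R.
Proof. by rewrite /fmeas => mf; exact: measurable_funX. Qed.

Lemma fmeas_expR t f : fmeas t f -> fmeas t (fun w => expR (f w)).
Proof. by rewrite /fmeas => mf; exact: measurableT_comp. Qed.

Lemma fmeas_cst t c : fmeas t (cst c).
Proof. exact: measurable_cst. Qed.

Lemma fmeas_sum t (f : nat -> T -> R) m : (forall k, (k < m)%N -> fmeas t (f k)) ->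
  fmeas t (fun w => \sum_(k < m) f k w)%R.
Proof.
elim: m => [|m IH] mf.
  by under eq_fun do rewrite big_ord0; exact: fmeas_cst.
under eq_fun do rewrite big_ord_recr/=.
by apply: fmeasD; [apply: IH => k km; apply: mf; exact: ltnW|exact: mf].
Qed.

(** The one-step martingale property: with [w] frozen, [G] and [V] are constants, and the normal
    integral of the exponential is one. *)
Lemma exponential_step (s t : R) (G V : T -> R) : (0 <= s)%R -> (s < t)%R ->
  fmeas s G -> (forall w, (0 <= G w)%R) -> fmeas s V ->
  \int[P]_w (G w * expR (V w * (W t w - W s w) - (V w) ^+ 2 * (t - s) / 2))%:E =
  \int[P]_w (G w)%:E.
Proof.
move=> s0 st mG G0 mV.
rewrite (@brownian_increment_integral s t s0 st (fun z =>
  (G z.1 * expR (V z.1 * z.2 - V z.1 ^+ 2 * (t - s) / 2))%:E)); last 2 first.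
- by move=> z; rewrite lee_fin mulr_ge0// expR_ge0.
- apply/measurable_EFinP.
  have mG' : measurable_fun [set: Ft s * measurableTypeR R] (G \o fst).
    exact: (@measurableT_comp _ _ _ _ _ _ (G : Ft s -> R) _ _ mG measurable_fst).
  have mV' : measurable_fun [set: Ft s * measurableTypeR R] (V \o fst).
    exact: (@measurableT_comp _ _ _ _ _ _ (V : Ft s -> R) _ _ mV measurable_fst).
  apply: measurable_funM => //; apply: measurableT_comp => //.
  apply: measurable_funB; apply: measurable_funM => //.
  by apply: measurable_funM => //; exact: measurable_funX.
apply: eq_integral => w _ /=.
under eq_integral do rewrite EFinM.
rewrite ge0_integralZl//=.
- by rewrite normal_exponential_integral ?subr_gt0// mule1.
- apply/measurable_EFinP; apply: measurableT_comp => //.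
  by apply: measurable_funB => //; exact: measurable_funM.
- by have := G0 w; rewrite -lee_fin.
Qed.

Definition mesh (n k : nat) : R := (k%:R / n.+1%:R)%R.

Lemma mesh_ge0 n k : (0 <= mesh n k)%R. Proof. by rewrite /mesh divr_ge0. Qed.

Lemma mesh_le n j k : (j <= k)%N -> (mesh n j <= mesh n k)%R.
Proof. by move=> jk; rewrite /mesh ler_pM2r ?invr_gt0 ?ltr0n// ler_nat. Qed.

Lemma meshSB n k : (mesh n k.+1 - mesh n k = n.+1%:R^-1)%R.
Proof. by rewrite /mesh -mulrBl -natrB// subSnn mul1r. Qed.

Lemma mesh_ltS n k : (mesh n k < mesh n k.+1)%R.
Proof. by rewrite -subr_gt0 meshSB invr_gt0 ltr0n. Qed.

Section Discrete.
Variable n : nat.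

Definition dsum (V : nat -> T -> R) m w : R :=
  (\sum_(k < m) V k w * (W (mesh n k.+1) w - W (mesh n k) w))%R.

Definition dvar (V : nat -> T -> R) m (w : T) : R :=
  (\sum_(k < m) (V k w) ^+ 2 / n.+1%:R)%R.

Definition dexp V m w : R := (dsum V m w - dvar V m w / 2)%R.

Variables (V : nat -> T -> R).
Hypothesis mV : forall k, fmeas (mesh n k) (V k).

Lemma fmeas_dsum m : fmeas (mesh n m) (dsum V m).
Proof.
apply: (fmeas_sum (f := fun k w =>
  V k w * (W (mesh n k.+1) w - W (mesh n k) w))%R) => k km; apply: fmeasM.
  by apply: (fmeas_le _ _ (@mV k)); [exact: mesh_ge0|exact/mesh_le/ltnW].
apply: fmeasB.
  by apply: (fmeas_le _ _ (brownian_fmeas (mesh_ge0 n k.+1))); [exact: mesh_ge0|exact/mesh_le].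
by apply: (fmeas_le _ _ (brownian_fmeas (mesh_ge0 n k))); [exact: mesh_ge0|exact/mesh_le/ltnW].
Qed.

Lemma fmeas_dvar m : fmeas (mesh n m) (dvar V m).
Proof.
apply: (fmeas_sum (f := fun k w => (V k w) ^+ 2 / n.+1%:R)%R) => k km.
apply: fmeasM; last exact: fmeas_cst.
apply: fmeasX.
by apply: (fmeas_le _ _ (@mV k)); [exact: mesh_ge0|exact/mesh_le/ltnW].
Qed.

Lemma fmeas_dexp m : fmeas (mesh n m) (dexp V m).
Proof.
exact: (@fmeasB _ _ _ (@fmeas_dsum m) (@fmeasM _ _ _ (@fmeas_dvar m) (@fmeas_cst _ _))).
Qed.

Lemma dexpS m w : dexp V m.+1 w = (dexp V m w +
  (V m w * (W (mesh n m.+1) w - W (mesh n m) w) -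
   (V m w) ^+ 2 * (mesh n m.+1 - mesh n m) / 2))%R.
Proof.
by rewrite /dexp /dsum /dvar !big_ord_recr/= meshSB; ring.
Qed.

Lemma dexp_integral m : \int[P]_w (expR (dexp V m w))%:E = 1.
Proof.
elim: m => [|m IH].
  under eq_integral do rewrite /dexp /dsum /dvar !big_ord0 mul0r subr0 expR0.
  by rewrite integral_cst// mul1e; exact: probability_setT.
under eq_integral do rewrite dexpS expRD.
rewrite exponential_step ?mesh_ge0 ?mesh_ltS//.
by apply: fmeas_expR; exact: fmeas_dexp.
Qed.

End Discrete.

(** Squaring the exponential amounts to doubling the integrand, at the price of the factor
    [exp (dvar)]. This factor is at most [exp (C^2 t)], and the doubled integrand again has an
    exponential of mean one. *)
Lemma dexp_integral_sqr n V C m : (forall k, fmeas (mesh n k) (V k)) ->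
  (forall k w, (`|V k w| <= C)%R) ->
  \int[P]_w ((expR (dexp n V m w)) ^+ 2)%:E <= (expR (C ^+ 2 * mesh n m))%:E.
Proof.
move=> mV VC; pose V2 k w := (2 * V k w)%R.
apply: (@le_trans _ _ (\int[P]_w
    (expR (C ^+ 2 * mesh n m) * expR (dexp n V2 m w))%:E)).
  apply: ge0_integral_le => w; first by rewrite sqr_ge0.
  rewrite expr2 -!expRD ler_expR.
  have -> : (dexp n V m w + dexp n V m w = dvar n V m w + dexp n V2 m w)%R.
    rewrite /dexp /V2 /dsum.
    have -> : (dvar n (fun k w0 => 2 * V k w0) m w = 4 * dvar n V m w)%R.
      by rewrite /dvar mulr_sumr; apply: eq_bigr => k _; ring.
    have -> : (\sum_(k < m) 2 * V k w * (W (mesh n k.+1) w - W (mesh n k) w) =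
      2 * \sum_(k < m) V k w * (W (mesh n k.+1) w - W (mesh n k) w))%R.
      by rewrite mulr_sumr; apply: eq_bigr => k _; ring.
    by field.
  rewrite lerD2r /dvar /mesh.
  apply: (@le_trans _ _ (\sum_(k < m) C ^+ 2 / n.+1%:R)%R).
    apply: ler_sum => k _; rewrite ler_pM2r ?invr_gt0 ?ltr0n//.
    by rewrite -[(V k w ^+ 2)%R]real_normK ?num_real// lerXn2r ?nnegrE// (le_trans _ (VC k w)).
  by rewrite sumr_const card_ord -[leLHS]mulr_natr mulrAC mulrA.
under eq_integral do rewrite EFinM.
rewrite ge0_integralZl//=.
- rewrite dexp_integral ?mule1// => k.
  by apply: fmeasM => //; exact: fmeas_cst.
- apply/measurable_EFinP; apply: measurableT_comp => //.
  apply: (fmeas_measurable (mesh_ge0 n m)); apply: fmeas_dexp => k.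
  by apply: fmeasM => //; exact: fmeas_cst.
Qed.

End BrownianExponential.

(** * Pathwise stochastic integrals and the Ville inequality *)

Section StochasticIntegral.
Context {R : realType} {d : measure_display} {T : measurableType d}.
Variables (P : probability T R) (F : R -> set (set T)) (W : R -> T -> R).
Hypotheses (HF : filtration F) (HW : brownian P F W).
(* [M] and [Q] are the pathwise limits, along the grids [k / n.+1], of the Riemann sums of
   [V dW] and [V^2 dt] for uniformly bounded adapted integrands [V n k]. *)
Definition stochint (M Q : R -> T -> R) : Prop :=
  exists (C : R) (V : nat -> nat -> T -> R),
  [/\ forall n k, fmeas F (mesh n k) (V n k),
      forall n k w, `|V n k w| <= C &
      forall (t : R) w, 0 <= t ->
        dsum W n (V n) (Num.truncn (t * n.+1%:R)) w @[n --> \oo] --> M t w /\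
        dvar n (V n) (Num.truncn (t * n.+1%:R)) w @[n --> \oo] --> Q t w].

Local Open Scope ereal_scope.

Section Crossing.
Variables (n : nat) (V : nat -> T -> R) (a : R).
Hypothesis mV : forall k, fmeas F (mesh n k) (V k).

Fixpoint crossed k w : bool :=
  if k is j.+1 then crossed j w || (a <= dexp W n V k w)%R
  else (a <= dexp W n V 0 w)%R.

Lemma crossed_exists m k w : (k <= m)%N -> (a <= dexp W n V k w)%R -> crossed m w.
Proof.
elim: m => [|m IH]; first by rewrite leqn0 => /eqP ->.
rewrite leq_eqVlt => /orP[/eqP -> /= ->|]; first by rewrite orbT.
by rewrite ltnS => km ak /=; rewrite IH.
Qed.

Let ind k w : R := (~~ crossed k w)%:R%R.

Let bool_nat_measurable : measurable_fun [set: bool] (fun b : bool => (~~ b)%:R : R).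
Proof. by []. Qed.

Lemma fmeas_crossed k :
  measurable_fun [set: g_sigma_algebraType (F (mesh n k))]
    (crossed k : g_sigma_algebraType (F (mesh n k)) -> bool).
Proof.
have mE j : measurable_fun [set: g_sigma_algebraType (F (mesh n j))]
    (fun w : g_sigma_algebraType (F (mesh n j)) => a <= dexp W n V j w)%R.
  by apply: measurable_fun_ler => //; exact: (@fmeas_dexp _ _ _ _ _ _ HF HW n V mV j).
elim: k => [|k IH]; first exact: mE.
apply: measurable_or; last exact: mE.
move=> _ B mB; rewrite (filtration_measurableE HF (mesh_ge0 n k.+1)).
apply: (HF.2.2 (mesh n k) (mesh n k.+1) (mesh_ge0 n k) (mesh_le n (leqnSn k))).
by rewrite -(filtration_measurableE HF (mesh_ge0 n k)); exact: IH.
Qed.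

Let fmeas_ind k : fmeas F (mesh n k) (ind k).
Proof.
exact: (measurableT_comp bool_nat_measurable (@fmeas_crossed k)).
Qed.

Lemma measurable_crossed k : measurable [set w | crossed k w].
Proof.
have := @fmeas_crossed k measurableT [set true] I.
rewrite setTI (filtration_measurableE HF (mesh_ge0 n k)).
move=> /(HF.2.1 _ (mesh_ge0 n k)); congr (measurable _).
Qed.

Let V' k w := (V k w * ind k w)%R.

Let mV' k : fmeas F (mesh n k) (V' k).
Proof. by apply: fmeasM; [exact: mV|exact: fmeas_ind]. Qed.

(** Switching the integrand off at the first crossing freezes [dexp] at a value which is at least
    [a]. The maximal inequality thus reduces to Markov's inequality for the stopped integrand, whose
    exponential also has mean one. *)
Lemma stopped_dexp m w :
  (crossed m w -> (a <= dexp W n V' m w)%R) /\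
  (~~ crossed m w -> dexp W n V' m w = dexp W n V m w).
Proof.
elim: m => [|m [IH1 IH2]].
  by rewrite /= /dexp /dsum /dvar !big_ord0.
have [cm|cm] := boolP (crossed m w).
  have -> : dexp W n V' m.+1 w = dexp W n V' m w.
    by rewrite dexpS [V' m w]/V' /ind cm /= mulr0 mul0r expr0n /= !mul0r subr0 addr0.
  by rewrite /= cm /=; split=> // _; exact: IH1.
have -> : dexp W n V' m.+1 w = dexp W n V m.+1 w.
  by rewrite !dexpS IH2// [V' m w]/V' /ind cm mulr1.
by rewrite /= (negbTE cm) /=; split.
Qed.

Lemma discrete_ville m : P [set w | crossed m w] <= (expR (- a))%:E.
Proof.
have mc := measurable_crossed m.
have H : (expR a)%:E * P [set w | crossed m w] <= 1.
  rewrite -(@dexp_integral _ _ _ P F W HF HW n V' mV' m).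
  have -> : P [set w | crossed m w] = \int[P]_w (\1_[set w | crossed m w] w)%:E.
    by rewrite integral_indic// setIT.
  rewrite -ge0_integralZl//; last by apply/measurable_EFinP; exact: measurable_indic.
  apply: le_integral_ae => //; apply: nearW => w _; rewrite -EFinM lee_fin indicE.
  have [cw|cw] := boolP (crossed m w).
    by rewrite mem_set// mulr1 ler_expR; exact: (stopped_dexp m w).1.
  by rewrite memNset ?mulr0 ?expR_ge0//; exact/negP.
rewrite expRN; rewrite -(fineK (fin_num_measure P _ mc)) in H *.
move: H; rewrite -EFinM !lee_fin => H.
by rewrite -(@ler_pM2l _ (expR a)) ?expR_gt0// mulfV// gt_eqF// expR_gt0.
Qed.

End Crossing.

Lemma stochint_measurable M Q t : stochint M Q -> (0 <= t)%R ->
  measurable_fun setT (M t) /\ measurable_fun setT (Q t).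
Proof.
move=> [C [V [mV VC cV]]] t0; split.
- apply: (measurable_fun_cvg _ (fun w _ => (cV t w t0).1)) => n.
  by apply: (fmeas_measurable HF (mesh_ge0 n _)); apply: (fmeas_dsum HF HW).
- apply: (measurable_fun_cvg _ (fun w _ => (cV t w t0).2)) => n.
  by apply: (fmeas_measurable HF (mesh_ge0 n _)); apply: (fmeas_dvar HF).
Qed.

Lemma mesh_truncn_le n (t : R) : (0 <= t)%R -> (mesh n (Num.truncn (t * n.+1%:R)%R) <= t)%R.
Proof.
move=> t0; rewrite /mesh ler_pdivrMr ?ltr0n//.
by have /andP[] := truncn_itv (mulr_ge0 t0 (ler0n _ n.+1)).
Qed.

(** The bound [C] on the integrands bounds the second moments of the discrete exponentials by
    [expR (C ^+ 2 * t)], uniformly in the mesh, so mean one survives the limit. *)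
Lemma stochint_exp M Q t : stochint M Q -> (0 <= t)%R ->
  \int[P]_w (expR (M t w - Q t w / 2))%:E = 1 /\
  exists K : R, \int[P]_w ((expR (M t w - Q t w / 2)) ^+ 2)%:E <= K%:E.
Proof.
move=> MQ t0; have [mM mQ] := stochint_measurable MQ t0.
move: MQ => [C [V [mV VC cV]]].
pose tr n := Num.truncn (t * n.+1%:R)%R.
have mf : measurable_fun setT (fun w => expR (M t w - Q t w / 2)).
  by apply: measurableT_comp => //; apply: measurable_funB => //; exact: measurable_funM.
have mfn n : measurable_fun setT (fun w => expR (dexp W n (V n) (tr n) w)).
  apply: measurableT_comp => //.
  by apply: (fmeas_measurable HF (mesh_ge0 n _)); apply: (fmeas_dexp HF HW).
have cf : {ae P, forall w, expR (dexp W n (V n) (tr n) w) @[n --> \oo] -->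
    expR (M t w - Q t w / 2)}.
  apply: nearW => w; apply: continuous_cvg; first exact: continuous_expR.
  by apply: cvgB; [exact: (cV t w t0).1|apply: cvgMl; exact: (cV t w t0).2].
have fnK n : \int[P]_w ((expR (dexp W n (V n) (tr n) w)) ^+ 2)%:E <= (expR (C ^+ 2 * t))%:E.
  apply: le_trans; first exact: (@dexp_integral_sqr _ _ _ P F W HF HW n (V n) C (tr n)).
  by rewrite lee_fin ler_expR ler_wpM2l ?sqr_ge0// mesh_truncn_le.
have one2 : \int[P]_w ((cst (1%R : R) w) ^+ 2)%:E < +oo.
  by under eq_integral do rewrite /= expr1n; rewrite integral_cst// mul1e -ge0_fin_numE ?fin_num_measure.
split; last by exists (expR (C ^+ 2 * t)); exact: (limit_L2bounded mfn cf fnK).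
have m1 : measurable_fun [set: T] (cst (1%R : R)) by exact: measurable_cst.
have [|_] := L2bounded_integral_eq mf m1 mfn cf fnK one2 (c := 1%R).
  move=> n; under eq_integral do rewrite mul1r.
  exact: (@dexp_integral _ _ _ P F W HF HW n (V n) (mV n) (tr n)).
by under eq_integral do rewrite mul1r.
Qed.

(** If the limit exceeds [a] at some [t], then the discrete exponentials exceed [a] for all large
    [n], so [w] lies in the lower limit of the discrete crossing sets. Its probability is bounded
    like theirs. *)
Lemma stochint_ville M Q (a : R) : stochint M Q ->
  exists B, [/\ measurable B, P B <= (expR (- a))%:E &
    forall w, ~ B w -> forall t, (0 <= t)%R -> (M t w - Q t w / 2 <= a)%R].
Proof.
move=> [C [V [mV VC cV]]].
(* Index [n * n.+1] is time [n]: the horizon grows with the refinement, so that every [t] is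
   eventually covered. *)
pose Bn n := [set w | crossed n (V n) a (n * n.+1) w].
have mBn n : measurable (Bn n) by apply: measurable_crossed.
pose A p := \bigcap_(n in [set n | (p <= n)%N]) Bn n.
have mA p : measurable (A p) by apply: bigcap_measurable => //; exists p => /=.
have PA p : P (A p) <= (expR (- a))%:E.
  apply: (le_trans _ (discrete_ville a (mV p) (p * p.+1))).
  by apply: le_measure; rewrite ?inE; [exact: mA|exact: (mBn p)|move=> w; apply => /=].
exists (\bigcup_p A p); split.
- exact: bigcup_measurable.
- have cA : P (A p) @[p --> \oo] --> P (\bigcup_p A p).
    apply: nondecreasing_cvg_mu => //; first exact: bigcup_measurable.
    move=> p q pq; apply/subsetPset => w Aw n /= qn.
    by apply: Aw => /=; exact: leq_trans pq qn.
  rewrite -(cvg_lim _ cA)//; apply: lime_le => //; last exact: nearW.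
  by apply/cvg_ex; eexists; exact: cA.
- move=> w nBw t t0; rewrite leNgt; apply/negP => lta; apply: nBw.
  have cE : dexp W n (V n) (Num.truncn (t * n.+1%:R)%R) w @[n --> \oo] --> (M t w - Q t w / 2)%R.
    by apply: cvgB; [exact: (cV t w t0).1|apply: cvgMl; exact: (cV t w t0).2].
  have [p _ Hp] : \forall n \near \oo, (a < dexp W n (V n) (Num.truncn (t * n.+1%:R)%R) w)%R /\ (t <= n%:R)%R.
    apply: filterI; first exact: (cvgr_gt _ cE).
    exact: nbhs_infty_ger.
  exists p => // n /= pn; have [h1 h2] := Hp n pn.
  apply: (@crossed_exists _ _ _ _ (Num.truncn (t * n.+1%:R)%R)); last exact: ltW.
  rewrite -(ler_nat R) natrM.
  have /andP[tr _] := truncn_itv (mulr_ge0 t0 (ler0n R n.+1)).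
  by apply: (le_trans tr); rewrite ler_wpM2r.
Qed.

End StochasticIntegral.

Section RealLimits.
Context {R : realType} {I : Type} {G : set_system I} {GG : ProperFilter G}.

Lemma cvg_le_cst (f : I -> R) (l c : R) :
  f x @[x --> G] --> l -> (\forall x \near G, f x <= c) -> l <= c.
Proof.
by move=> fl fc; rewrite -(cvg_lim _ fl)//; apply: limr_le => //; apply/cvg_ex; exists l.
Qed.

Lemma cvg_ge_cst (f : I -> R) (l c : R) :
  f x @[x --> G] --> l -> (\forall x \near G, c <= f x) -> c <= l.
Proof.
by move=> fl fc; rewrite -(cvg_lim _ fl)//; apply: limr_ge => //; apply/cvg_ex; exists l.
Qed.

End RealLimits.

Section SplitSums.
Context {R : realType}.

Lemma sum_split_coef (a b : R) (N : nat) (x : nat -> R) m :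
  \sum_(k < m) (if (k < N)%N then a else b) * x k =
  a * \sum_(k < minn m N) x k + b * (\sum_(k < m) x k - \sum_(k < minn m N) x k).
Proof.
elim: m => [|m IH]; first by rewrite min0n !big_ord0 subrr !mulr0 addr0.
rewrite big_ord_recr/= IH; have [mN|Nm] := ltnP m N.
  by rewrite (minn_idPl mN) big_ord_recr/=; ring.
by rewrite (minn_idPr (leqW Nm)) big_ord_recr/=; ring.
Qed.

Lemma truncn_min (t : R) (S n : nat) : 0 <= t ->
  Num.truncn (Num.min t S%:R * n.+1%:R) = minn (Num.truncn (t * n.+1%:R)) (S * n.+1).
Proof.
move=> t0; have [tS|St] := leP t S%:R.
  apply/esym/minn_idPl; rewrite -(ler_nat R) natrM.
  have /andP[h _] := truncn_itv (mulr_ge0 t0 (ler0n R n.+1)).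
  by apply: (le_trans h); rewrite ler_wpM2r.
rewrite -natrM natrK; apply/esym/minn_idPr.
by rewrite truncn_ge_nat ?mulr_ge0// natrM ler_wpM2r// ltW.
Qed.

End SplitSums.

Section ProbabilityLimits.
Context {R : realType} {d : measure_display} {T : measurableType d}.
Variables (P : probability T R).
Local Open Scope ereal_scope.

Lemma liminf_measure_le (B : nat -> set T) (c : \bar R) :
  (forall n, measurable (B n)) -> (forall n, P (B n) <= c) ->
  measurable (\bigcup_p \bigcap_(n in [set n | (p <= n)%N]) B n) /\
  P (\bigcup_p \bigcap_(n in [set n | (p <= n)%N]) B n) <= c.
Proof.
move=> mB PB; pose A p := \bigcap_(n in [set n | (p <= n)%N]) B n.
have mA p : measurable (A p) by apply: bigcap_measurable => //; exists p => /=.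
have mU : measurable (\bigcup_p A p) by exact: bigcup_measurable.
split=> //.
have cA : P (A p) @[p --> \oo] --> P (\bigcup_p A p).
  apply: nondecreasing_cvg_mu => //.
  move=> p q pq; apply/subsetPset => w Aw n /= qn.
  by apply: Aw => /=; exact: leq_trans pq qn.
rewrite -(cvg_lim _ cA)//; apply: lime_le => //.
  by apply/cvg_ex; eexists; exact: cA.
apply: nearW => p; apply: le_trans (PB p).
by apply: le_measure; rewrite ?inE; [exact: mA|exact: (mB p)|move=> w; apply => /=].
Qed.

End ProbabilityLimits.

Section StochintProperties.
Context {R : realType} {d : measure_display} {T : measurableType d}.
Variables (P : probability T R) (F : R -> set (set T)) (W : R -> T -> R).
Hypotheses (HF : filtration F) (HW : brownian P F W).

(** The integrand is multiplied by [a] before time [S] and by [b] afterwards; an integer [S] is a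
    node of every grid. With [a = 0] this isolates the increment after [S]; with general [a] and [b]
    it gives the joint exponential identities for the past and the increment. *)
Lemma stochint_cat (M Q : R -> T -> R) (a b : R) (S : nat) : stochint F W M Q ->
  stochint F W
    (fun t w => a * M (Num.min t S%:R) w + b * (M t w - M (Num.min t S%:R) w))
    (fun t w => a ^+ 2 * Q (Num.min t S%:R) w + b ^+ 2 * (Q t w - Q (Num.min t S%:R) w)).
Proof.
move=> [C [V [mV VC cV]]].
exists (Num.max `|a| `|b| * C), (fun n k w => (if (k < S * n.+1)%N then a else b) * V n k w).
split.
- by move=> n k; apply: fmeasM; [exact: fmeas_cst|exact: mV].
- move=> n k w; rewrite normrM ler_pM//.
  by case: ifP => _; rewrite le_max lexx ?orbT.
- move=> t w t0; have tS0 : 0 <= Num.min t S%:R by rewrite le_min t0/=.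
  have [cM cQ] := cV t w t0; have [cMS cQS] := cV _ w tS0.
  split.
  + have E n : dsum W n (fun k w => (if (k < S * n.+1)%N then a else b) * V n k w)
        (Num.truncn (t * n.+1%:R)) w =
      a * dsum W n (V n) (Num.truncn (Num.min t S%:R * n.+1%:R)) w +
      b * (dsum W n (V n) (Num.truncn (t * n.+1%:R)) w -
           dsum W n (V n) (Num.truncn (Num.min t S%:R * n.+1%:R)) w).
      rewrite truncn_min// /dsum.
      rewrite -(sum_split_coef a b _
        (fun k => V n k w * (W (mesh n k.+1) w - W (mesh n k) w))).
      by apply: eq_bigr => k _; rewrite mulrA.
    under eq_cvg do rewrite E.
    by apply: cvgD; apply: cvgMr => //; apply: cvgB.
  + have E n : dvar n (fun k w => (if (k < S * n.+1)%N then a else b) * V n k w)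
        (Num.truncn (t * n.+1%:R)) w =
      a ^+ 2 * dvar n (V n) (Num.truncn (Num.min t S%:R * n.+1%:R)) w +
      b ^+ 2 * (dvar n (V n) (Num.truncn (t * n.+1%:R)) w -
           dvar n (V n) (Num.truncn (Num.min t S%:R * n.+1%:R)) w).
      rewrite truncn_min// /dvar.
      rewrite -(sum_split_coef (a ^+ 2) (b ^+ 2) _ (fun k => (V n k w) ^+ 2 / n.+1%:R)).
      by apply: eq_bigr => k _; rewrite exprMn -mulrA; case: ifP.
    under eq_cvg do rewrite E.
    by apply: cvgD; apply: cvgMr => //; apply: cvgB.
Qed.

Lemma stochint_scale (M Q : R -> T -> R) (b : R) : stochint F W M Q ->
  stochint F W (fun t w => b * M t w) (fun t w => b ^+ 2 * Q t w).
Proof.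
move=> [C [V [mV VC cV]]]; exists (`|b| * C), (fun n k w => b * V n k w); split.
- by move=> n k; apply: fmeasM; [exact: fmeas_cst|exact: mV].
- by move=> n k w; rewrite normrM ler_wpM2l.
- move=> t w t0; have [cM cQ] := cV t w t0; split.
  + have E n : dsum W n (fun k w => b * V n k w) (Num.truncn (t * n.+1%:R)) w =
        b * dsum W n (V n) (Num.truncn (t * n.+1%:R)) w.
      by rewrite /dsum mulr_sumr; apply: eq_bigr => k _; rewrite mulrA.
    by under eq_cvg do rewrite E; exact: cvgMr.
  + have E n : dvar n (fun k w => b * V n k w) (Num.truncn (t * n.+1%:R)) w =
        b ^+ 2 * dvar n (V n) (Num.truncn (t * n.+1%:R)) w.
      by rewrite /dvar mulr_sumr; apply: eq_bigr => k _; rewrite exprMn mulrA.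
    by under eq_cvg do rewrite E; exact: cvgMr.
Qed.

Lemma stochint_var (M Q : R -> T -> R) : stochint F W M Q ->
  exists2 C : R, 0 <= C & forall s t w, 0 <= s -> s <= t -> 0 <= Q t w - Q s w <= C * t.
Proof.
move=> [C [V [mV VC cV]]]; exists (C ^+ 2); first exact: sqr_ge0.
move=> s t w s0 st; have t0 := le_trans s0 st.
have [_ cQs] := cV s w s0; have [_ cQt] := cV t w t0.
have cD : dvar n (V n) (Num.truncn (t * n.+1%:R)) w -
    dvar n (V n) (Num.truncn (s * n.+1%:R)) w @[n --> \oo] --> Q t w - Q s w.
  exact: cvgB.
have tr n : (Num.truncn (s * n.+1%:R) <= Num.truncn (t * n.+1%:R))%N.
  by apply: le_truncn; rewrite ler_wpM2r.
have V2 n k : 0 <= V n k w ^+ 2 / n.+1%:R <= C ^+ 2 / n.+1%:R.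
  rewrite divr_ge0 ?sqr_ge0//= ler_pM2r ?invr_gt0 ?ltr0n//.
  by rewrite -[V n k w ^+ 2]real_normK ?num_real// lerXn2r ?nnegrE// (le_trans _ (VC n k w)).
have E n : dvar n (V n) (Num.truncn (t * n.+1%:R)) w - dvar n (V n) (Num.truncn (s * n.+1%:R)) w
   = \sum_(Num.truncn (s * n.+1%:R) <= k < Num.truncn (t * n.+1%:R)) (V n k w ^+ 2 / n.+1%:R).
  rewrite /dvar -!(big_mkord xpredT (fun k => V n k w ^+ 2 / n.+1%:R)).
  by rewrite (big_cat_nat (n := Num.truncn (s * n.+1%:R)))//= addrAC subrr add0r.
apply/andP; split.
  apply: (cvg_ge_cst cD); apply: nearW => n /=; rewrite E.
  by apply: sumr_ge0 => k _; have /andP[] := V2 n k.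
apply: (cvg_le_cst cD); apply: nearW => n /=; rewrite E.
apply: (@le_trans _ _ (dvar n (fun _ _ => C) (Num.truncn (t * n.+1%:R)) w)).
  rewrite /dvar -(big_mkord xpredT (fun k => C ^+ 2 / n.+1%:R)).
  rewrite [leRHS](big_cat_nat (n := Num.truncn (s * n.+1%:R)))//=.
  rewrite -[leLHS]add0r lerD//.
    by apply: sumr_ge0 => k _; rewrite divr_ge0 ?sqr_ge0.
  by apply: ler_sum => k _; have /andP[] := V2 n k.
rewrite /dvar sumr_const card_ord -[leLHS]mulr_natr mulrAC -mulrA.
by rewrite ler_wpM2l ?sqr_ge0//; exact: mesh_truncn_le.
Qed.

End StochintProperties.

Section HalfLine.
Context {R : realType}.

Lemma continuous_halfline_cvg (f : R -> R) (u : nat -> R) (t : R) :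
  {within [set u : R | 0 <= u], continuous f} -> 0 <= t -> (forall n, 0 <= u n) ->
  u n @[n --> \oo] --> t -> f (u n) @[n --> \oo] --> f t.
Proof.
move=> /subspace_continuousP cf t0 u0 ut A /(cf t t0) H.
have {}H : nbhs t (fun x => 0 <= x -> A (f x)) := H.
have [N _ HN] := ut _ H.
by exists N => // n /= Nn; exact: HN n Nn (u0 n).
Qed.

Lemma mesh_truncn_cvg (t : R) : 0 <= t ->
  mesh n (Num.truncn (t * n.+1%:R)) @[n --> \oo] --> t.
Proof.
move=> t0; apply/cvgrPdist_le => e e0.
near=> n.
have n0 : 0 < n.+1%:R :> R by rewrite ltr0n.
rewrite ger0_norm ?subr_ge0 ?mesh_truncn_le// /mesh.
rewrite -(ler_pM2r n0) mulrBl divfK ?gt_eqF// lerBlDr.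
have /ltW := truncnS_gt (t * n.+1%:R).
rewrite -[(Num.truncn _).+1%:R]natr1 => h.
apply: (le_trans h); rewrite addrC lerD2r.
rewrite mulrC -ler_pdivrMr// mul1r.
apply: (@le_trans _ _ n%:R); last by rewrite ler_nat.
near: n; exact: nbhs_infty_ger.
Unshelve. all: by end_near. Qed.

Lemma sumr_inv_succ (n : nat) :
  \sum_(k < n) ((k.+1%:R * k.+2%:R)^-1 : R) = 1 - n.+1%:R^-1.
Proof.
elim: n => [|n IH]; first by rewrite big_ord0 invr1 subrr.
rewrite big_ord_recr/= IH; field.
by rewrite -!natr1 !gt_eqF// ?ltr_wpDl// ?addr_ge0.
Qed.

End HalfLine.

(** * Convergence of the stochastic integral and growth of Brownian motion *)

Section AlmostSureLimits.
Context {R : realType} {d : measure_display} {T : measurableType d}.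
Variables (P : probability T R) (F : R -> set (set T)) (W : R -> T -> R).
Hypotheses (HF : filtration F) (HW : brownian P F W).

Lemma stochint_ville2 (M Q : R -> T -> R) (a : R) : stochint F W M Q ->
  exists B, [/\ measurable B, (P B <= (2 * expR (- a))%:E)%E &
    forall w, ~ B w -> forall t, 0 <= t -> `|M t w| - Q t w / 2 <= a].
Proof.
move=> MQ.
have [B1 [mB1 PB1 B1P]] := stochint_ville HF HW a MQ.
have [B2 [mB2 PB2 B2P]] := stochint_ville HF HW a (stochint_scale (-1) MQ).
exists (B1 `|` B2); split; first exact: measurableU.
  apply: (le_trans (measureU2 _ mB1 mB2)).
  by rewrite mulr2n mulrDl mul1r EFinD; exact: leeD.
move=> w /not_orP[nB1 nB2] t t0.
have := B1P w nB1 t t0; have := B2P w nB2 t t0.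
rewrite sqrrN expr1n mul1r mulN1r => h2 h1.
by have [_|_] := ger0P (M t w); lra.
Qed.

Lemma negligible_small (A : set T) (B : nat -> set T) (c : R) : 0 <= c ->
  (forall k, measurable (B k)) -> (forall k, (P (B k) <= (c / k.+1%:R)%:E)%E) ->
  (forall k, A `<=` B k) -> P.-negligible A.
Proof.
move=> c0 mB PB AB; exists (\bigcap_k B k).
have mI : measurable (\bigcap_k B k) by exact: bigcapT_measurable.
split => //; last by move=> w Aw k _; exact: AB.
have PI k : (P (\bigcap_k B k) <= (c / k.+1%:R)%:E)%E.
  by apply: le_trans (PB k); apply: le_measure; rewrite ?inE//; move=> w; apply.
apply/eqP; rewrite eq_le measure_ge0 andbT.
rewrite -(fineK (fin_num_measure P _ mI)) lee_fin leNgt; apply/negP => p0.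
have := PI (Num.truncn (c / fine (P (\bigcap_k B k)))).
rewrite -(fineK (fin_num_measure P _ mI)) lee_fin leNgt => /negP; apply.
by rewrite ltr_pdivrMr ?ltr0n// mulrC -ltr_pdivrMr// truncnS_gt.
Qed.

(** The Ville inequality for [k.+1] times the increment after time [s], at level
    [k.+1 / (2 * j.+1)], bounds [|M_t - M_s|] by [1 / (2 * j.+1) + k.+1 * (Q_t - Q_s) / 2] off a set
    whose probability is small for large [k], uniformly in [s]. Where [Q] converges, a late [s]
    brings this bound down to [1 / j.+1], and [M] is Cauchy. *)
Lemma stochint_cvg (M Q : R -> T -> R) : stochint F W M Q ->
  {ae P, forall w, cvg (Q t w @[t --> +oo]) -> cvg (M t w @[t --> +oo])}.
Proof.
move=> MQ.
pose bad (p : nat * nat * nat) (B : set T) := let: (j, k, s) := p in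
  [/\ measurable B, (P B <= (2 * expR (- (k.+1%:R / (2 * j.+1%:R))))%:E)%E &
  forall w, ~ B w -> forall t, s%:R <= t ->
    k.+1%:R * `|M t w - M s%:R w| - k.+1%:R ^+ 2 * (Q t w - Q s%:R w) / 2 <=
      k.+1%:R / (2 * j.+1%:R)].
have /choice[B BP] : forall p, exists B, bad p B.
  move=> [[j k] s].
  have [B [mB PB BP]] := stochint_ville2 (k.+1%:R / (2 * j.+1%:R)) (stochint_cat 0 k.+1%:R s MQ).
  exists B; split=> // w nB t St.
  have t0 : 0 <= t by apply: le_trans St.
  have := BP w nB t t0; rewrite (min_idPr St).
  by rewrite expr0n /= !mul0r !add0r normrM ger0_norm.
(* Outside this lower limit infinitely many starting times [s] are good, so one can be taken beyond
   the time after which [Q] varies little. That time depends on [w], which is why a single [s] would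
   not do. *)
pose L j k := \bigcup_p \bigcap_(s in [set s | (p <= s)%N]) B (j, k, s).
have LP j k : measurable (L j k) /\
    (P (L j k) <= (2 * expR (- (k.+1%:R / (2 * j.+1%:R))))%:E)%E.
  by apply: liminf_measure_le => s; have [] := BP (j, k, s).
apply: (@negligibleS _ _ _ _ (\bigcup_j \bigcap_k L j k)); last first.
  apply: negligible_bigcup => j.
  apply: (@negligible_small _ (L j) (4 * j.+1%:R)).
  - by rewrite mulr_ge0.
  - by move=> k; have [] := LP j k.
  (* [exp (- x) <= 1 / x] makes the probabilities decay like [4 * j.+1 / k.+1]. *)
  - move=> k; apply: (le_trans (LP j k).2); rewrite lee_fin expRN.
    have e0 := expR_gt0 (k.+1%:R / (2 * j.+1%:R) : R).
    rewrite ler_pdivrMr// mulrAC ler_pdivlMr ?ltr0n//.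
    have := expR_ge1Dx (k.+1%:R / (2 * j.+1%:R) : R).
    set e := expR _ => h.
    have : k.+1%:R / (2 * j.+1%:R) <= e by apply: le_trans h; rewrite lerDr.
    rewrite ler_pdivrMr ?mulr_gt0 ?ltr0n// => h2.
    by apply: (le_trans (ler_wpM2l _ h2)) => //; rewrite le_eqVlt; apply/orP; left; apply/eqP; ring.
  - by move=> k w; apply.
move=> w /= /not_implyP[cQ ncM]; apply: contrapT => nN; apply: ncM.
apply/cauchy_cvgP; apply: cauchy_exP => e e0.
pose j := Num.truncn e^-1.
have je : j.+1%:R^-1 < e.
  by rewrite -[ltRHS]invrK ltf_pV2 ?posrE ?invr_gt0 ?ltr0n// truncnS_gt.
have [k nLk] : exists k, ~ L j k w.
  apply: contrapT => H; apply: nN; exists j => // k _.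
  by apply: contrapT => nL; apply: H; exists k.
move: cQ => /cvg_ex[q /cvgrPdist_lt/(_ (k.+1%:R * (2 * j.+1%:R))^-1)].
rewrite invr_gt0 ?mulr_gt0 ?ltr0n// => /(_ isT)[A [_ HA]].
have [s [pS nB]] : exists s, ((Num.truncn A).+1 <= s)%N /\ ~ B (j, k, s) w.
  apply: contrapT => H; apply: nLk; exists (Num.truncn A).+1 => // s /= pS.
  by apply: contrapT => nB; apply: H; exists s.
have [_ _ /(_ w nB) BS] := BP (j, k, s).
have AS : A < s%:R by rewrite (lt_le_trans (truncnS_gt _))// ler_nat.
exists (M s%:R w); exists s%:R; split => // t /= St; rewrite /ball /=.
have := BS t (ltW St).
have := HA _ AS; have := HA _ (lt_trans AS St) => /= h1 h2 h3.
rewrite distrC; apply: le_lt_trans je.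
have k0 : 0 < k.+1%:R :> R by rewrite ltr0n.
rewrite -(ler_pM2l k0); apply: le_trans (_ : _ <= k.+1%:R / (2 * j.+1%:R) +
  k.+1%:R ^+ 2 * (Q t w - Q s%:R w) / 2) _; first by rewrite -lerBlDr.
have j0 : 0 < j.+1%:R :> R by rewrite ltr0n.
have dQ : Q t w - Q s%:R w <= 2 * (k.+1%:R * (2 * j.+1%:R))^-1.
  move: h1 h2; set eta := (k.+1%:R * (2 * j.+1%:R))^-1.
  by rewrite !ltr_norml => /andP[? ?] /andP[? ?]; lra.
apply: (@le_trans _ _ (k.+1%:R / (2 * j.+1%:R) +
  k.+1%:R ^+ 2 * (2 * (k.+1%:R * (2 * j.+1%:R))^-1) / 2)).
  by rewrite lerD2l ler_pM2r// ler_wpM2l ?sqr_ge0.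
rewrite le_eqVlt; apply/orP; left; apply/eqP; field.
by rewrite !gt_eqF ?ltr0n.
Qed.

Lemma brownian_stochint : stochint F W W (fun t _ => t).
Proof.
exists 1, (fun _ _ _ => 1); split.
- by move=> n k; exact: fmeas_cst.
- by move=> n k w; rewrite normr1.
- move=> t w t0; split.
  + have E n m : dsum W n (fun _ _ => 1) m w = W (mesh n m) w.
      rewrite /dsum -(big_mkord xpredT (fun k => 1 * (W (mesh n k.+1) w - W (mesh n k) w))).
      under eq_bigr do rewrite mul1r.
      rewrite telescope_sumr// {2}/mesh mul0r.
      by have [W0 _] := HW; rewrite W0 subr0.
    under eq_cvg do rewrite E.
    apply: (@continuous_halfline_cvg _ (fun t => W t w)) => //.
    * by have [_ [cW _]] := HW; exact: cW.
    * by move=> n; exact: mesh_ge0.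
    * exact: mesh_truncn_cvg.
  + have E n m : dvar n (fun _ _ => 1) m w = mesh n m.
      by rewrite /dvar sumr_const card_ord expr1n mul1r -[LHS]mulr_natl.
    under eq_cvg do rewrite E.
    exact: mesh_truncn_cvg.
Qed.

(** An upper bound of iterated-logarithm type, with a crude constant. On the block
    [exp k <= t <= exp (k + 1)] the Ville inequality is used with level [a k], for which the failure
    probabilities [2 / ((k + 1) (k + 2))] are summable, and with the slope [th k] that makes [a k]
    and [th k ^+ 2 * t / 2] comparable. Borel-Cantelli leaves finitely many bad blocks. *)
Lemma brownian_growth : {ae P, forall w, exists C T0 : R,
  forall t, T0 <= t -> (W t w) ^+ 2 <= C * (t * ln (ln t))}.
Proof.
pose a k : R := ln (k.+1%:R * k.+2%:R).
pose th k : R := Num.sqrt (a k / expR k%:R).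
have p0 k : 0 < k.+1%:R * k.+2%:R :> R by rewrite mulr_gt0 ?ltr0n.
have a0 k : 0 < a k.
  by rewrite ln_gt0// -natrM ltr1n mulSn.
have th0 k : 0 < th k by rewrite sqrtr_gt0 divr_gt0 ?expR_gt0.
pose bad k (B : set T) := [/\ measurable B, (P B <= (2 * (k.+1%:R * k.+2%:R)^-1)%:E)%E &
  forall w, ~ B w -> forall t, 0 <= t -> th k * `|W t w| <= a k + th k ^+ 2 * t / 2].
have /choice[B BP] : forall k, exists B, bad k B.
  move=> k; have [B [mB PB BP]] := stochint_ville2 (a k) (stochint_scale (th k) brownian_stochint).
  exists B; split=> //.
    by move: PB; rewrite expRN lnK ?posrE.
  move=> w nB t t0; have := BP w nB t t0.
  by rewrite normrM (ger0_norm (ltW (th0 k))) lerBlDr.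
have mB k : measurable (B k) by have [] := BP k.
have PB0 : P (lim_sup_set B) = 0%E.
  apply: lim_sup_set_cvg0 => //.
  apply: (@le_lt_trans _ _ 2%:E); last exact: ltry.
  apply: lime_le; first by apply: is_cvg_nneseries => n _ _; exact: measure_ge0.
  apply: nearW => n.
  apply: (@le_trans _ _ (\sum_(0 <= k < n) (2 * (k.+1%:R * k.+2%:R)^-1)%:E)%E).
    by apply: lee_sum => k _; have [] := BP k.
  rewrite sumEFin lee_fin -mulr_sumr big_mkord sumr_inv_succ.
  by rewrite -[leRHS]mulr1 ler_wpM2l// gerBl invr_ge0.
exists (lim_sup_set B); split.
- by apply: bigcap_measurable; [exists 0%N|move=> n _; exact: bigcup_measurable].
- exact: PB0.
move=> w /= nH; apply: contrapT => nlim; apply: nH.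
have [p Hp] : exists p, forall k, (p <= k)%N -> ~ B k w.
  apply: contrapT => H; apply: nlim => p _; apply: contrapT => H2; apply: H.
  by exists p => k pk Bk; apply: H2; exists k.
(* On block [k] one has [t <= expR 1 * expR k%:R], hence [a k + th k ^+ 2 * t / 2 <= c * a k]. *)
pose c := 1 + expR 1 / 2 : R.
exists (c ^+ 2 * 4), (expR (maxn p 2).+1%:R) => t Tt.
have t0 : 0 < t by apply: lt_le_trans Tt; exact: expR_gt0.
have lt_ : (maxn p 2).+1%:R <= ln t by rewrite -ler_expR lnK.
pose k := Num.truncn (ln t).
have lt0 : 0 <= ln t by apply: le_trans lt_.
have /andP[kt tk] := truncn_itv lt0; rewrite -/k in kt tk.
have mk : (maxn p 2 <= k)%N.
  by rewrite truncn_ge_nat//; apply: le_trans lt_; rewrite ler_nat.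
have pk : (p <= k)%N by apply: leq_trans mk; exact: leq_maxl.
have k2 : (2 <= k)%N by apply: leq_trans mk; exact: leq_maxr.
have [_ _ /(_ w (Hp k pk) t (ltW t0)) BW] := BP k.
have ekt : expR k%:R <= t by rewrite -[leRHS]lnK ?posrE// ler_expR.
have tek : t <= expR 1 * expR k%:R.
  rewrite -expRD -[leLHS]lnK ?posrE// ler_expR nat1r; exact: ltW.
have ek0 := expR_gt0 (k%:R : R).
have th2 : th k ^+ 2 = a k / expR k%:R by rewrite sqr_sqrtr// divr_ge0 ?ltW.
have BW2 : th k * `|W t w| <= c * a k.
  apply: (le_trans BW); rewrite th2 /c mulrDl mul1r lerD2l.
  have -> : a k / expR k%:R * t / 2 = t / expR k%:R * (a k / 2) by ring.
  have -> : expR 1 / 2 * a k = expR 1 * (a k / 2) by ring.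
  by rewrite ler_wpM2r ?divr_ge0 ?(ltW (a0 k))// ler_pdivrMr.
have : (th k * `|W t w|) ^+ 2 <= (c * a k) ^+ 2.
  have c0 : 0 <= c by rewrite /c addr_ge0// divr_ge0// ltW// expR_gt0.
  by apply: lerXn2r BW2; rewrite nnegrE mulr_ge0// ltW.
rewrite !exprMn th2 real_normK ?num_real// => h.
have W2 : W t w ^+ 2 <= c ^+ 2 * (a k * expR k%:R).
  rewrite -(ler_pM2l (divr_gt0 (a0 k) ek0)); apply: (le_trans h).
  rewrite le_eqVlt; apply/orP; left; apply/eqP; field.
  by rewrite gt_eqF.
apply: (le_trans W2); rewrite -mulrA ler_wpM2l ?sqr_ge0//.
have lk0 : 0 < ln (k%:R : R) by rewrite ln_gt0// ltr1n.
(* From [(k + 1) (k + 2) <= k ^ 4], true from [k = 2] on; hence the maximum with 2 in the starting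
   time. *)
have ak : a k <= 4 * ln k%:R.
  have -> : 4 * ln (k%:R : R) = ln (k%:R ^+ 4) by rewrite lnXn ?mulr_natl// ltr0n (leq_trans _ k2).
  rewrite /a ler_ln ?posrE ?exprn_gt0 ?ltr0n ?(leq_trans _ k2)//.
  rewrite -natrM -natrX ler_nat.
  have h1 : (k.+2 <= k ^ 2)%N.
    apply: (@leq_trans (k * 2)%N); first by rewrite muln2 -addnn -addn2 leq_add2l.
    by rewrite -mulnn leq_mul2l k2 orbT.
  have h2 : (k.+1 <= k ^ 2)%N by apply: leq_trans h1.
  by rewrite (_ : 4 = 2 + 2)%N// expnD leq_mul.
have lnk : ln (k%:R : R) <= ln (ln t) by rewrite ler_ln// posrE ?ltr0n ?(leq_trans _ k2)// (lt_le_trans _ kt)// ltr0n (leq_trans _ k2).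
apply: (@le_trans _ _ (4 * ln k%:R * t)).
  by apply: ler_pM => //; exact: (ltW (a0 k)).
rewrite -mulrA ler_wpM2l// mulrC ler_wpM2l// ltW//.
Qed.

(** The exceptional set depends on [W] alone, so the quantifier over [x] stands inside the almost
    sure statement and [x] may be the path of a strategy at the same [w]. *)
Lemma brownian_product_cvg0 : {ae P, forall w, forall x : R -> R,
  (fun t => (x t) ^+ 2 * t * ln (ln t)) @ +oo --> 0 -> x t * W t w @[t --> +oo] --> 0}.
Proof.
apply: filterS brownian_growth => w [C [T0 WC]] x /cvgrPdist_lt x0.
apply/cvgrPdist_lt => e e0.
have C0 : 0 < `|C| + 1 by rewrite ltr_wpDl.
have /x0 : 0 < e ^+ 2 / (`|C| + 1) by rewrite divr_gt0 ?exprn_gt0.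
move=> Hx; near=> t.
rewrite sub0r normrN -(@ltr_pXn2r _ 2)// ?nnegrE ?(ltW e0)// real_normK ?num_real// exprMn.
have : `|0 - x t ^+ 2 * t * ln (ln t)| < e ^+ 2 / (`|C| + 1) by near: t.
rewrite sub0r normrN ltr_pdivlMr// => h.
apply: (le_lt_trans _ h).
apply: (@le_trans _ _ (x t ^+ 2 * (C * (t * ln (ln t))))).
  by rewrite ler_wpM2l ?sqr_ge0//; apply: WC; near: t; apply: nbhs_pinfty_ge; exact: num_real.
have -> : x t ^+ 2 * (C * (t * ln (ln t))) = (x t ^+ 2 * t * ln (ln t)) * C by ring.
apply: (le_trans (ler_norm _)); rewrite normrM ler_wpM2l// lerDl//.
Unshelve. all: by end_near. Qed.

End AlmostSureLimits.

(** * Moments from exponential moments *)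

Section HyperbolicBounds.
Context {R : realType}.
Implicit Types x y c : R.

(** [sh] and [ch] are twice the hyperbolic sine and cosine. Since [2 cosh x - 2] is the square of
    [sh (x / 2)], the mean value bounds [2 y <= sh y <= y * ch y] give both comparisons with
    [x ^+ 2]. *)
Let sh y := expR y - expR (- y).
Let ch y := expR y + expR (- y).

Let ch_ge2 y : 2 <= ch y.
Proof.
rewrite /ch; have := expR_gt0 (- y); have : expR y * expR (- y) = 1 by rewrite -expRD subrr expR0.
set a := expR y; set b := expR (- y) => ab b0; rewrite -subr_ge0.
have -> : a + b - 2 = (a - 1) ^+ 2 * b.
  have -> : (a - 1) ^+ 2 * b = a * (a * b) - 2 * (a * b) + b by ring.
  by rewrite ab; ring.
by rewrite mulr_ge0 ?sqr_ge0// ltW.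
Qed.

Let ch_le c y : 0 <= c -> c <= y -> ch c <= ch y.
Proof.
move=> c0 cy; rewrite -subr_ge0 /ch.
have -> : expR y + expR (- y) - (expR c + expR (- c)) =
    (expR y - expR c) * (1 - expR (- y) * expR (- c)).
  have -> : (expR y - expR c) * (1 - expR (- y) * expR (- c)) =
    expR y - expR c - (expR y * expR (- y)) * expR (- c) + (expR c * expR (- c)) * expR (- y) by ring.
  by rewrite -[expR y * expR (- y)]expRD -[expR c * expR (- c)]expRD !subrr !expR0; ring.
apply: mulr_ge0; first by rewrite subr_ge0 ler_expR.
by rewrite -expRD subr_ge0 -expR0 ler_expR; lra.
Qed.

Let sh_bounds y : 0 <= y -> 2 * y <= sh y <= y * ch y.
Proof.
rewrite le_eqVlt => /orP[/eqP <-|y0].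
  by rewrite /sh oppr0 subrr mulr0 mul0r lexx.
have dsh x : is_derive x 1 sh (ch x).
  have dN : is_derive x 1 (fun z => expR (- z)) (expR (- x) * -1).
    exact: (@is_derive1_comp _ expR -%R x _ _).
  rewrite /sh /ch (_ : expR x + _ = expR x - expR (- x) * -1); last by rewrite mulrN1 opprK.
  exact: is_deriveB.
have [c cy] : exists2 c, c \in `]0, y[%R & sh y - sh 0 = ch c * (y - 0).
  apply: (@MVT _ sh ch 0 y y0).
  apply: continuous_subspaceT => z; apply: differentiable_continuous.
  by apply/derivable1_diffP; case: (dsh z).
move: cy; rewrite in_itv/= => /andP[c0 cy].
have sh0 : sh 0 = 0 by rewrite /sh oppr0 subrr.
rewrite sh0 !subr0 => ->.
rewrite ler_pM2r// ch_ge2/= mulrC ler_pM2l//.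
by apply: ch_le; exact: ltW.
Qed.

Let halves x : [/\ expR x = expR (x / 2) ^+ 2, expR (- x) = expR (- (x / 2)) ^+ 2 &
  expR (x / 2) * expR (- (x / 2)) = 1].
Proof. by rewrite !expr2 -!expRD -opprD -splitr subrr expR0. Qed.

Let shsq x : expR x + expR (- x) - 2 = sh (x / 2) ^+ 2.
Proof.
rewrite /sh; have [-> -> ab] := halves x.
by rewrite sqrrB ab; ring.
Qed.

Let chsq x : expR x + expR (- x) + 2 = ch (x / 2) ^+ 2.
Proof.
rewrite /ch; have [-> -> ab] := halves x.
by rewrite sqrrD ab; ring.
Qed.

Lemma sqr_le_cosh x : x ^+ 2 <= expR x + expR (- x) - 2.
Proof.
wlog x0 : x / 0 <= x.
  move=> H; have [|/ltW x0] := leP 0 x; first exact: H.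
  have := H (- x); rewrite oppr_ge0 => /(_ x0).
  by rewrite sqrrN opprK [expR (- x) + _]addrC.
rewrite shsq; have /sh_bounds/andP[h _] : 0 <= x / 2 by rewrite divr_ge0.
have {1}-> : x = 2 * (x / 2) by field.
by apply: lerXn2r; rewrite ?nnegrE// ?(le_trans _ h)// mulr_ge0// divr_ge0.
Qed.

Lemma cosh_le_sqr x : expR x + expR (- x) - 2 <= x ^+ 2 * (expR x + expR (- x) + 2) / 4.
Proof.
wlog x0 : x / 0 <= x.
  move=> H; have [|/ltW x0] := leP 0 x; first exact: H.
  by have := H (- x); rewrite oppr_ge0 => /(_ x0); rewrite sqrrN opprK ![expR (- x) + _]addrC.
have h2 : 0 <= x / 2 by rewrite divr_ge0.
have /andP[h1 h] := sh_bounds h2.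
have -> : x ^+ 2 * (expR x + expR (- x) + 2) / 4 = (x / 2 * ch (x / 2)) ^+ 2.
  rewrite chsq.
  by field.
have s0 : 0 <= sh (x / 2) by apply: le_trans h1; rewrite mulr_ge0.
by rewrite shsq; apply: lerXn2r; rewrite ?nnegrE// (le_trans s0).
Qed.

End HyperbolicBounds.

Section Expectations.
Context {R : realType} {d : measure_display} {T : measurableType d}.
Variables (P : probability T R).
Local Open Scope ereal_scope.

Definition integrable_rv (f : T -> R) := P.-integrable setT (fun w => (f w)%:E).

Lemma integrable_rv_le (f : T -> R) (g : T -> R) : measurable_fun setT f -> (forall w, `|f w| <= g w)%R -> integrable_rv g -> integrable_rv f.
Proof.
move=> mf fg ig_g; apply: le_integrable ig_g => //; first exact/measurable_EFinP.
by move=> w _ /=; rewrite lee_fin (le_trans (fg w))// ler_norm.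
Qed.

Lemma integrable_rvD (f : T -> R) (g : T -> R) : integrable_rv f -> integrable_rv g -> integrable_rv (fun w => f w + g w)%R.
Proof. by move=> f_ g_; rewrite /integrable_rv; under eq_fun do rewrite EFinD; exact: integrableD. Qed.

Lemma integrable_rvZ (c : R) (f : T -> R) : integrable_rv f -> integrable_rv (fun w => c * f w)%R.
Proof. by move=> f_; rewrite /integrable_rv; under eq_fun do rewrite EFinM; exact: integrableZl. Qed.

Lemma integrable_rv_cst (c : R) : integrable_rv (fun=> c).
Proof. exact: finite_measure_integrable_cst. Qed.

Lemma integrable_rv_ge0 (f : T -> R) (c : \bar R) : measurable_fun setT f -> (forall w, 0 <= f w)%R ->
  c < +oo -> \int[P]_w (f w)%:E <= c -> integrable_rv f.
Proof.
move=> mf f0 coo fc; apply/integrableP; split; first exact/measurable_EFinP.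
under eq_integral do rewrite gee0_abs ?lee_fin//.
exact: le_lt_trans coo.
Qed.

Definition mean (f : T -> R) : R := fine (\int[P]_w (f w)%:E).

Lemma meanE (f : T -> R) : integrable_rv f -> \int[P]_w (f w)%:E = (mean f)%:E.
Proof. by move=> f_; rewrite fineK//; exact: integrable_fin_num. Qed.

Lemma meanD (f : T -> R) (g : T -> R) : integrable_rv f -> integrable_rv g -> mean (fun w => f w + g w)%R = (mean f + mean g)%R.
Proof.
move=> f_ g_; rewrite /mean; under eq_integral do rewrite EFinD.
by rewrite integralD// fineD//; exact: integrable_fin_num.
Qed.

Lemma meanZ (c : R) (f : T -> R) : integrable_rv f -> mean (fun w => c * f w)%R = (c * mean f)%R.
Proof.
move=> f_; rewrite /mean; under eq_integral do rewrite EFinM.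
by rewrite integralZl// fineM//; exact: integrable_fin_num.
Qed.

Lemma mean_cst c : mean (fun=> c) = c.
Proof. by rewrite /mean integral_cst//= probability_setT mule1. Qed.

Lemma mean_le (f : T -> R) (g : T -> R) : integrable_rv f -> integrable_rv g -> (forall w, f w <= g w)%R -> (mean f <= mean g)%R.
Proof.
move=> f_ g_ fg; rewrite -lee_fin -!meanE//.
by apply: le_integral_ae => //; apply: nearW => w _; rewrite lee_fin.
Qed.

Lemma le_quadratic_eq0 (m c : R) : (0 <= c)%R ->
  (forall b, b * m <= b ^+ 2 * c)%R -> m = 0%R.
Proof.
move=> c0 H; apply/eqP; rewrite -sqrf_eq0 eq_le sqr_ge0 andbT.
have c1 : (0 < c + 1)%R by rewrite ltr_wpDl.
have := H (m / (c + 1))%R; rewrite -(ler_pM2r (exprn_gt0 2 c1)).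
have -> : (m / (c + 1) * m * (c + 1) ^+ 2 = m ^+ 2 * (c + 1))%R by field; rewrite gt_eqF.
have -> : ((m / (c + 1)) ^+ 2 * c * (c + 1) ^+ 2 = m ^+ 2 * c)%R by field; rewrite gt_eqF.
by rewrite mulrDr mulr1 gerDl.
Qed.

Section ExponentialMoments.
Variables (G D q : T -> R) (c K : R).
Hypotheses (mG : measurable_fun setT G) (mD : measurable_fun setT D)
  (mq : measurable_fun setT q).
Hypotheses (G0 : forall w, (0 <= G w)%R) (q0 : forall w, (0 <= q w <= c)%R).
Hypothesis G2 : \int[P]_w ((G w) ^+ 2)%:E <= K%:E.
Hypothesis GD : forall b : R,
  \int[P]_w (G w * expR (b * D w - b ^+ 2 * q w / 2))%:E = 1.
Hypothesis D1 : forall b : R, \int[P]_w (expR (b * D w - b ^+ 2 * q w / 2))%:E = 1.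

Hypothesis c0 : (0 <= c)%R.

Let mexp b : measurable_fun setT (fun w => expR (b * D w - b ^+ 2 * q w / 2)).
Proof.
apply: measurableT_comp => //; apply: measurable_funB; first exact: measurable_funM.
by apply: measurable_funM => //; exact: measurable_funM.
Qed.

Let igexp b : integrable_rv (fun w => expR (b * D w - b ^+ 2 * q w / 2)).
Proof. by apply: (@integrable_rv_ge0 _ 1); rewrite ?D1// ?ltry// => w; exact: expR_ge0. Qed.

Let igq : integrable_rv q.
Proof.
apply: (integrable_rv_le mq _ (integrable_rv_cst c)) => w; have /andP[h1 h2] := q0 w.
by rewrite ger0_norm.
Qed.

(** Only the identities at [b] and [- b] are used. With [u = b^2 q / 2 <= 1 / 2], multiplying
    [b^2 D^2 <= 2 cosh (b D) - 2] by [exp (- u) >= 1 - u >= 1 / 2] bounds [D^2] by an explicit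
    combination [h], whose mean is [2 * mean q]. The lost factor 2 is harmless where only a uniform
    second-moment bound is wanted. *)
Lemma exponential_sqr : integrable_rv (fun w => D w ^+ 2)%R /\ (mean (fun w => D w ^+ 2)%R <= 2 * mean q)%R.
Proof.
(* This choice gives [b ^+ 2 * q w <= 1]. *)
pose b := (Num.sqrt (c + 1))^-1%R.
have c1 : (0 < c + 1)%R by rewrite ltr_wpDl.
have b2 : (b ^+ 2 = (c + 1)^-1)%R by rewrite exprVn sqr_sqrtr// ltW.
have b20 : (0 < b ^+ 2)%R by rewrite b2 invr_gt0.
have bn0 : b != 0%R by rewrite -sqrf_eq0 gt_eqF.
pose h w := (2 / b ^+ 2 * ((expR (b * D w - b ^+ 2 * q w / 2) +
   expR (- b * D w - (- b) ^+ 2 * q w / 2)) + (b ^+ 2 * q w + (- 2))))%R.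
have igh : integrable_rv h by apply: integrable_rvZ; apply: integrable_rvD; apply: integrable_rvD; [exact: igexp|exact: igexp|exact: integrable_rvZ|exact: integrable_rv_cst].
have Dh w : (D w ^+ 2 <= h w)%R.
  have /andP[qw0 qwc] := q0 w.
  have u0 : (0 <= b ^+ 2 * q w / 2)%R by rewrite divr_ge0// mulr_ge0// ltW.
  have u1 : (b ^+ 2 * q w / 2 <= 1 / 2)%R.
    rewrite ler_pM2r ?invr_gt0// b2 mulrC ler_pdivrMr// mul1r.
    by apply: (le_trans qwc); rewrite lerDl.
  rewrite /h sqrrN mulNr; set u := (b ^+ 2 * q w / 2)%R in u0 u1 *.
  rewrite !expRD -mulrDl; have := expR_ge1Dx (- u); have := sqr_le_cosh (b * D w)%R.
  set E := (_ + expR (- (b * D w)))%R; set eu := expR (- u) => hE heu.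
  have bq : (b ^+ 2 * q w = 2 * u)%R by rewrite /u; field.
  rewrite bq; set Y := (Z in (2 / b ^+ 2 * Z)%R); rewrite -(ler_pM2l b20).
  have -> : (b ^+ 2 * (2 / b ^+ 2 * Y) = 2 * Y)%R by field.
  rewrite /Y.
  rewrite exprMn in hE; have := sqr_ge0 (D w); set x := (b ^+ 2 * D w ^+ 2)%R in hE *.
  move=> D2; have x0 : (0 <= x)%R by rewrite mulr_ge0// ltW.
  have : ((1 - u) * (x + 2) <= eu * E)%R by apply: ler_pM; lra.
  by rewrite mulrC [(E * eu)%R]mulrC; nra.
have igD2 : integrable_rv (fun w => D w ^+ 2)%R.
  apply: integrable_rv_le igh; first exact: measurable_funX.
  by move=> w; rewrite ger0_norm ?sqr_ge0.
split => //; apply: le_trans (mean_le igD2 igh Dh) _.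
rewrite /h meanZ; last by apply: integrable_rvD; apply: integrable_rvD; [exact: igexp|exact: igexp|exact: integrable_rvZ|exact: integrable_rv_cst].
rewrite meanD; last 2 first.
- by apply: integrable_rvD; exact: igexp.
- by apply: integrable_rvD; [exact: integrable_rvZ|exact: integrable_rv_cst].
rewrite !meanD ?mean_cst ?meanZ//; [|exact: integrable_rvZ|exact: integrable_rv_cst].
rewrite {1 2}/mean !D1 /= le_eqVlt; apply/orP; left; apply/eqP; field.
exact: bn0.
Qed.

(** The first-order term in [b]: integrating [G exp (b D - b^2 q / 2) >= G (1 + b D - b^2 c / 2)]
    gives [b * mean (G D) <= b^2 c / 2] for every real [b], which forces the mean to vanish. *)
Lemma exponential_orth : integrable_rv (fun w => G w * D w)%R /\ mean (fun w => G w * D w)%R = 0%R.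
Proof.
have [igD2 _] := exponential_sqr.
have igG2 : integrable_rv (fun w => G w ^+ 2)%R.
  by apply: (integrable_rv_ge0 _ _ (ltry K) G2); [exact: measurable_funX|move=> w; exact: sqr_ge0].
have igGD : integrable_rv (fun w => G w * D w)%R.
  apply: integrable_rv_le (integrable_rvD igG2 igD2); first exact: measurable_funM.
  move=> w; rewrite normrM -[(G w ^+ 2)%R]real_normK ?num_real//.
  rewrite -[(D w ^+ 2)%R]real_normK ?num_real//.
  have := sqr_ge0 (`|G w| - `|D w|)%R.
  have := normr_ge0 (G w); have := normr_ge0 (D w); nra.
split=> //.
have igGexp b : integrable_rv (fun w => G w * expR (b * D w - b ^+ 2 * q w / 2))%R.
  apply: (@integrable_rv_ge0 _ 1); rewrite ?GD ?ltry//; first exact: measurable_funM.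
  by move=> w; rewrite mulr_ge0// expR_ge0.
have GE w : (G w * expR (0 * D w - 0 ^+ 2 * q w / 2) = G w)%R.
  by rewrite expr0n /= !mul0r subrr expR0 mulr1.
have igG : integrable_rv G by have := igGexp 0%R; rewrite /integrable_rv; under eq_fun do rewrite GE.
have ExG : mean G = 1%R.
  by have := GD 0%R; rewrite /mean; under eq_integral do rewrite GE; move=> ->.
apply: (@le_quadratic_eq0 _ (c / 2)%R); first by rewrite divr_ge0.
move=> b.
have := mean_le (integrable_rvD (integrable_rvZ (1 - b ^+ 2 * (c / 2))%R igG) (integrable_rvZ b igGD)) (igGexp b).
rewrite meanD ?meanZ ?ExG//; [|exact: integrable_rvZ|exact: integrable_rvZ].
have -> : mean (fun w => G w * expR (b * D w - b ^+ 2 * q w / 2))%R = 1%R by rewrite /mean GD.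
rewrite mulr1 => H.
suff /H : forall w, ((1 - b ^+ 2 * (c / 2)) * G w + b * (G w * D w) <=
    G w * expR (b * D w - b ^+ 2 * q w / 2))%R by lra.
move=> w; have := expR_ge1Dx (b * D w - b ^+ 2 * q w / 2)%R; set e := expR _ => he.
apply: (@le_trans _ _ (G w * (1 + (b * D w - b ^+ 2 * q w / 2)))%R); last by rewrite ler_wpM2l.
have -> : ((1 - b ^+ 2 * (c / 2)) * G w + b * (G w * D w) =
  G w * (1 + (b * D w - b ^+ 2 * c / 2)))%R by ring.
have /andP[_ qc] := q0 w.
rewrite ler_wpM2l// lerD2l lerD2l lerN2 ler_pM2r ?invr_gt0//.
by rewrite ler_wpM2l// sqr_ge0.
Qed.

End ExponentialMoments.

End Expectations.

Section GaussianMoments.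
Context {R : realType} {d : measure_display} {T : measurableType d}.
Variables (P : probability T R) (Z : T -> R) (q : R).
Hypotheses (mZ : measurable_fun setT Z) (q0 : 0 <= q).
Hypothesis ZE : forall b : R,
  (\int[P]_w (expR (b * Z w - b ^+ 2 * q / 2))%:E = 1)%E.

Let m1 : measurable_fun [set: T] (cst (1 : R)).
Proof. exact: measurable_cst. Qed.

Let mq : measurable_fun [set: T] (cst q).
Proof. exact: measurable_cst. Qed.

Let one_ge0 (w : T) : 0 <= cst (1 : R) w. Proof. by []. Qed.
Let q_bound (w : T) : 0 <= cst q w <= q. Proof. by rewrite /= q0 lexx. Qed.

Let one2 : (\int[P]_w ((cst (1 : R) w) ^+ 2)%:E <= 1%:E)%E.
Proof. by under eq_integral do rewrite /= expr1n; rewrite integral_cst// mul1e; exact: probability_le1. Qed.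

Let ZE1 (b : R) : (\int[P]_w (cst 1 w * expR (b * Z w - b ^+ 2 * cst q w / 2))%:E = 1)%E.
Proof. by under eq_integral do rewrite /= mul1r; exact: ZE. Qed.

Lemma gaussian_mean : integrable_rv P Z /\ mean P Z = 0.
Proof.
have := exponential_orth m1 mZ mq one_ge0 q_bound one2 ZE1 ZE q0.
by rewrite /integrable_rv /mean; under eq_fun do rewrite /= mul1r.
Qed.

Let igexp b : integrable_rv P (fun w => expR (b * Z w)).
Proof.
have h : integrable_rv P (fun w => expR (b * Z w - b ^+ 2 * q / 2)).
  apply: (@integrable_rv_ge0 _ _ _ _ _ 1%E); rewrite ?ZE ?ltry//.
  by apply: measurableT_comp => //; apply: measurable_funB => //; exact: measurable_funM.
have := integrable_rvZ (expR (b ^+ 2 * q / 2)) h; rewrite /integrable_rv.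
by under eq_fun do rewrite -expRD addrC subrK.
Qed.

Let Exexp b : mean P (fun w => expR (b * Z w)) = expR (b ^+ 2 * q / 2).
Proof.
have : mean P (fun w => expR (b * Z w - b ^+ 2 * q / 2)) = 1 by rewrite /mean ZE.
under eq_fun do rewrite addrC expRD; rewrite meanZ// expRN => /(canRL (mulKf _)) ->.
  by rewrite mulr1 invrK.
by rewrite invr_neq0// gt_eqF// expR_gt0.
Qed.

Let igZ2 : integrable_rv P (fun w => Z w ^+ 2).
Proof. by have [] := exponential_sqr mZ mq q_bound ZE q0. Qed.

(** With [u = b^2 q / 2], the mean of [b^2 Z^2 <= 2 cosh (b Z) - 2] is at most [2 exp u - 2], and
    [(1 - u) exp u <= 1] turns this into [(1 - u) v <= q]. Taking [b] small, depending on [v]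
    itself, makes [u v <= e]. *)
Let sqr_up : mean P (fun w => Z w ^+ 2) <= q.
Proof.
set v := mean P _.
have v0 : 0 <= v.
  have := mean_le (integrable_rv_cst P 0) igZ2 (fun w => sqr_ge0 (Z w)).
  by rewrite mean_cst.
apply/ler_addgt0Pr => e e0.
pose b := Num.sqrt (Num.min (q + 1)^-1 (e / (q * v + 1))).
have k0 : 0 < q * v + 1 by rewrite ltr_wpDl// mulr_ge0.
have q1 : 0 < q + 1 by rewrite ltr_wpDl.
have m0 : 0 < Num.min (q + 1)^-1 (e / (q * v + 1)) by rewrite lt_min invr_gt0 q1 divr_gt0.
have b2 : b ^+ 2 = Num.min (q + 1)^-1 (e / (q * v + 1)) by rewrite sqr_sqrtr// ltW.
have b20 : 0 < b ^+ 2 by rewrite b2.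
have bq : b ^+ 2 * q <= 1.
  apply: (@le_trans _ _ ((q + 1)^-1 * q)); first by rewrite ler_wpM2r// b2 ge_min lexx.
  by rewrite mulrC ler_pdivrMr// mul1r lerDl.
have be : b ^+ 2 * (q * v) <= e.
  apply: (@le_trans _ _ (e / (q * v + 1) * (q * v))).
    by rewrite ler_wpM2r ?mulr_ge0// b2 ge_min lexx orbT.
  by rewrite mulrAC ler_pdivrMr// ler_wpM2l ?lerDl// ltW.
have H : b ^+ 2 * v <= 2 * expR (b ^+ 2 * q / 2) - 2.
  have igs : integrable_rv P (fun w => expR (b * Z w) + expR (- b * Z w) + (- 2)).
    by apply: integrable_rvD; [apply: integrable_rvD; exact: igexp|exact: integrable_rv_cst].
  have := mean_le (integrable_rvZ (b ^+ 2) igZ2) igs.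
  rewrite meanZ// meanD; [|by apply: integrable_rvD; exact: igexp|exact: integrable_rv_cst].
  rewrite meanD// !Exexp mean_cst sqrrN -/v => H; apply: le_trans (H _) _; last by rewrite mulr2n mulrDl mul1r.
  by move=> w; have := sqr_le_cosh (b * Z w); rewrite exprMn mulNr.
have u0 : 0 <= b ^+ 2 * q / 2 by rewrite divr_ge0// mulr_ge0// sqr_ge0.
have u1 : (1 - b ^+ 2 * q / 2) * expR (b ^+ 2 * q / 2) <= 1.
  have := expR_ge1Dx (- (b ^+ 2 * q / 2)); rewrite expRN => h.
  by rewrite -ler_pdivlMr ?expR_gt0// mul1r.
set u := b ^+ 2 * q / 2 in H u0 u1.
have uE : b ^+ 2 * q = 2 * u by rewrite /u; field.
have u12 : 0 < 1 - u by move: bq; rewrite uE; lra.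
have h1 : (1 - u) * (b ^+ 2 * v) <= 2 * u.
  apply: (le_trans (ler_wpM2l (ltW u12) H)); lra.
rewrite -uE in h1.
have h2 : (1 - u) * v <= q.
  by rewrite -(ler_pM2l b20); apply: le_trans h1; rewrite mulrCA.
have : u * v <= e by rewrite /u; lra.
lra.
Qed.

(** The converse comparison bounds [(2 cosh (b Z) - 2) / b^2], whose mean is at least [q], by [f n].
    These functions tend to [Z ^+ 2] as [b] tends to 0, under a common bound. *)
Let sqr_low : q <= mean P (fun w => Z w ^+ 2).
Proof.
pose b n : R := n.+1%:R^-1.
have b0 n : 0 < b n by rewrite invr_gt0 ltr0n.
have b1 n : b n <= 1 by rewrite invf_le1 ?ltr0n// ler1n.
pose f n w := Z w ^+ 2 * (expR (b n * Z w) + expR (- b n * Z w) + 2) / 4.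
(* Both factors of [f n] are bounded through [exp Z + exp (- Z)]: the square by [sqr_le_cosh], the
   exponentials because [b n <= 1]. Their product accounts for the exponents [2] and [- 2]. *)
pose g w := expR (2 * Z w) + expR (- 2 * Z w) + (expR (1 * Z w) + expR (- 1 * Z w) + 2).
have igg : integrable_rv P g by apply: integrable_rvD; [apply: integrable_rvD; exact: igexp|apply: integrable_rvD; [apply: integrable_rvD; exact: igexp|exact: integrable_rv_cst]].
have mf n : measurable_fun setT (f n).
  apply: measurable_funM => //; apply: measurable_funM; first exact: measurable_funX.
  apply: measurable_funD => //; apply: measurable_funD;
    by apply: measurableT_comp => //; exact: measurable_funM.
have f0 n w : 0 <= f n w by rewrite /f divr_ge0// mulr_ge0 ?sqr_ge0// !addr_ge0// expR_ge0.
have fg n w : f n w <= g w.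
  have ze : Z w ^+ 2 <= expR (Z w) + expR (- Z w).
    by apply: le_trans (sqr_le_cosh _) _; rewrite gerDl oppr_le0.
  have bb (c : R) : `|c| <= 1 -> expR (c * Z w) <= expR (Z w) + expR (- Z w).
    move=> c1; have : c * Z w <= `|Z w|.
      by apply: (le_trans (ler_norm _)); rewrite normrM ler_piMl.
    have := expR_ge0 (Z w); have := expR_ge0 (- Z w).
    rewrite -ler_expR; case: (ger0P (Z w)) => _; lra.
  have h1 := bb (b n) _; have h2 := bb (- b n) _.
  rewrite normrN in h2; rewrite (gtr0_norm (b0 n)) in h1 h2.
  have {}h1 := h1 (b1 n); have {}h2 := h2 (b1 n).
  rewrite /f /g !mul1r !mulN1r.
  have -> : expR (2 * Z w) = expR (Z w) ^+ 2 by rewrite -expRM_natl.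
  have -> : expR (- 2 * Z w) = expR (- Z w) ^+ 2 by rewrite -expRM_natl mulrN mulNr.
  have ee : expR (Z w) * expR (- Z w) = 1 by rewrite -expRD subrr expR0.
  have e0 := expR_ge0 (Z w); have e1 := expR_ge0 (- Z w).
  set a := expR (Z w) in ze h1 h2 ee e0 *; set a' := expR (- Z w) in ze h1 h2 ee e1 *.
  set y1 := expR (b n * Z w) in h1 *; set y2 := expR (- b n * Z w) in h2 *.
  have y10 : 0 <= y1 by exact: expR_ge0.
  have y20 : 0 <= y2 by exact: expR_ge0.
  have : Z w ^+ 2 * (y1 + y2 + 2) <= (a + a') * (2 * (a + a') + 2).
    by apply: ler_pM; rewrite ?sqr_ge0//; lra.
  have -> : (a + a') * (2 * (a + a') + 2) = 2 * (a ^+ 2 + a' ^+ 2) + 4 * (a * a') + 2 * (a + a') by ring.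
  have := sqr_ge0 a; have := sqr_ge0 a'.
  rewrite ee; lra.
have fq n : (q%:E <= \int[P]_w (f n w)%:E)%E.
  have igf : integrable_rv P (f n).
    by apply: integrable_rv_le igg => // w; rewrite ger0_norm.
  rewrite meanE// lee_fin.
  have igs : integrable_rv P (fun w => (b n ^+ 2)^-1 * (expR (b n * Z w) + expR (- b n * Z w) + (- 2))).
    by apply: integrable_rvZ; apply: integrable_rvD; [apply: integrable_rvD; exact: igexp|exact: integrable_rv_cst].
  apply: le_trans (mean_le igs igf _).
    rewrite meanZ; last by apply: integrable_rvD; [apply: integrable_rvD; exact: igexp|exact: integrable_rv_cst].
    rewrite meanD; [|by apply: integrable_rvD; exact: igexp|exact: integrable_rv_cst].
    rewrite meanD// !Exexp mean_cst sqrrN.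
    rewrite mulrC ler_pdivlMr ?exprn_gt0//.
    have := expR_ge1Dx (b n ^+ 2 * q / 2); lra.
  move=> w; rewrite mulrC ler_pdivrMr ?exprn_gt0//.
  have := cosh_le_sqr (b n * Z w); rewrite exprMn mulNr /f => h.
  by apply: (le_trans h); rewrite le_eqVlt; apply/orP; left; apply/eqP; rewrite mulNr; ring.
have cb : b n @[n --> \oo] --> (0 : R) by exact: cvg_harmonic.
have [] := @dominated_convergence _ T R P setT measurableT
  (fun n w => (f n w)%:E) (fun w => (Z w ^+ 2)%:E) (fun w => (g w)%:E).
- by move=> n; exact/measurable_EFinP.
- by apply/measurable_EFinP; exact: measurable_funX.
- apply: nearW => w _; apply: cvg_EFin; first exact: nearW.
  have e1 (c : R) : expR (c * b n * Z w) @[n --> \oo] --> (1 : R).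
    rewrite -[X in _ --> X]expR0; apply: continuous_cvg; first exact: continuous_expR.
    rewrite -[X in _ --> X](mul0r (Z w)); apply: cvgMl.
    by rewrite -(mulr0 c); apply: cvgMr.
  have -> : Z w ^+ 2 = Z w ^+ 2 * (1 + 1 + 2) / 4 by field.
  apply: cvgMl; apply: cvgMr; apply: cvgD; last exact: cvg_cst.
  apply: cvgD; first by under eq_cvg do rewrite -[b _]mul1r; exact: e1.
  by under eq_cvg do rewrite -[- b _]mulN1r; exact: e1.
- exact: igg.
- apply: nearW => w n _; rewrite gee0_abs ?lee_fin//.
move=> _ _ cf; rewrite -lee_fin -meanE//.
rewrite -(cvg_lim _ cf)//; apply: lime_ge; last exact: nearW.
by apply/cvg_ex; eexists; exact: cf.
Qed.

Lemma gaussian_variance : integrable_rv P (fun w => Z w ^+ 2) /\ mean P (fun w => Z w ^+ 2) = q.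
Proof. by split=> //; apply/eqP; rewrite eq_le sqr_up sqr_low. Qed.

End GaussianMoments.

(** * Stochastic integrals up to time infinity *)

Section Terminal.
Context {R : realType} {d : measure_display} {T : measurableType d}.
Variables (P : probability T R) (F : R -> set (set T)) (W : R -> T -> R).
Hypotheses (HF : filtration F) (HW : brownian P F W).
Variables (M Q : R -> T -> R).
Hypothesis MQ : stochint F W M Q.
Variable Minf : T -> R.
Hypothesis cM : {ae P, forall w, M n%:R w @[n --> \oo] --> Minf w}.

Let mexp (a : R) (t : R) : 0 <= t ->
  measurable_fun setT (fun w => expR (a * M t w - a ^+ 2 * Q t w / 2)).
Proof.
move=> t0; have [mM mQ] := stochint_measurable HF HW MQ t0.
apply: measurableT_comp => //; apply: measurable_funB; first exact: measurable_funM.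
by apply: measurable_funM => //; exact: measurable_funM.
Qed.

Let exp1 (a : R) (t : R) : 0 <= t ->
  (\int[P]_w (expR (a * M t w - a ^+ 2 * Q t w / 2))%:E = 1)%E.
Proof. by move=> t0; have [] := stochint_exp HF HW (stochint_scale a MQ) t0. Qed.

Hypothesis mMinf : measurable_fun setT Minf.

(** For deterministic [Q] the second moments of the exponentials are at most [exp (a^2 qinf)], so
    mean one persists at infinity. *)
Lemma stochint_terminal_exp (q : R -> R) (qinf a : R) :
  (forall t w, 0 <= t -> Q t w = q t) -> q n%:R @[n --> \oo] --> qinf ->
  (\int[P]_w (expR (a * Minf w - a ^+ 2 * qinf / 2))%:E = 1)%E.
Proof.
move=> Qq cq.
have [C C0 var] := stochint_var MQ.
have qmono (s t : R) : 0 <= s -> s <= t -> q s <= q t.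
  move=> s0 st; have /andP[h _] := var s t point s0 st.
  by rewrite -subr_ge0 -(Qq s point)// -(Qq t point)// (le_trans s0).
have q_le n : q n%:R <= qinf.
  apply: (cvg_ge_cst cq); exists n => // m /= nm.
  by apply: qmono => //; rewrite ler_nat.
pose fn n w := expR (a * M n%:R w - a ^+ 2 * q n%:R / 2).
have mfn n : measurable_fun setT (fn n).
  rewrite (_ : fn n = fun w => expR (a * M n%:R w - a ^+ 2 * Q n%:R w / 2)); first exact: mexp.
  by apply/funext => w; rewrite /fn Qq.
have mf : measurable_fun setT (fun w => expR (a * Minf w - a ^+ 2 * qinf / 2)).
  by apply: measurableT_comp => //; apply: measurable_funB => //; exact: measurable_funM.
have cf : {ae P, forall w, fn n w @[n --> \oo] --> expR (a * Minf w - a ^+ 2 * qinf / 2)}.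
  apply: filterS cM => w cMw; apply: continuous_cvg; first exact: continuous_expR.
  by apply: cvgB; [exact: cvgMr|apply: cvgMl; exact: cvgMr].
have fnK n : (\int[P]_w (fn n w ^+ 2)%:E <= (expR (a ^+ 2 * qinf))%:E)%E.
  have E w : fn n w ^+ 2 = expR (a ^+ 2 * q n%:R) *
      expR (2 * a * M n%:R w - (2 * a) ^+ 2 * Q n%:R w / 2).
    by rewrite /fn expr2 -!expRD Qq//; congr expR; field.
  under eq_integral do rewrite E EFinM.
  rewrite ge0_integralZl//=.
  - rewrite exp1// mule1 lee_fin ler_expR ler_wpM2l ?sqr_ge0//; exact: q_le.
  - by apply/measurable_EFinP; exact: mexp.
have m1 : measurable_fun [set: T] (cst (1 : R)) by exact: measurable_cst.
have one2 : (\int[P]_w ((cst (1 : R) w) ^+ 2)%:E < +oo)%E.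
  under eq_integral do rewrite /= expr1n.
  by rewrite integral_cst// mul1e -ge0_fin_numE ?fin_num_measure.
have [|_] := L2bounded_integral_eq mf m1 mfn cf fnK one2 (c := 1).
  move=> n; under eq_integral do rewrite mul1r.
  rewrite -[RHS](@exp1 a n%:R)//; apply: eq_integral => w _.
  by rewrite /fn Qq.
by under eq_integral do rewrite mul1r.
Qed.

(** For random [Q], of bounded mean only, the exponential is kept at the finite time [S] and the
    increments after [S] are controlled in second moment by [2 * K]. That suffices to carry
    orthogonality to the limit. [GD] comes from [stochint_cat] with weight [a] before [S] and [b]
    after it. *)
Lemma stochint_terminal_orth (K : R) (a : R) (S : nat) :
  (forall t w, 0 <= t -> 0 <= Q t w) ->
  (forall n : nat, (\int[P]_w (Q n%:R w)%:E <= K%:E)%E) ->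
  let G w := expR (a * M S%:R w - a ^+ 2 * Q S%:R w / 2) in
  [/\ integrable_rv P G, mean P G = 1, integrable_rv P (fun w => G w * (Minf w - M S%:R w)) &
      mean P (fun w => G w * (Minf w - M S%:R w)) = 0].
Proof.
move=> Q0 QK G.
have S0 : 0 <= S%:R :> R by [].
have mG : measurable_fun setT G by exact: mexp.
have G0 w : 0 <= G w by exact: expR_ge0.
have [G1 [KG G2]] := stochint_exp HF HW (stochint_scale a MQ) S0.
have igG : integrable_rv P G by apply: (@integrable_rv_ge0 _ _ _ _ _ 1%E); rewrite ?G1 ?ltry.
have [mMS mQS] := stochint_measurable HF HW MQ S0.
have [C C0 var] := stochint_var MQ.
pose D n w := M (S + n)%:R w - M S%:R w.
pose q n w := Q (S + n)%:R w - Q S%:R w.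
have Sn n : S%:R <= (S + n)%:R :> R by rewrite ler_nat leq_addr.
have mD n : measurable_fun setT (D n).
  by have [mM _] := stochint_measurable HF HW MQ (ler0n R (S + n)); exact: measurable_funB.
have mq n : measurable_fun setT (q n).
  by have [_ mQ] := stochint_measurable HF HW MQ (ler0n R (S + n)); exact: measurable_funB.
have q0 n w : 0 <= q n w <= C * (S + n)%:R by apply: var.
have CS0 n : 0 <= C * (S + n)%:R by rewrite mulr_ge0.
have GD n b : (\int[P]_w (G w * expR (b * D n w - b ^+ 2 * q n w / 2))%:E = 1)%E.
  have [H _] := stochint_exp HF HW (stochint_cat a b S MQ) (ler0n R (S + n)).
  rewrite -[RHS]H; apply: eq_integral => w _; rewrite /G -expRD (min_idPr (Sn n)).
  by congr (expR _)%:E; rewrite /D /q; field.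
have D1 n b : (\int[P]_w (expR (b * D n w - b ^+ 2 * q n w / 2))%:E = 1)%E.
  have [H _] := stochint_exp HF HW (stochint_cat 0 b S MQ) (ler0n R (S + n)).
  rewrite -[RHS]H; apply: eq_integral => w _; rewrite (min_idPr (Sn n)).
  by congr (expR _)%:E; rewrite /D /q; field.
have orth n := exponential_orth mG (mD n) (mq n) G0 (q0 n) G2 (GD n) (D1 n) (CS0 n).
have mDinf : measurable_fun setT (fun w => Minf w - M S%:R w) by exact: measurable_funB.
have cD : {ae P, forall w, D n w @[n --> \oo] --> Minf w - M S%:R w}.
  apply: filterS cM => w cMw; apply: cvgB; last exact: cvg_cst.
  have := cMw; rewrite -(cvg_shiftn S) => h.
  by under eq_cvg do rewrite addnC; exact: h.
have DK n : (\int[P]_w (D n w ^+ 2)%:E <= (2 * K)%:E)%E.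
  have [igD2 le2] := exponential_sqr (mD n) (mq n) (q0 n) (D1 n) (CS0 n).
  rewrite meanE// lee_fin; apply: (le_trans le2); rewrite ler_wpM2l//.
  have igQ : integrable_rv P (Q (S + n)%:R).
    have [_ mQ] := stochint_measurable HF HW MQ (ler0n R (S + n)).
    by apply: (@integrable_rv_ge0 _ _ _ _ _ K%:E) => //; [move=> w; exact: Q0|exact: ltry].
  have igq : integrable_rv P (q n).
    apply: integrable_rv_le igQ => // w; have /andP[h _] := q0 n w.
    by rewrite ger0_norm// /q gerBl; exact: Q0.
  have QKn : mean P (Q (S + n)%:R) <= K by rewrite -lee_fin -meanE.
  apply: le_trans QKn; apply: mean_le => // w; rewrite /q gerBl; exact: Q0.
have G2oo : (\int[P]_w (G w ^+ 2)%:E < +oo)%E by apply: (le_lt_trans G2); exact: ltry.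
have [|igGD EGD] := L2bounded_integral_eq mDinf mG mD cD DK G2oo (c := 0).
  by move=> n; have [ign En] := orth n; rewrite meanE// En.
split => //; first by rewrite /mean G1.
by rewrite /mean EGD.
Qed.

End Terminal.

(** * Absolutely continuous paths *)

Section RintegralLimits.
Context {d : measure_display} {T : measurableType d} {R : realType}.
Variable mu : {measure set T -> \bar R}.

Lemma Rintegral_dominated_cvg (D : set T) (fn : nat -> T -> R) (f g : T -> R) :
  measurable D -> (forall n, measurable_fun D (fn n)) -> measurable_fun D f ->
  (forall x, D x -> fn n x @[n --> \oo] --> f x) ->
  mu.-integrable D (EFin \o g) -> (forall n x, D x -> `|fn n x| <= g x) ->
  \int[mu]_(x in D) fn n x @[n --> \oo] --> \int[mu]_(x in D) f x.
Proof.
move=> mD mfn mf cf ig_g fg.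
have [] := @dominated_convergence _ T R mu D mD
  (fun n x => (fn n x)%:E) (fun x => (f x)%:E) (fun x => (g x)%:E).
- by move=> n; exact/measurable_EFinP.
- exact/measurable_EFinP.
- by apply: nearW => x Dx; apply: cvg_EFin; [exact: nearW|exact: cf].
- exact: ig_g.
- by apply: nearW => x n Dx; rewrite /= lee_fin; exact: fg.
move=> igf _ cI; apply: fine_cvg.
by rewrite fineK//; exact: integrable_fin_num.
Qed.

Lemma le_integrable_R (D : set T) (f g : T -> R) : measurable D ->
  measurable_fun D f -> (forall x, D x -> `|f x| <= g x) ->
  mu.-integrable D (EFin \o g) -> mu.-integrable D (EFin \o f).
Proof.
move=> mD mf fg; apply: le_integrable => //; first exact/measurable_EFinP.
by move=> x Dx /=; rewrite lee_fin (le_trans (fg x Dx))// ler_norm.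
Qed.

Lemma integrable_scale_norm (D : set T) (f : T -> R) (B : R) : measurable D ->
  mu.-integrable D (EFin \o f) -> mu.-integrable D (EFin \o (fun s => B * `|f s|)).
Proof.
move=> mD fi; have := integrableZl mD B (integrable_abse fi).
by apply: eq_integrable.
Qed.

End RintegralLimits.

Lemma cvg_eq {R : realType} {I : Type} {G : set_system I} (u : I -> R) (l l' : R) :
  u n @[n --> G] --> l -> l = l' -> u n @[n --> G] --> l'.
Proof. by move=> ul <-. Qed.

(** * Riemann-Stieltjes sums against absolutely continuous integrators *)

Section RiemannStieltjes.
Context {R : realType}.
Local Notation mu := (@lebesgue_measure R).
Local Notation H := [set u : R | 0 <= u].
Local Notation mesh := (@mesh R).

Lemma measurable_halfline : measurable H.
Proof.
by rewrite (_ : H = `[0, +oo[%classic)//; apply/seteqP; split=> x /=; rewrite in_itv/= andbT.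
Qed.

Lemma measurable_truncn : measurable_fun [set: R] (@Num.truncn R).
Proof.
move=> _ B _; rewrite setTI.
have -> : (@Num.truncn R) @^-1` B = \bigcup_(k in B) ((fun x : R => (Num.truncn x)%:R : R) @^-1` [set k%:R]).
  apply/seteqP; split=> [x Bx|x [k Bk] /= /eqP].
    by exists (Num.truncn x).
  by rewrite eqr_nat => /eqP ->.
apply: bigcup_measurable => k _; rewrite -[X in measurable X]setTI.
have : measurable_fun [set: R] (fun x : R => (Num.truncn x)%:R : R).
  by apply: nondecreasing_measurable => // x y xy; rewrite ler_nat; exact: le_truncn.
by apply => //; exact: measurable_set1.
Qed.

Lemma halfline_bounded (h : R -> R) (b : R) : {within H, continuous h} -> 0 <= b ->
  exists2 B, 0 <= B & forall s, 0 <= s <= b -> `|h s| <= B.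
Proof.
move=> ch b0.
have chb : {within `[0, b], continuous (fun s => `|h s|)}.
  apply: (@continuous_subspaceW _ _ _ H).
    by move=> x /=; rewrite in_itv/= => /andP[].
  move=> x; apply: continuous_comp; first exact: ch.
  exact: norm_continuous.
have [c _ cP] := EVT_max b0 chb.
exists `|h c| => // s sb; apply: cP; by rewrite in_itv.
Qed.

Section Sums.
Variables (h f : R -> R).
Hypothesis ch : {within H, continuous h}.
Hypothesis fi : forall t : R, 0 <= t -> mu.-integrable `[0, t] (EFin \o f).

(** Step function with its tag at the left ([c = 0]) or right ([c = 1]) end of the cell containing
    [s]. Left tags occur in the sums of squares, right tags are produced by summation by parts. *)
Let phi (n c : nat) (s : R) : R := h (mesh n (Num.truncn (s * n.+1%:R) + c)).

Let mphi n c D : measurable D -> measurable_fun D (phi n c).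
Proof.
move=> mD; apply: (measurable_funS measurableT) => //.
rewrite (_ : phi n c = (fun k => h (mesh n (k + c))) \o (@Num.truncn R) \o (fun s => s * n.+1%:R)) //.
apply: measurableT_comp; last exact: measurable_funM.
by apply: measurableT_comp => //; exact: measurable_truncn.
Qed.

Let tag_bounds (n c : nat) (s t : R) : (c <= 1)%N -> 0 <= s <= t ->
  0 <= (mesh n (Num.truncn (s * n.+1%:R) + c) : R) <= t + 1.
Proof.
move=> c1 /andP[s0 st]; rewrite mesh_ge0/= /mesh natrD mulrDl lerD//.
  by apply: le_trans st; exact: mesh_truncn_le.
rewrite ler_pdivrMr ?ltr0n// mul1r ler_nat.
exact: leq_trans c1 _.
Qed.

Let itv_sub (t : R) : `[0, t] `<=` H.
Proof. by move=> x /=; rewrite in_itv/= => /andP[]. Qed.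

Let mh (t : R) : measurable_fun `[0, t] h.
Proof.
apply: (measurable_funS measurable_halfline (@itv_sub t)).
by apply: subspace_continuous_measurable_fun => //; exact: measurable_halfline.
Qed.

Let mf (t : R) : 0 <= t -> measurable_fun `[0, t] f.
Proof. by move=> t0; apply/measurable_EFinP; exact: measurable_int (fi t0). Qed.

Let integrable_step (n c : nat) (t : R) : (c <= 1)%N -> 0 <= t ->
  mu.-integrable `[0, t] (EFin \o (fun s => phi n c s * f s)).
Proof.
move=> c1 t0; have [B B0 hB] := halfline_bounded ch (addr_ge0 t0 ler01).
apply: (@le_integrable_R _ (measurableTypeR R) R mu `[0, t]%classic _ (fun s => B * `|f s|)) => //.
- by apply: measurable_funM; [exact: mphi|exact: mf].
- move=> s; rewrite /= in_itv/= => st; rewrite normrM ler_wpM2r//.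
  by apply: hB; exact: tag_bounds.
- by apply: integrable_scale_norm => //; exact: fi.
Qed.

Lemma step_sumE n c m : (c <= 1)%N ->
  \sum_(k < m) h (mesh n (k + c)) * (\int[mu]_(s in `[mesh n k, mesh n k.+1[) f s) =
  \int[mu]_(s in `[0, mesh n m[) (phi n c s * f s).
Proof.
move=> c1; elim: m => [|m IH].
  by rewrite big_ord0 /mesh mul0r set_itvco0 Rintegral_set0.
rewrite big_ord_recr/= IH.
have UE : `[0, mesh n m.+1[%classic = `[0, mesh n m[%classic `|` `[mesh n m, mesh n m.+1[%classic.
  apply/seteqP; split=> x /=; rewrite !in_itv/=.
    by move=> /andP[x0 x1]; have [xm|xm] := ltP x (mesh n m); [left; rewrite x0|right; rewrite x1].
  move=> [/andP[x0 xm]|/andP[xm x1]].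
    by rewrite x0 (lt_trans xm)// mesh_ltS.
  by rewrite x1 (le_trans _ xm)// mesh_ge0.
have isub : `[0, mesh n m.+1[%classic `<=` `[0, mesh n m.+1]%classic.
  by apply: subset_itvl; rewrite bnd_simp.
have ii : mu.-integrable `[0, mesh n m.+1[ (EFin \o (fun s => phi n c s * f s)).
  by apply: integrableS (integrable_step n c1 (mesh_ge0 n m.+1)).
rewrite UE Rintegral_setU//; last 2 first.
- by rewrite -UE.
- by apply/disj_setPS => x [] /=; rewrite !in_itv/= => /andP[_ h1] /andP[h2 _]; move: (lt_le_trans h1 h2); rewrite ltxx.
congr (_ + _); rewrite -RintegralZl//; last first.
  apply: integrableS (fi (mesh_ge0 n m.+1)) => //.
  by move=> x /=; rewrite !in_itv/= => /andP[h1 h2]; rewrite (le_trans _ h1) ?mesh_ge0// ltW.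
apply: eq_Rintegral => s; rewrite inE /= in_itv/= => /andP[s1 s2].
congr (h (mesh n (_ + c)) * _); apply/esym/truncn_def.
move: s1 s2; rewrite /mesh ler_pdivrMr ?ltr0n// ltr_pdivlMr ?ltr0n// => -> ->//.
Qed.

(** The sum is the integral of a step function times [f], to which dominated convergence applies;
    [h] is bounded on [[0, t + 1]] because a right tag may pass [t]. The complete cells eventually
    cover each [s < t] but never [t] itself, hence the detour through the half-open interval. *)
Lemma riemann_stieltjes_cvg (c : nat) (t : R) : (c <= 1)%N -> 0 <= t ->
  \sum_(k < Num.truncn (t * n.+1%:R)) h (mesh n (k + c)) *
     (\int[mu]_(s in `[mesh n k, mesh n k.+1[) f s) @[n --> \oo] -->
  \int[mu]_(s in `[0, t]) (h s * f s).
Proof.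
move=> c1 t0.
have [B B0 hB] := halfline_bounded ch (addr_ge0 t0 ler01).
have mt : measurable_fun `[0, t[ f.
  by apply: (measurable_funS _ _ (mf t0)) => //; apply: subset_itvl; rewrite bnd_simp.
have mht : measurable_fun `[0, t[ h.
  by apply: (measurable_funS _ _ (@mh t)) => //; apply: subset_itvl; rewrite bnd_simp.
have mhf : measurable_fun `[0, t] (fun s => h s * f s).
  by apply: measurable_funM; [exact: mh|exact: mf].
suff H : \sum_(k < Num.truncn (t * n.+1%:R)) h (mesh n (k + c)) *
     (\int[mu]_(s in `[mesh n k, mesh n k.+1[) f s) @[n --> \oo] -->
    \int[mu]_(s in `[0, t[) (h s * f s).
  apply: (cvg_eq H); apply: Rintegral_itv_bndo_bndc.
  apply: (@le_integrable_R _ (measurableTypeR R) R mu `[0, t[%classic _ (fun s => B * `|f s|)) => //.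
  - exact: measurable_funM.
  - move=> s; rewrite /= in_itv/= => /andP[s0 st]; rewrite normrM ler_wpM2r//.
    by apply: hB; rewrite s0/= (le_trans (ltW st))// lerDl.
  - apply: integrable_scale_norm => //; apply: integrableS (fi t0) => //.
    by apply: subset_itvl; rewrite bnd_simp.
pose D n := `[0, mesh n (Num.truncn (t * n.+1%:R))[%classic.
have E n : \sum_(k < Num.truncn (t * n.+1%:R)) h (mesh n (k + c)) *
     (\int[mu]_(s in `[mesh n k, mesh n k.+1[) f s) =
   \int[mu]_(s in `[0, t[) ((fun s => phi n c s * f s) \_ (D n)) s.
  rewrite step_sumE// -Rintegral_mkcondr; congr Rintegral.
  rewrite /D; apply/seteqP; split=> x /=; rewrite !in_itv/=; last by move=> [].
  move=> /andP[x0 xm]; split; rewrite x0//=.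
  by apply: (lt_le_trans xm); exact: mesh_truncn_le.
under eq_cvg do rewrite E.
apply: (@Rintegral_dominated_cvg _ (measurableTypeR R) R mu `[0, t[%classic _ _ (fun s => B * `|f s|)) => //.
- move=> n; apply/(measurable_restrict _ _ _) => //; first exact: measurable_itv.
  apply: measurable_funM; first by apply: mphi; apply: measurableI; exact: measurable_itv.
  apply: (measurable_funS _ _ mt) => //; exact: subIsetl.
- exact: measurable_funM.
- move=> s /=; rewrite in_itv/= => /andP[s0 st].
  have csn : phi n c s * f s @[n --> \oo] --> h s * f s.
    apply: cvgMl; apply: continuous_halfline_cvg => // [n|]; first exact: mesh_ge0.
    have -> : s = s + 0 by rewrite addr0.
    under eq_cvg do rewrite /mesh natrD mulrDl.
    apply: cvgD; first by rewrite addr0; exact: mesh_truncn_cvg.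
    by rewrite -[X in _ --> X](mulr0 c%:R); apply: cvgMr; exact: cvg_harmonic.
  apply: cvg_trans csn; apply: near_eq_cvg.
  have st' := cvgr_gt _ (mesh_truncn_cvg t0) _ st.
  near=> n; rewrite patchE mem_set// /D /= in_itv/= s0/=; near: n; exact: st'.
- apply: integrable_scale_norm => //; apply: integrableS (fi t0) => //.
  by apply: subset_itvl; rewrite bnd_simp.
- move=> n s /=; rewrite in_itv/= => /andP[s0 st]; rewrite patchE; case: ifP => _.
    rewrite normrM ler_wpM2r//; apply: hB; apply: tag_bounds => //.
    by rewrite s0 ltW.
  by rewrite normr0 mulr_ge0.
Unshelve. all: by end_near. Qed.

End Sums.

End RiemannStieltjes.

(** * Integration by parts and differentiation along paths *)

Section AbsolutelyContinuousPaths.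
Context {R : realType}.
Local Notation mu := (@lebesgue_measure R).
Local Notation H := [set u : R | 0 <= u].
Local Notation mesh := (@mesh R).

Lemma near_lt (x z : R) : x < z -> \forall y \near x, y < z.
Proof.
move=> xz; apply/nbhs_ballP; exists (z - x); first by rewrite /= subr_gt0.
by move=> y; rewrite /ball/= ltr_norml => /andP[]; lra.
Qed.

Lemma near_gt (x z : R) : z < x -> \forall y \near x, z < y.
Proof.
move=> xz; apply/nbhs_ballP; exists (x - z); first by rewrite /= subr_gt0.
by move=> y; rewrite /ball/= ltr_norml => /andP[]; lra.
Qed.

Definition ac_path (X f : R -> R) := forall t, 0 <= t ->
  mu.-integrable `[0, t] (EFin \o f) /\
  X t = X 0 + \int[mu]_(s in `[0, t]) f s.

Lemma ac_path_incr X f (s t : R) : ac_path X f -> 0 <= s -> s <= t ->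
  X t - X s = \int[mu]_(u in `[s, t[) f u.
Proof.
move=> Xf s0 st; have t0 := le_trans s0 st.
have [fit ->] := Xf t t0; have [fis ->] := Xf s s0.
have sub (r : R) : `[0, r[%classic `<=` `[0, r]%classic by apply: subset_itvl; rewrite bnd_simp.
have iit : mu.-integrable `[0, t[ (EFin \o f) by apply: integrableS fit.
have iis : mu.-integrable `[0, s[ (EFin \o f) by apply: integrableS fis.
rewrite -!Rintegral_itv_bndo_bndc//.
have UE : `[0, t[%classic = `[0, s[%classic `|` `[s, t[%classic.
  apply/seteqP; split=> x /=; rewrite !in_itv/=.
    by move=> /andP[x0 x1]; have [xm|xm] := ltP x s; [left; rewrite x0|right; rewrite x1].
  move=> [/andP[x0 xm]|/andP[xm x1]].
    by rewrite x0 (lt_le_trans xm).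
  by rewrite x1 (le_trans _ xm).
rewrite UE Rintegral_setU//; last 2 first.
- by rewrite -UE.
- by apply/disj_setPS => x [] /=; rewrite !in_itv/= => /andP[_ h1] /andP[h2 _]; move: (lt_le_trans h1 h2); rewrite ltxx.
by ring.
Qed.

Lemma ac_path_continuous X f : ac_path X f -> {within H, continuous X}.
Proof.
move=> Xf; apply/subspace_continuousP => x /= x0 A HA.
have x1 : 0 <= x + 1 by rewrite addr_ge0.
have [fi _] := Xf _ x1.
have /subspace_continuousP := parameterized_integral_continuous x1 fi.
move=> /(_ x); rewrite /= in_itv/= x0 lerDl ler01 => /(_ isT) cG.
have cX : X 0 + \int[mu]_(s in `[0, y]) f s @[y --> within `[0, x + 1] (nbhs x)] --> X x.
  by have [_ ->] := Xf x x0; apply: cvgD; [exact: cvg_cst|exact: cG].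
have /= near1 : \forall y \near x, y < x + 1 by apply: near_lt; rewrite ltrDl.
have near2 : \forall y \near x, `[0, x + 1]%classic y -> A (X 0 + \int[mu]_(s in `[0, y]) f s) := cX _ HA.
have : \forall y \near x, 0 <= y -> A (X y).
  near=> y => y0; have [_ ->] := Xf y y0.
  have y1 : y < x + 1 by near: y.
  have := near near2 y; apply => //; rewrite /= in_itv/= y0/= ltW//.
by [].
Unshelve. all: by end_near. Qed.

Lemma parts_sum (y w : nat -> R) m :
  \sum_(k < m) y k * (w k.+1 - w k) =
  y m * w m - y 0%N * w 0%N - \sum_(k < m) w k.+1 * (y k.+1 - y k).
Proof.
elim: m => [|m IH]; first by rewrite !big_ord0 subrr subrr.
by rewrite !big_ord_recr/= IH; ring.
Qed.

(** Summation by parts moves the increments from [W] to [X], where they are integrals of [f];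
    continuity of [W] is then enough, although Brownian paths have unbounded variation. *)
Lemma ac_path_continuous_parts_cvg X f (W : R -> R) t : ac_path X f ->
  {within H, continuous W} -> 0 <= t ->
  \sum_(k < Num.truncn (t * n.+1%:R)) X (mesh n k) * (W (mesh n k.+1) - W (mesh n k))
    @[n --> \oo] -->
  X t * W t - X 0 * W 0 - \int[mu]_(s in `[0, t]) (W s * f s).
Proof.
move=> Xf cW t0.
have fi s : 0 <= s -> mu.-integrable `[0, s] (EFin \o f) by move=> /Xf[].
have E n : \sum_(k < Num.truncn (t * n.+1%:R)) X (mesh n k) * (W (mesh n k.+1) - W (mesh n k)) =
  X (mesh n (Num.truncn (t * n.+1%:R))) * W (mesh n (Num.truncn (t * n.+1%:R))) - X 0 * W 0 -
  \sum_(k < Num.truncn (t * n.+1%:R)) W (mesh n (k + 1)) *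
    (\int[mu]_(s in `[mesh n k, mesh n k.+1[) f s).
  rewrite (parts_sum (fun k => X (mesh n k)) (fun k => W (mesh n k))).
  have -> : mesh n 0 = 0 by rewrite /mesh mul0r.
  congr (_ - _); apply: eq_bigr => k _.
  by rewrite addn1 (ac_path_incr Xf)// ?mesh_ge0// ltW// mesh_ltS.
under eq_cvg do rewrite E.
apply: cvgB; last exact: riemann_stieltjes_cvg.
apply: cvgB; last exact: cvg_cst.
apply: cvgM; apply: continuous_halfline_cvg => //.
- exact: ac_path_continuous Xf.
- by move=> n; exact: mesh_ge0.
- exact: mesh_truncn_cvg.
- by move=> n; exact: mesh_ge0.
- exact: mesh_truncn_cvg.
Qed.

(** The same Riemann sums have two expressions for their limit, one through summation by parts and
    one directly. *)
Lemma ac_path_parts F f G g t : ac_path F f -> ac_path G g -> 0 <= t ->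
  \int[mu]_(s in `[0, t]) (F s * g s) + \int[mu]_(s in `[0, t]) (G s * f s) =
  F t * G t - F 0 * G 0.
Proof.
move=> Ff Gg t0.
have c1 := ac_path_continuous_parts_cvg Ff (ac_path_continuous Gg) t0.
have gi s : 0 <= s -> mu.-integrable `[0, s] (EFin \o g) by move=> /Gg[].
have c2 := riemann_stieltjes_cvg (ac_path_continuous Ff) gi (leq0n 1) t0.
have E n : \sum_(k < Num.truncn (t * n.+1%:R)) F (mesh n (k + 0)) *
      (\int[mu]_(s in `[mesh n k, mesh n k.+1[) g s) =
   \sum_(k < Num.truncn (t * n.+1%:R)) F (mesh n k) * (G (mesh n k.+1) - G (mesh n k)).
  apply: eq_bigr => k _.
  by rewrite addn0 (ac_path_incr Gg)// ?mesh_ge0// ltW// mesh_ltS.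
move: c2; under eq_cvg do rewrite E; move=> c2.
have := cvg_unique _ c1 c2 => /(_ (@Rhausdorff R)) <-.
by rewrite subrK.
Qed.

(** Lebesgue differentiation, applied to [f] cut off outside [[0, n]] since nothing is known of it
    on the negative axis, and then a countable union over [n]. The point 0, where the two-sided
    derivative sees negative times, is discarded as a null set. *)
Lemma ac_path_derive X f : ac_path X f -> {ae mu, forall t, 0 <= t -> derive1 X t = f t}.
Proof.
move=> Xf; have aeF := ae_filter_ringOfSetsType mu.
pose fn (n : nat) := f \_ `[0, n%:R]%classic.
have fni (n : nat) D : measurable D -> mu.-integrable D (EFin \o fn n).
  move=> mD; apply: (integrableS measurableT) => //.
  have := (@integrable_mkcond _ (measurableTypeR R) R mu `[0, n%:R]%classic (EFin \o f)
    (measurable_itv _)).1 (Xf n%:R (ler0n _ _)).1.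
  by apply: eq_integrable => // x _; rewrite /fn /= !patchE; case: ifP.
have loc n : locally_integrable [set: R] (fn n).
  split; [|exact: openT|].
    by have /measurable_int/measurable_EFinP := fni n _ measurableT.
  move=> K _ cK; have mK : measurable K by exact: compact_measurable.
  have := fni n K mK => /integrableP[_]; by [].
have H1 (n : nat) : {ae mu, forall t, 0 < t < n%:R -> derive1 X t = f t}.
  have := FTC1 (a := BLeft 0) (fun y => fni n _ (measurable_itv _)) (loc n).
  apply: filterS => t Ht /andP[t0 tn].
  have [|dF FE] := Ht.
    by rewrite /= lte_fin.
  have <- : fn n t = f t by rewrite /fn patchE mem_set//= in_itv/= (ltW t0) (ltW tn).
  rewrite -FE !derive1E.
  have XE : \forall y \near t, X 0 + \int[mu]_(s in `[0, y]) fn n s = X y.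
    near=> y.
    have y0 : 0 < y by near: y; exact: near_gt.
    have yn : y < n%:R by near: y; exact: near_lt.
    have [_ ->] := Xf y (ltW y0); congr (_ + _); apply: eq_Rintegral => s.
    rewrite inE/= in_itv/= => /andP[s0 sy].
    by rewrite /fn patchE mem_set//= in_itv/= s0 (le_trans sy)// ltW.
  rewrite -(near_eq_derive _ XE) deriveD//.
  by rewrite derive_cst add0r.
have H0 : {ae mu, forall t, t != (0 : R)}.
  exists [set 0]; split => //; first exact: lebesgue_measure_set1.
  by move=> t /= /negP; rewrite negbK => /eqP.
have /ae_foralln H2 := H1.
apply: filterS2 H2 H0 => t Ht tn0 t0.
apply: (Ht (Num.truncn t).+1).
by rewrite lt_neqAle eq_sym tn0 t0/= truncnS_gt.
Unshelve. all: by end_near. Qed.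

End AbsolutelyContinuousPaths.

(** * Square-integrable functions and paths on the half line *)

Section HalfLineL2.
Context {R : realType}.
Local Notation mu := (@lebesgue_measure R).
Local Notation H := [set u : R | 0 <= u].
Local Notation RR := (measurableTypeR R).

Definition l2 (f : R -> R) :=
  measurable_fun H f /\ (\int[mu]_(t in H) ((f t) ^+ 2)%:E < +oo)%E.

Definition ip (f g : R -> R) : R := \int[mu]_(t in H) (f t * g t).

Let mH : (measurable : set (set RR)) H := @measurable_halfline R.

Let mI (t : R) : (measurable : set (set RR)) `[0, t]%classic.
Proof. exact: measurable_itv. Qed.

Lemma l2_sqr_integrable f : l2 f -> mu.-integrable H (EFin \o (fun t => f t ^+ 2)).
Proof.
move=> [mf f2]; apply/integrableP; split.
  by apply/measurable_EFinP; exact: measurable_funX.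
apply: le_lt_trans f2; rewrite le_eqVlt; apply/orP; left; apply/eqP.
by apply: eq_integral => t _; rewrite /= ger0_norm ?sqr_ge0.
Qed.

Lemma l2M_integrable f g : l2 f -> l2 g -> mu.-integrable H (EFin \o (fun t => f t * g t)).
Proof.
move=> lf lg.
apply: (@le_integrable_R _ RR R mu H _ (fun t => f t ^+ 2 + g t ^+ 2)) => //.
- by apply: measurable_funM; [exact: lf.1|exact: lg.1].
- move=> t _; rewrite normrM -[f t ^+ 2]real_normK ?num_real//.
  rewrite -[g t ^+ 2]real_normK ?num_real//.
  have := sqr_ge0 (`|f t| - `|g t|).
  have := normr_ge0 (f t); have := normr_ge0 (g t); nra.
- by have := integrableD mH (l2_sqr_integrable lf) (l2_sqr_integrable lg); apply: eq_integrable.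
Qed.

Lemma l2D f g : l2 f -> l2 g -> l2 (fun t => f t + g t).
Proof.
move=> lf lg; split; first by apply: measurable_funD; [exact: lf.1|exact: lg.1].
apply: (@le_lt_trans _ _ (\int[mu]_(t in H) (2 * f t ^+ 2 + 2 * g t ^+ 2)%:E)%E).
  apply: le_integral_ae => //; apply: nearW => t _; rewrite lee_fin.
  by have := sqr_ge0 (f t - g t); nra.
have h : mu.-integrable H (EFin \o (fun t => 2 * f t ^+ 2 + 2 * g t ^+ 2)).
  have := integrableD mH (integrableZl mH 2 (l2_sqr_integrable lf))
    (integrableZl mH 2 (l2_sqr_integrable lg)).
  by apply: eq_integrable.
have /integrableP[_] := h; apply: le_lt_trans.
apply: le_integral_ae => //; apply: nearW => t _ /=; rewrite lee_fin; exact: ler_norm.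
Qed.

Lemma l2Z c f : l2 f -> l2 (fun t => c * f t).
Proof.
move=> lf; split; first by apply: measurable_funM => //; exact: lf.1.
have h : mu.-integrable H (EFin \o (fun t => c ^+ 2 * f t ^+ 2)).
  by have := integrableZl mH (c ^+ 2) (l2_sqr_integrable lf); apply: eq_integrable.
have /integrableP[_] := h; apply: le_lt_trans.
apply: le_integral_ae => //; apply: nearW => t _ /=; rewrite lee_fin exprMn; exact: ler_norm.
Qed.

Lemma l2B f g : l2 f -> l2 g -> l2 (fun t => f t - g t).
Proof.
move=> lf lg; have := l2D lf (l2Z (-1) lg).
by under eq_fun do rewrite mulN1r.
Qed.

Lemma l2_cst0 : l2 (fun=> 0).
Proof.
split; first exact: measurable_cst.
by under eq_integral do rewrite expr0n /=; rewrite integral0 ltry.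
Qed.

Lemma ipC f g : ip f g = ip g f.
Proof. by apply: eq_Rintegral => t _; rewrite mulrC. Qed.

Lemma ipDl f g h : l2 f -> l2 g -> l2 h -> ip (fun t => f t + g t) h = ip f h + ip g h.
Proof.
move=> lf lg lh; rewrite /ip -RintegralD//; [|exact: l2M_integrable|exact: l2M_integrable].
by apply: eq_Rintegral => t _; rewrite mulrDl.
Qed.

Lemma ipZl c f g : l2 f -> l2 g -> ip (fun t => c * f t) g = c * ip f g.
Proof.
move=> lf lg; rewrite /ip -RintegralZl//; last exact: l2M_integrable.
by apply: eq_Rintegral => t _; rewrite mulrA.
Qed.

Lemma ipDr f g h : l2 f -> l2 g -> l2 h -> ip f (fun t => g t + h t) = ip f g + ip f h.
Proof. by move=> lf lg lh; rewrite ipC ipDl// ![ip _ f]ipC. Qed.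

Lemma ipZr c f g : l2 f -> l2 g -> ip f (fun t => c * g t) = c * ip f g.
Proof. by move=> lf lg; rewrite ipC ipZl// ipC. Qed.

Lemma ipBl f g h : l2 f -> l2 g -> l2 h -> ip (fun t => f t - g t) h = ip f h - ip g h.
Proof.
move=> lf lg lh; have := ipDl lf (l2Z (-1) lg) lh; rewrite ipZl// mulN1r => <-.
by congr ip; apply/funext => t; rewrite mulN1r.
Qed.

Lemma ipBr f g h : l2 f -> l2 g -> l2 h -> ip f (fun t => g t - h t) = ip f g - ip f h.
Proof. by move=> lf lg lh; rewrite ipC ipBl// ![ip _ f]ipC. Qed.

Lemma ip_sumr n (Q : pred 'I_n) (f : R -> R) (g : 'I_n -> R -> R) : l2 f ->
  (forall i, l2 (g i)) ->
  ip f (fun t => \sum_(i < n | Q i) g i t) = \sum_(i < n | Q i) ip f (g i).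
Proof.
move=> lf lg.
suff [//] : l2 (fun t => \sum_(i < n | Q i) g i t) /\
  ip f (fun t => \sum_(i < n | Q i) g i t) = \sum_(i < n | Q i) ip f (g i).
elim: (index_enum _) => [|i s [l2s IH]].
  rewrite big_nil; split.
    by under eq_fun do rewrite big_nil; exact: l2_cst0.
  rewrite /ip; under eq_Rintegral do rewrite big_nil mulr0.
  by rewrite /Rintegral integral0.
have E : (fun t => \sum_(j <- i :: s | Q j) g j t) =
    (if Q i then (fun t => g i t + \sum_(j <- s | Q j) g j t)
     else (fun t => \sum_(j <- s | Q j) g j t)).
  by apply/funext => t; rewrite big_cons; case: (Q i).
rewrite E big_cons; case: (Q i) => //; split; first exact: l2D.
by rewrite ipDr// IH.
Qed.

Lemma ip_ge0 f : 0 <= ip f f.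
Proof. by apply: Rintegral_ge0 => t _; rewrite -expr2 sqr_ge0. Qed.

Lemma integral_sqr_ip f : l2 f -> (\int[mu]_(t in H) ((f t) ^+ 2)%:E)%E = (ip f f)%:E.
Proof.
move=> lf; rewrite /ip /Rintegral fineK; last first.
  by apply: integrable_fin_num => //; exact: l2M_integrable.
by apply: eq_integral => t _; rewrite expr2.
Qed.

Lemma ip_eq0 f : {within H, continuous f} -> l2 f -> ip f f = 0 ->
  forall t, 0 <= t -> f t = 0.
Proof.
move=> cf lf ff t t0.
have : (\int[mu]_(t in H) `|((f t) ^+ 2)%:E|)%E = 0%E.
  rewrite -[RHS](_ : (ip f f)%:E = 0%E); last by rewrite ff.
  rewrite -integral_sqr_ip//; apply: eq_integral => s _.
  by rewrite gee0_abs// lee_fin sqr_ge0.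
move=> /(ae_eq_integral_abs mu mH) => /(_ _)/wrap[|].
  by apply/measurable_EFinP; apply: measurable_funX; exact: lf.1.
move=> [N [mN N0 fN]].
apply: contrapT => /eqP ft0.
move: cf => /subspace_continuousP/(_ t t0).
have /= nb : nbhs (f t) [set y : R | y != 0].
  apply/nbhs_ballP; exists `|f t|; first by rewrite /= normr_gt0.
  move=> y; rewrite /ball/=; apply: contraTneq => ->.
  by rewrite subr0 ltxx.
move=> /(_ _ nb) => -[e /= e0 He].
(* The interval extends to the right of [t], so that it stays in the half line also for [t = 0]; its
   positive length contradicts [N] being null. *)
have sub : `[t, t + e[%classic `<=` N.
  move=> s /=; rewrite in_itv/= => /andP[ts ste]; apply: fN => /= H0.
  have s0 : 0 <= s by exact: le_trans ts.
  have : f s != 0.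
    apply: (He s) => //; rewrite /ball/= distrC ger0_norm ?subr_ge0//.
    by rewrite ltrBlDl.
  by have [/eqP] := H0 s0; rewrite sqrf_eq0 => ->.
have : (mu `[t, (t + e)%R[%classic <= mu N)%E by apply: le_measure; rewrite ?inE.
rewrite N0 lebesgue_measure_itv/= lte_fin ltrDl e0 -EFinB addrC addKr lee_fin.
by rewrite leNgt e0.
Qed.

Lemma halfline_integral_cvg (f : R -> R) : mu.-integrable H (EFin \o f) ->
  \int[mu]_(s in `[0, t]) f s @[t --> +oo] --> \int[mu]_(s in H) f s.
Proof.
move=> fi; apply/cvg_pinftyP => u uoo.
have E (t : R) : \int[mu]_(s in `[0, t]) f s = \int[mu]_(s in H) (f \_ `[0, t]%classic) s.
  rewrite -Rintegral_mkcondr; congr Rintegral.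
  by apply/seteqP; split => s /=; rewrite in_itv/=; [move=> /andP[h1 h2]; rewrite h1|move=> []].
under eq_cvg do rewrite E.
have mf : measurable_fun H f by have /measurable_int/measurable_EFinP := fi.
apply: (@Rintegral_dominated_cvg _ RR R mu H _ _ (fun s => `|f s|)) => //.
- move=> n; apply/(measurable_restrict _ _ _); [exact: measurable_itv|exact: mH|].
  by apply: (measurable_funS _ _ mf) => //; exact: subIsetl.
- move=> s s0; have cf : f s @[_ --> \oo] --> f s by exact: cvg_cst.
  apply: cvg_trans cf; apply: near_eq_cvg.
  near=> n; rewrite patchE mem_set//= in_itv/= s0/=.
  by near: n; exact: cvgry_ge.
- by have := integrable_abse fi; apply: eq_integrable.
- by move=> n s _; rewrite patchE; case: ifP => // _; rewrite normr0.
Unshelve. all: by end_near. Qed.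

Definition l2_path (X f : R -> R) :=
  [/\ ac_path X f, l2 f, l2 X & X t @[t --> +oo] --> 0].

Lemma l2_path_parts F f G g : l2_path F f -> l2_path G g ->
  ip F g + ip G f = - (F 0 * G 0).
Proof.
move=> [aF lf lF cF] [aG lg lG cG].
have c1 : \int[mu]_(s in `[0, t]) (F s * g s) + \int[mu]_(s in `[0, t]) (G s * f s)
    @[t --> +oo] --> ip F g + ip G f.
  by apply: cvgD; apply: halfline_integral_cvg; exact: l2M_integrable.
have c2 : F t * G t - F 0 * G 0 @[t --> +oo] --> 0 * 0 - F 0 * G 0.
  by apply: cvgB; [exact: cvgM|exact: cvg_cst].
rewrite mul0r sub0r in c2; apply: (cvg_unique _ _ c2) => //.
apply: cvg_trans c1; apply: near_eq_cvg; near=> t.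
have t0 : 0 <= t by near: t; apply: nbhs_pinfty_ge; exact: num_real.
by rewrite ac_path_parts.
Unshelve. all: by end_near. Qed.

Lemma ac_pathD (X f Y g : R -> R) : ac_path X f -> ac_path Y g -> ac_path (fun t => X t + Y t) (fun t => f t + g t).
Proof.
move=> Xf Yg t t0; have [fi Xt] := Xf t t0; have [gi Yt] := Yg t t0; split.
  by have := integrableD (mI t) fi gi; apply: eq_integrable.
by rewrite RintegralD// Xt Yt addrACA.
Qed.

Lemma ac_pathZ (c : R) (X f : R -> R) : ac_path X f -> ac_path (fun t => c * X t) (fun t => c * f t).
Proof.
move=> Xf t t0; have [fi Xt] := Xf t t0; split.
  by have := integrableZl (mI t) c fi; apply: eq_integrable.
by rewrite RintegralZl// Xt mulrDr.
Qed.

Lemma l2_pathD X f Y g : l2_path X f -> l2_path Y g ->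
  l2_path (fun t => X t + Y t) (fun t => f t + g t).
Proof.
move=> [a1 l1 L1 c1] [a2 l2_ L2 c2]; split; [exact: ac_pathD|exact: l2D|exact: l2D|].
by rewrite -(addr0 (0 : R)); exact: cvgD.
Qed.

Lemma l2_pathZ c X f : l2_path X f -> l2_path (fun t => c * X t) (fun t => c * f t).
Proof.
move=> [a1 l1 L1 c1]; split; [exact: ac_pathZ|exact: l2Z|exact: l2Z|].
by rewrite -(mulr0 c); exact: cvgMr.
Qed.

Lemma l2_pathB X f Y g : l2_path X f -> l2_path Y g ->
  l2_path (fun t => X t - Y t) (fun t => f t - g t).
Proof.
move=> h1 h2; have := l2_pathD h1 (l2_pathZ (-1) h2).
by under eq_fun do rewrite mulN1r; under [fun t => f t + _]eq_fun do rewrite mulN1r.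
Qed.

Lemma l2_path_cst0 : l2_path (fun=> 0) (fun=> 0).
Proof.
split; [|exact: l2_cst0|exact: l2_cst0|exact: cvg_cst].
move=> t t0; split; last by rewrite /Rintegral integral0 addr0.
have := integrable0 mu `[0, t]%classic; apply.
Qed.

Lemma l2_path_sum n (Q : pred 'I_n) (X f : 'I_n -> R -> R) : (forall i, l2_path (X i) (f i)) ->
  l2_path (fun t => \sum_(i < n | Q i) X i t) (fun t => \sum_(i < n | Q i) f i t).
Proof.
move=> Xf; elim: (index_enum _) => [|i s IH].
  under eq_fun do rewrite big_nil; under [fun t => \sum_(i <- _ | _) f i t]eq_fun do rewrite big_nil.
  exact: l2_path_cst0.
under eq_fun do rewrite big_cons; under [fun t => \sum_(i <- _ | _) f i t]eq_fun do rewrite big_cons.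
by case: (Q i) => //; exact: l2_pathD.
Qed.

Lemma l2_path_self X f : l2_path X f -> ip X f = - (X 0 ^+ 2 / 2).
Proof. by move=> Xf; have := l2_path_parts Xf Xf; lra. Qed.

End HalfLineL2.

(** * The revenue along a single path *)

Section PathRevenue.
Context {R : realType}.
Local Notation mu := (@lebesgue_measure R).
Local Notation H := [set u : R | 0 <= u].
Local Notation RR := (measurableTypeR R).

Let mI (t : R) : (measurable : set (set RR)) `[0, t]%classic.
Proof. exact: measurable_itv. Qed.

Let I T (u : R -> R) := mu.-integrable `[0, T]%classic (EFin \o u).

Let ID T u v : I T u -> I T v -> I T (fun t => u t + v t).
Proof. by move=> hu hv; have := integrableD (mI T) hu hv; apply: eq_integrable. Qed.

Let IZ T c u : I T u -> I T (fun t => c * u t).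
Proof. by move=> hu; have := integrableZl (mI T) c hu; apply: eq_integrable. Qed.

Let Il2 T f g : l2 f -> l2 g -> I T (fun t => f t * g t).
Proof.
move=> lf lg; apply: integrableS (l2M_integrable lf lg) => //.
- exact: measurable_halfline.
- by move=> s /=; rewrite in_itv/= => /andP[].
Qed.

Lemma ac_path_mul_integrable (X f h : R -> R) (T : R) : ac_path X f -> {within H, continuous h} ->
  0 <= T -> mu.-integrable `[0, T]%classic (EFin \o (fun t => h t * f t)).
Proof.
move=> Xf ch T0; have [B B0 hB] := halfline_bounded ch T0; have [fi _] := Xf T T0.
apply: (@le_integrable_R _ RR R mu `[0, T]%classic _ (fun s => B * `|f s|)) => //.
- apply: measurable_funM; last by apply/measurable_EFinP; exact: measurable_int fi.
  apply: (measurable_funS (@measurable_halfline R)).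
    by move=> s /=; rewrite in_itv/= => /andP[].
  by apply: subspace_continuous_measurable_fun => //; exact: measurable_halfline.
- by move=> s /=; rewrite in_itv/= => /hB ?; rewrite normrM ler_wpM2r.
- by apply: integrable_scale_norm => //; exact: mI.
Qed.

(** The Brownian term [int W f] is written as [Y W - (Y W - int W f)]: the product vanishes at
    infinity and the bracket is the stochastic integral, with limit [m]. Every other term is an
    integral over the half line, and [int Y f] is a boundary term. The executed rate [dY] and the
    price [p] are prescribed for almost every time only, because [dot] is a pointwise derivative. *)
Lemma path_revenue_cvg (S0 sigma gamma lambda m : R) (Y f G g W p dY : R -> R) :
  l2_path Y f -> l2_path G g -> {within H, continuous W} ->
  Y t * W t - \int[mu]_(s in `[0, t]) (W s * f s) @[t --> +oo] --> m ->
  Y t * W t @[t --> +oo] --> 0 ->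
  {ae mu, forall t, 0 <= t -> dY t = f t} ->
  {ae mu, forall t, 0 <= t -> p t = S0 + sigma * W t +
     gamma * ((Y t - Y 0) + (G t - G 0)) + lambda * (f t + g t)} ->
  \int[mu]_(t in `[0, T]) (dY t * p t) @[T --> +oo] -->
    - (S0 * Y 0 + sigma * m - gamma * (Y 0 ^+ 2 / 2) - gamma * ip f G
       - gamma * (Y 0 * G 0) - lambda * (ip f f + ip f g)).
Proof.
move=> Yf Gg cW cM cYW aeY aep.
have [aY lf lY cY] := Yf; have [aG lg lG cG] := Gg.
pose c := S0 - gamma * Y 0 - gamma * G 0.
have E (T : R) : 0 <= T -> \int[mu]_(t in `[0, T]) (dY t * p t) =
  c * (Y T - Y 0) + (sigma * (Y T * W T - (Y T * W T - \int[mu]_(s in `[0, T]) (W s * f s)))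
  + (gamma * \int[mu]_(s in `[0, T]) (Y s * f s)
  + (gamma * \int[mu]_(s in `[0, T]) (f s * G s)
  + (lambda * \int[mu]_(s in `[0, T]) (f s * f s)
  + lambda * \int[mu]_(s in `[0, T]) (f s * g s))))).
  move=> T0; have [fi YT] := aY T T0.
  transitivity (\int[mu]_(t in `[0, T]) (c * f t + (sigma * (W t * f t) +
     (gamma * (Y t * f t) + (gamma * (f t * G t) + (lambda * (f t * f t) + lambda * (f t * g t))))))).
    rewrite /Rintegral; congr fine; apply: eq_integral_ae.
    have aeF := ae_filter_ringOfSetsType mu.
    apply: filterS2 aeY aep => t tY tp; rewrite /= in_itv/= => /andP[t0 _].
    by rewrite tY// tp// /c; congr EFin; ring.
  have i2 : I T (fun t => sigma * (W t * f t)) by exact: (IZ _ (ac_path_mul_integrable aY cW T0)).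
  have i3 : I T (fun t => gamma * (Y t * f t)) by apply: IZ; apply: Il2.
  have i4 : I T (fun t => gamma * (f t * G t)) by apply: IZ; apply: Il2.
  have i5 : I T (fun t => lambda * (f t * f t)) by apply: IZ; apply: Il2.
  have i6 : I T (fun t => lambda * (f t * g t)) by apply: IZ; apply: Il2.
  have i56 := ID i5 i6; have i456 := ID i4 i56; have i3456 := ID i3 i456.
  have i2_6 := ID i2 i3456; have i1 : I T (fun t => c * f t) by exact: IZ.
  rewrite RintegralD// RintegralD// RintegralD// RintegralD// RintegralD//.
  rewrite RintegralZl// RintegralZl; [|exact: mI|exact: ac_path_mul_integrable aY cW T0].
  rewrite RintegralZl; [|exact: mI|exact: Il2].
  rewrite RintegralZl; [|exact: mI|exact: Il2].
  rewrite RintegralZl; [|exact: mI|exact: Il2].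
  rewrite RintegralZl; [|exact: mI|exact: Il2].
  by congr (_ + _); [rewrite YT addrAC subrr add0r|congr (_ + _); rewrite subKr].
have lim : c * (Y T - Y 0) + (sigma * (Y T * W T - (Y T * W T - \int[mu]_(s in `[0, T]) (W s * f s)))
  + (gamma * \int[mu]_(s in `[0, T]) (Y s * f s)
  + (gamma * \int[mu]_(s in `[0, T]) (f s * G s)
  + (lambda * \int[mu]_(s in `[0, T]) (f s * f s)
  + lambda * \int[mu]_(s in `[0, T]) (f s * g s))))) @[T --> +oo] -->
  c * (0 - Y 0) + (sigma * (0 - m) + (gamma * ip Y f + (gamma * ip f G +
   (lambda * ip f f + lambda * ip f g)))).
  apply: cvgD; first by apply: cvgMr; apply: cvgB => //; exact: cvg_cst.
  apply: cvgD; first by apply: cvgMr; apply: cvgB.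
  apply: cvgD; first by apply: cvgMr; apply: halfline_integral_cvg; exact: l2M_integrable.
  apply: cvgD; first by apply: cvgMr; apply: halfline_integral_cvg; exact: l2M_integrable.
  by apply: cvgD; apply: cvgMr; apply: halfline_integral_cvg; exact: l2M_integrable.
rewrite (_ : - _ = c * (0 - Y 0) + (sigma * (0 - m) + (gamma * ip Y f + (gamma * ip f G +
   (lambda * ip f f + lambda * ip f g))))); last first.
  by rewrite (l2_path_self Yf) /c; field.
apply: cvg_trans lim; apply: near_eq_cvg; near=> T; rewrite E//.
Unshelve. all: by end_near. Qed.

End PathRevenue.

(** * Decaying exponentials as paths *)

Section ExponentialPaths.
Context {R : realType}.
Local Notation mu := (@lebesgue_measure R).
Local Notation H := [set u : R | 0 <= u].
Variable a : R.
Hypothesis a0 : a < 0.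

Let cexp : continuous (fun t => expR (a * t)).
Proof. by move=> t; apply: continuous_comp; [exact: mulrl_continuous|exact: continuous_expR]. Qed.

Lemma exp_cvg0 : expR (a * t) @[t --> +oo] --> 0.
Proof.
apply/cvgrPdist_le => e e0; near=> t.
rewrite sub0r normrN ger0_norm ?expR_ge0// -[leRHS]lnK ?posrE// ler_expR.
rewrite -ler_ndivrMl//; near: t; apply: nbhs_pinfty_ge; exact: num_real.
Unshelve. all: by end_near. Qed.

(** [ln (ln t) <= t] and the cubic term in the expansion of [exp (- a t)] give
    [exp (a t) * t^2 <= 6 / ((- a)^3 * t)], whence the threshold for [t]. *)
Lemma exp_growth_cvg0 : expR (a * t) * t * ln (ln t) @[t --> +oo] --> 0.
Proof.
have a3 : 0 < (- a) ^+ 3 by rewrite exprn_gt0// oppr_gt0.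
apply/cvgrPdist_le => e e0; near=> t.
have t1 : expR 1 <= t by near: t; apply: nbhs_pinfty_ge; exact: num_real.
have te : 6 / ((- a) ^+ 3 * e) <= t by near: t; apply: nbhs_pinfty_ge; exact: num_real.
have t0 : 0 < t by apply: lt_le_trans t1; exact: expR_gt0.
have l1 : 1 <= ln t by rewrite -ler_expR lnK.
have lnle (x : R) : 0 < x -> ln x <= x.
  by move=> x0; have := expR_ge1Dx (ln x); rewrite lnK ?posrE//; lra.
have ll0 : 0 <= ln (ln t) by rewrite ln_ge0.
have llt : ln (ln t) <= t.
  by apply: (le_trans (lnle _ _)); [apply: lt_le_trans l1|exact: lnle].
rewrite sub0r normrN ger0_norm; last by rewrite mulr_ge0// mulr_ge0 ?expR_ge0// ltW.
apply: (@le_trans _ _ (expR (a * t) * t * t)).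
  by rewrite ler_wpM2l// mulr_ge0 ?expR_ge0// ltW.
have at0 : 0 <= - a * t by rewrite mulr_ge0 ?oppr_ge0 ?ltW.
have := expR_ge1Dxn 2 at0; rewrite (_ : 3`!%:R = 6)// mulNr expRN => h.
have e1 := expR_gt0 (a * t).
have h2 : (- a) ^+ 3 * t ^+ 3 / 6 <= (expR (a * t))^-1.
  by apply: le_trans h; rewrite exprNn -mulNr exprMn addrC -exprNn lerDl.
have h3 : expR (a * t) * ((- a) ^+ 3 * t ^+ 3 / 6) <= 1.
  by rewrite -[leRHS](mulfV (lt0r_neq0 e1)) ler_pM2l.
move: te; rewrite ler_pdivrMr ?(mulr_gt0 a3 e0)// => te.
have t2 : 0 < t ^+ 2 by rewrite exprn_gt0.
have te2 : 6 * (expR (a * t) * t ^+ 2) <= t * ((- a) ^+ 3 * e) * (expR (a * t) * t ^+ 2).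
  by rewrite ler_wpM2r// mulr_ge0 ?expR_ge0// sqr_ge0.
have : t * ((- a) ^+ 3 * e) * (expR (a * t) * t ^+ 2) =
  6 * e * (expR (a * t) * ((- a) ^+ 3 * t ^+ 3 / 6)) by field.
have : 6 * e * (expR (a * t) * ((- a) ^+ 3 * t ^+ 3 / 6)) <= 6 * e * 1.
  by apply: ler_wpM2l => //; rewrite mulr_ge0// ltW.
move=> h6 h5; have -> : expR (a * t) * t * t = expR (a * t) * t ^+ 2 by ring.
move: te2 h6; rewrite h5; lra.
Unshelve. all: by end_near. Qed.

Lemma ac_path_exp : ac_path (fun t => expR (a * t)) (fun t => a * expR (a * t)).
Proof.
have cf : continuous (fun t => a * expR (a * t)).
  by move=> t; apply: cvgMr; exact: cexp.
move=> t t0; split.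
  apply: continuous_compact_integrable; first exact: segment_compact.
  exact: continuous_subspaceT.
move: t0; rewrite le_eqVlt => /orP[/eqP <-|t0].
  by rewrite set_itv1 Rintegral_set1 addr0.
have dE (x : R) : is_derive x 1 (fun t => expR (a * t)) (a * expR (a * x)).
  rewrite mulrC; apply: (@is_derive1_comp _ expR (fun t => a * t) x).
  by apply: is_derive_eq; rewrite /GRing.scale/= mulr1.
have FTC : (\int[mu]_(x in `[0%R, t]) (a * expR (a * x))%:E)%E =
    ((expR (a * t))%:E - (expR (a * 0))%:E)%E.
  apply: (@continuous_FTC2 _ _ (fun x => expR (a * x))) => //.
  - exact: continuous_subspaceT.
  - split.
    + by move=> x _; case: (dE x).
    + by apply: cvg_at_right_filter; exact: cexp.
    + by apply: cvg_at_left_filter; exact: cexp.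
  - by move=> x _; rewrite derive1E; apply: derive_val.
by rewrite /Rintegral FTC -EFinB /= addrC subrK.
Qed.

Lemma l2_exp : l2 (fun t => expR (a * t)).
Proof.
split.
  apply: (measurable_funS measurableT) => //; apply: measurableT_comp => //.
have r0 : 0 < - (2 * a) by rewrite oppr_gt0 pmulr_rlt0.
have := integral_exponential_pdf r0 => h.
(* The square of the exponential is a multiple of the exponential density with rate [- (2 * a)],
   whose integral is known. *)
apply: (@le_lt_trans _ _ (\int[mu]_(t in H) ((- (2 * a))^-1%:E * (exponential_pdf (- (2 * a)) t)%:E))%E).
  apply: le_integral_ae; apply: nearW => t /= t0; rewrite -EFinM lee_fin exponential_pdfE// mulrA mulVf ?gt_eqF// mul1r.
  by rewrite opprK expr2 -expRD ler_expR; lra.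
rewrite ge0_integralZl//=; last 4 first.
- exact: measurable_halfline.
- apply/measurable_EFinP; apply: (measurable_funS measurableT) => //.
  exact: measurable_exponential_pdf.
- by move=> t _; rewrite lee_fin exponential_pdf_ge0// ltW.
- by rewrite lee_fin invr_ge0 ltW.
apply: lte_mul_pinfty => //; first by rewrite lee_fin invr_ge0 ltW.
apply: (@le_lt_trans _ _ 1%E); last exact: ltry.
rewrite -h; apply: ge0_subset_integral => //.
- exact: measurable_halfline.
- by apply/measurable_EFinP; exact: measurable_exponential_pdf.
- by move=> t _; rewrite lee_fin exponential_pdf_ge0// ltW.
Qed.

Lemma l2_path_exp : l2_path (fun t => expR (a * t)) (fun t => a * expR (a * t)).
Proof. by split; [exact: ac_path_exp|apply: l2Z; exact: l2_exp|exact: l2_exp|exact: exp_cvg0]. Qed.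

End ExponentialPaths.

Section PathLemmas.
Context {R : realType}.
Local Notation mu := (@lebesgue_measure R).
Local Notation H := [set u : R | 0 <= u].
Local Notation RR := (measurableTypeR R).

Lemma halfline_bigcup : H = \bigcup_n `[0, n%:R]%classic :> set R.
Proof.
apply/seteqP; split=> [x /= x0|x [n _] /=]; last by rewrite in_itv/= => /andP[].
exists (Num.truncn x).+1 => //=; rewrite in_itv/= x0/= ltW//; exact: truncnS_gt.
Qed.

Lemma ac_path_measurable (X f : R -> R) : ac_path X f -> measurable_fun H f.
Proof.
move=> Xf; rewrite halfline_bigcup.
apply/(measurable_fun_bigcup _ (fun=> measurable_itv _)) => n.
by apply/measurable_EFinP; exact: measurable_int (Xf n%:R (ler0n _ _)).1.
Qed.

Lemma halfline_continuous_measurable (h : R -> R) : {within H, continuous h} ->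
  measurable_fun H h.
Proof. by apply: subspace_continuous_measurable_fun; exact: measurable_halfline. Qed.

Lemma ge0_halfline_integral_cvgn (f : R -> \bar R) : measurable_fun H f ->
  (forall t, 0 <= t -> (0 <= f t)%E) ->
  (\int[mu]_(s in `[0%R, n%:R]) f s)%E @[n --> \oo] --> (\int[mu]_(s in H) f s)%E.
Proof.
move=> mf f0; rewrite halfline_bigcup.
apply: (@ge0_nondecreasing_set_cvg_integral _ RR R (fun n => `[0, n%:R]%classic) f mu).
- move=> m n mn; apply/subsetPset => x /=; rewrite !in_itv/= => /andP[-> h]/=.
  by rewrite (le_trans h)// ler_nat.
- by move=> n; exact: measurable_itv.
- move=> n; apply: (measurable_funS (@measurable_halfline R)) => //.
  by move=> x /=; rewrite in_itv/= => /andP[].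
- by move=> n x /=; rewrite in_itv/= => /andP[x0 _]; exact: f0.
Qed.

Lemma ac_path_eq (X X' f : R -> R) : (forall t, 0 <= t -> X t = X' t) -> ac_path X f -> ac_path X' f.
Proof. by move=> XX Xf t t0; rewrite -!XX//; exact: Xf. Qed.

Lemma l2_path_eq (X X' f : R -> R) : (forall t, 0 <= t -> X t = X' t) ->
  l2_path X f -> l2_path X' f.
Proof.
move=> XX [aX lf lX cX]; split => //; first exact: ac_path_eq aX.
  split; first by apply: (eq_measurable_fun X) lX.1 => t /set_mem; exact: XX.
  rewrite (_ : (\int[mu]_(t in H) _)%E = (\int[mu]_(t in H) ((X t) ^+ 2)%:E)%E); first exact: lX.2.
  by apply: eq_integral => t /set_mem /= t0; rewrite XX.
apply: cvg_trans cX; apply: near_eq_cvg; near=> t; apply: XX.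
near: t; apply: nbhs_pinfty_ge; exact: num_real.
Unshelve. all: by end_near. Qed.

Lemma growth_cvg0 (x : R -> R) : (fun t => (x t) ^+ 2 * t * ln (ln t)) @ +oo --> 0 ->
  x t @[t --> +oo] --> 0.
Proof.
move=> /cvgrPdist_lt xg; apply/cvgrPdist_lt => e e0.
have /xg Hx : 0 < e ^+ 2 by rewrite exprn_gt0.
near=> t.
(* Beyond this time both [t] and [ln (ln t)] are at least 1, so the growth condition dominates the
   square itself. *)
have te : expR (expR 1) <= t by near: t; apply: nbhs_pinfty_ge; exact: num_real.
have t0 : 0 < t by apply: lt_le_trans te; exact: expR_gt0.
have l1 : expR 1 <= ln t by rewrite -ler_expR lnK.
have lt0 : 0 < ln t by apply: lt_le_trans l1; exact: expR_gt0.
have ll1 : 1 <= ln (ln t) by rewrite -ler_expR lnK.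
have e1 (y : R) : 1 <= expR y * expR (- y) by rewrite -expRD subrr expR0.
have t1 : 1 <= t.
  apply: le_trans te; rewrite -[leLHS]expR0 ler_expR; exact: expR_ge0.
rewrite sub0r normrN -(@ltr_pXn2r _ 2)// ?nnegrE ?(ltW e0)// real_normK ?num_real//.
have : `|0 - x t ^+ 2 * t * ln (ln t)| < e ^+ 2 by near: t.
rewrite sub0r normrN; apply: le_lt_trans; apply: le_trans (ler_norm _).
rewrite -mulrA -[leLHS]mulr1 ler_wpM2l ?sqr_ge0// -[leLHS]mulr1.
by apply: ler_pM.
Unshelve. all: by end_near. Qed.

End PathLemmas.

(** * Admissible strategies and revenues *)

Section Admissible.
Context {R : realType} {d : measure_display} {T : measurableType d}.
Variables (P : probability T R) (F : R -> set (set T)) (W : R -> T -> R).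
Hypotheses (HF : filtration F) (HW : brownian P F W).
Local Notation mu := (@lebesgue_measure R).
Local Notation H := [set u : R | 0 <= u].
Local Notation RR := (measurableTypeR R).

Definition Mint (Y Yd : R -> T -> R) (t : R) (w : T) : R :=
  Y t w * W t w - \int[mu]_(s in `[0, t]) (W s w * Yd s w).

Definition Qint (Y : R -> T -> R) (t : R) (w : T) : R :=
  \int[mu]_(s in `[0, t]) (Y s w) ^+ 2.

Lemma ac_path_stochint (Y Yd : R -> T -> R) (C : R) : adapted F Y ->
  (forall t w, 0 <= t -> `|Y t w| <= C) -> (forall w, ac_path (Y^~ w) (Yd^~ w)) ->
  stochint F W (Mint Y Yd) (Qint Y).
Proof.
move=> aY YC Yp; exists C, (fun n k w => Y (mesh n k) w); split.
- by move=> n k; apply/fmeasP => //; [exact: mesh_ge0|exact: aY (mesh_ge0 n k)].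
- by move=> n k w; apply: YC; exact: mesh_ge0.
- move=> t w t0; have [W0 [cW _]] := HW; split.
  + have := ac_path_continuous_parts_cvg (Yp w) (cW w) t0.
    by rewrite W0 mulr0 subr0.
  + have cY2 : {within H, continuous (fun s => Y s w ^+ 2)}.
      have cY := ac_path_continuous (Yp w).
      move=> x; apply: (@continuous_comp _ _ _ (Y^~ w : subspace H -> R) (fun y => y ^+ 2)).
        exact: cY.
      exact: exprn_continuous.
    have fi s : 0 <= s -> mu.-integrable `[0, s] (EFin \o (fun=> 1)).
      move=> s0; apply: continuous_compact_integrable; first exact: segment_compact.
      by apply: continuous_subspaceT => x; exact: cvg_cst.
    have c := riemann_stieltjes_cvg cY2 fi (leq0n 1) t0.
    have -> : Qint Y t w = \int[mu]_(s in `[0, t]) (Y s w ^+ 2 * 1).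
      by apply: eq_Rintegral => s _; rewrite mulr1.
    suff E n : dvar n (fun k w => Y (mesh n k) w) (Num.truncn (t * n.+1%:R)) w =
        \sum_(k < Num.truncn (t * n.+1%:R)) Y (mesh n (k + 0)) w ^+ 2 *
          (\int[mu]_(s in `[mesh n k, mesh n k.+1[) 1).
      by under eq_cvg do rewrite E.
    apply: eq_bigr => k _.
    rewrite addn0 Rintegral_cst//= lebesgue_measure_itv/= lte_fin mesh_ltS -EFinB/= meshSB mul1r.
    by [].
Qed.

(** A finite expectation of [int Y^2] yields square-integrable paths once this integral is known to
    be measurable in [w]; it is, as the limit of [Qint], which is itself a limit of Riemann sums. *)
Lemma admissible_paths x Y : admissible P F x Y -> exists (Yd : R -> T -> R) (C : R),
  [/\ adapted F Y /\ (forall w, Y 0 w = x),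
      (forall t w, 0 <= t -> `|Y t w| <= C),
      (forall w, ac_path (Y^~ w) (Yd^~ w)),
      {ae P, forall w, l2_path (Y^~ w) (Yd^~ w) /\
         (fun t => (Y t w) ^+ 2 * t * ln (ln t)) @ +oo --> 0} &
      exists K : R, forall n : nat, (\int[P]_w (Qint Y n%:R w)%:E <= K%:E)%E].
Proof.
move=> [[aY Y0] [Yd [_ Yp Yd2]] [C YC] EY2 grow].
have aYp w : ac_path (Y^~ w) (Yd^~ w) by move=> t t0; have := Yp w t t0; rewrite Y0.
have MQ := ac_path_stochint aY YC aYp.
have mY w : measurable_fun H (Y^~ w).
  by apply: halfline_continuous_measurable; exact: ac_path_continuous (aYp w).
have sub (n : nat) : `[0, n%:R]%classic `<=` H by move=> s /=; rewrite in_itv/= => /andP[].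
pose E w := (\int[mu]_(t in H) ((Y t w) ^+ 2)%:E)%E.
have QE n w : (Qint Y n%:R w)%:E = (\int[mu]_(t in `[0%R, n%:R]) ((Y t w) ^+ 2)%:E)%E.
  rewrite /Qint /Rintegral fineK//; apply: integrable_fin_num; first exact: measurable_itv.
  apply: continuous_compact_integrable; first exact: segment_compact.
  apply: (continuous_subspaceW (@sub n)) => z.
  apply: (@continuous_comp _ _ _ (Y^~ w : subspace H -> R) (fun y => y ^+ 2)).
    exact: (ac_path_continuous (aYp w)).
  exact: exprn_continuous.
have mY2 w : measurable_fun H (fun t => ((Y t w) ^+ 2)%:E).
  by apply/measurable_EFinP; apply: measurable_funX.
have cE w : (Qint Y n%:R w)%:E @[n --> \oo] --> E w.
  under eq_cvg do rewrite QE.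
  by apply: ge0_halfline_integral_cvgn => // t _; rewrite lee_fin sqr_ge0.
have mE : measurable_fun setT E.
  apply: (emeasurable_fun_cvg (fun n w => (Qint Y n%:R w)%:E)) => [n|w _]; last exact: cE.
  by apply/measurable_EFinP; have [] := stochint_measurable HF HW MQ (ler0n R n).
have E0 w : (0 <= E w)%E by apply: integral_ge0 => t _; rewrite lee_fin sqr_ge0.
have EK : (\int[P]_w E w < +oo)%E by exact: EY2.
have aeE : {ae P, forall w, (E w < +oo)%E}.
  have iE : P.-integrable setT E.
    apply/integrableP; split => //.
    by under eq_integral do rewrite gee0_abs//.
  apply: filterS (integrable_ae measurableT iE) => w /(_ I).
  by rewrite ge0_fin_numE.
exists Yd, C; split => //.
- apply: filterS3 aeE Yd2 grow => w Ew Ydw gw; split => //; split => //.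
  + by split; [exact: ac_path_measurable (aYp w)|exact: Ydw].
  + exact: growth_cvg0.
- exists (fine (\int[P]_w E w)) => n; rewrite fineK; last first.
    by rewrite ge0_fin_numE//; apply: integral_ge0.
  apply: le_integral_ae; apply: nearW => w _; rewrite QE.
  apply: ge0_subset_integral => //.
  + exact: measurable_halfline.
  + exact: mY2.
  + by move=> t _; rewrite lee_fin sqr_ge0.
Qed.

Lemma ae_witness (A : T -> Prop) : {ae P, forall w, A w} -> exists w, A w.
Proof.
move=> [N [mN N0 AN]]; apply: contrapT => nA.
have : P setT = 0%E.
  apply/eqP; rewrite eq_le measure_ge0 andbT -N0; apply: le_measure; rewrite ?inE//.
  by move=> w _; apply: AN => /= Aw; apply: nA; exists w.
by rewrite probability_setT => /eqP; rewrite onee_eq0.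
Qed.

(** The density of a deterministic strategy may still vary with [w]. The density at one good [w0]
    represents the common path, and so serves for every [w]. *)
Lemma admissible_det_path x Y : admissible_det P F x Y ->
  (forall w, Y 0 w = x) /\ exists f, forall w, l2_path (Y^~ w) f.
Proof.
move=> [aY dY]; have [Yd [C [[_ Y0] _ _ ae _]]] := admissible_paths aY.
split => //; have [w0 [pw _]] := ae_witness ae.
by exists (Yd^~ w0) => w; apply: l2_path_eq pw => t t0; exact: dY.
Qed.

End Admissible.

Section RevenuePath.
Context {R : realType} {d : measure_display} {T : measurableType d}.
Variables (P : probability T R) (F : R -> set (set T)) (W : R -> T -> R).
Hypotheses (HF : filtration F) (HW : brownian P F W).
Variables (S0 sigma gamma lambda : R).
Local Notation mu := (@lebesgue_measure R).
Local Notation H := [set u : R | 0 <= u].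
Local Notation RR := (measurableTypeR R).

Definition det_profile n (Zs : 'I_n -> R -> T -> R) (z g : 'I_n -> R -> R) :=
  forall j, (forall t w, 0 <= t -> Zs j t w = z j t) /\ l2_path (z j) (g j).

Definition others n (i : 'I_n) (z : 'I_n -> R -> R) (t : R) : R := \sum_(j < n | j != i) z j t.

(** The noise-free part of the revenue of an agent with initial position [x] and trading rate [f],
    when the opponents have aggregate position [G] and rate [g]. The agent's own permanent impact
    contributes only the boundary term in [x ^+ 2]. *)
Definition path_cost (x : R) (f G g : R -> R) : R :=
  S0 * x - gamma * (x ^+ 2 / 2) - gamma * ip f G - gamma * (x * G 0)
  - lambda * (ip f f + ip f g).

(** An upper limit along integers exists for every [w] and is measurable outright; [fine] makes it
    real. Where the stochastic integral converges it is the limit. *)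
Definition Mlim (Y Yd : R -> T -> R) (w : T) : R :=
  fine (limn_esup (fun n : nat => (Mint W Y Yd n%:R w)%:E)).

Lemma l2_path_others n (i : 'I_n) z g : (forall j, l2_path (z j) (g j)) ->
  l2_path (others i z) (others i g).
Proof. by move=> zg; exact: l2_path_sum. Qed.

Lemma revenue_ae n (Zs : 'I_n -> R -> T -> R) z g (i : 'I_n) x (Y Yd : R -> T -> R) :
  det_profile Zs z g -> (forall w, Y 0 w = x) ->
  stochint F W (Mint W Y Yd) (Qint Y) ->
  {ae P, forall w, l2_path (Y^~ w) (Yd^~ w) /\
         (fun t => (Y t w) ^+ 2 * t * ln (ln t)) @ +oo --> 0} ->
  {ae P, forall w, (Mint W Y Yd n0%:R w @[n0 --> \oo] --> Mlim Y Yd w) /\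
     revenue S0 sigma gamma lambda W (upd Zs i Y) i w =
     path_cost x (Yd^~ w) (others i z) (others i g) + sigma * Mlim Y Yd w}.
Proof.
move=> Zz Y0 MQ aeY.
have Zp j w : l2_path ((Zs j)^~ w) (g j).
  by have [Zt zg] := Zz j; apply: l2_path_eq zg => t t0; rewrite Zt.
have [W0 [cW _]] := HW.
apply: filterS3 aeY (stochint_cvg HF HW MQ) (brownian_product_cvg0 HF HW).
move=> w [pY gY] cM bp.
have [aY lf lY cY] := pY.
have cQ : cvg (Qint Y t w @[t --> +oo]).
  by apply/cvg_ex; eexists; exact: halfline_integral_cvg (l2_sqr_integrable lY).
have {cQ}cM := cM cQ.
have cMn : Mint W Y Yd n0%:R w @[n0 --> \oo] --> lim (Mint W Y Yd t w @[t --> +oo]).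
  by move/cvg_pinftyP: cM => /(_ (fun k => k%:R)); apply; exact: cvgr_idn.
have ME : Mlim Y Yd w = lim (Mint W Y Yd t w @[t --> +oo]) by exact: cvg_fine_limn_esup.
split; first by rewrite ME.
have aeF := ae_filter_ringOfSetsType mu.
have Gg := @l2_path_others n i z g (fun j => (Zz j).2).
have dYf := ac_path_derive aY.
(* There are finitely many agents, so one null set of times serves them all. *)
have aeD : {ae mu, forall t, forall j, 0 <= t -> derive1 ((Zs j)^~ w) t = g j t}.
  apply: filter_forall => j; apply: ac_path_derive; by have [] := Zp j w.
have Ep : {ae mu, forall t, 0 <= t -> price S0 sigma gamma lambda W (upd Zs i Y) t w =
    S0 + sigma * W t w + gamma * ((Y t w - Y 0 w) + (others i z t - others i z 0))
    + lambda * (Yd t w + others i g t)}.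
  apply: filterS2 dYf aeD => t dY dZ t0; rewrite /price; congr (_ + gamma * _ + lambda * _).
    rewrite (bigD1 i)//= {1 2}/upd eqxx; congr (_ + _).
    rewrite /others -sumrB; apply: eq_bigr => j ji; rewrite /upd (negbTE ji).
    by rewrite !(Zz j).1.
  rewrite (bigD1 i)//= {1}/upd eqxx; congr (_ + _); first exact: dY.
  by apply: eq_bigr => j ji; rewrite /upd (negbTE ji) /dot dZ.
have := path_revenue_cvg pY Gg (cW w) cM (bp _ gY) dYf Ep.
move=> /cvg_lim L; rewrite /revenue /upd eqxx -/(upd Zs i Y) /dot L//.
by rewrite ME /path_cost Y0 opprK; lra.
Qed.

End RevenuePath.

(** * Objectives and equilibria *)

Section MeanVarianceCost.
Context {R : realType}.
Variables (S0 sigma gamma lambda : R).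
Local Notation mu := (@lebesgue_measure R).
Local Notation H := [set u : R | 0 <= u].
Local Notation RR := (measurableTypeR R).
Local Notation path_cost := (path_cost S0 gamma lambda).

Definition mv_cost (alpha x : R) (y f G g : R -> R) : R :=
  path_cost x f G g - alpha / 2 * (sigma ^+ 2 * ip y y).

(** The Euler-Lagrange equation in du Bois-Reymond form: the momentum is an absolutely continuous
    path whose derivative is the position term. No second derivative of [X] is mentioned. *)
Definition euler_lagrange (alpha : R) (X f G g : R -> R) :=
  l2_path (fun t => gamma * G t + (2 * lambda) * f t + lambda * g t)
    (fun t => alpha * sigma ^+ 2 * X t).

Lemma mv_cost_quadratic (alpha x : R) (X f Y k G g : R -> R) :
  l2_path X f -> l2_path Y k -> X 0 = x -> Y 0 = x -> l2_path G g ->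
  euler_lagrange alpha X f G g ->
  mv_cost alpha x Y k G g = mv_cost alpha x X f G g
    - lambda * ip (fun t => k t - f t) (fun t => k t - f t)
    - alpha / 2 * sigma ^+ 2 * ip (fun t => Y t - X t) (fun t => Y t - X t).
Proof.
move=> Xf Yk X0 Y0 Gg EL.
(* The deviation [Y - X] vanishes at time 0, so pairing it with the momentum leaves no boundary
   term: this is the vanishing of the first variation. *)
have := l2_path_parts (l2_pathB Yk Xf) EL; rewrite X0 Y0 subrr mul0r oppr0.
have [_ lf lX _] := Xf; have [_ lk lY _] := Yk; have [_ lg lG _] := Gg.
have l1 := l2Z gamma lG; have l2' := l2Z (2 * lambda) lf; have l3 := l2Z lambda lg.
have lkf := l2B lk lf; have lYX := l2B lY lX.
have l12 := l2D l1 l2'.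
rewrite [X in _ + X]ipC.
rewrite (ipDr lkf l12 l3) (ipDr lkf l1 l2') !ipZr// /mv_cost /path_cost.
rewrite !(ipBl, ipBr)//.
rewrite (ipC f k) (ipC X Y).
by set a1 := ip _ _; set a2 := ip _ _; set a3 := ip _ _; set a4 := ip _ _; set a5 := ip _ _;
  set a6 := ip _ _; move: gamma lambda (sigma ^+ 2) => c1 c2 c3 h; nra.
Qed.

(** The opponents are coupled to the agent's rate bilinearly, so a change of opponents alters the
    gain of a deviation by cross terms only. In the uniqueness proof this compares the opponents of
    two equilibria. *)
Lemma mv_cost_swap (alpha x : R) (X f Y k G g G' g' : R -> R) :
  l2_path X f -> l2_path Y k -> l2_path G g -> l2_path G' g' ->
  (mv_cost alpha x Y k G g - mv_cost alpha x X f G g)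
  - (mv_cost alpha x Y k G' g' - mv_cost alpha x X f G' g') =
  - gamma * ip (fun t => k t - f t) (fun t => G t - G' t)
  - lambda * ip (fun t => k t - f t) (fun t => g t - g' t).
Proof.
move=> [_ lf lX _] [_ lk lY _] [_ lg lG _] [_ lg' lG' _].
have lkf := l2B lk lf.
by rewrite !(ipBl, ipBr)//; [rewrite /mv_cost /path_cost; ring|exact: l2B..].
Qed.

(** The difference of the squares is [2 Y X - X^2]. Up to time [S] it is at most [Y^2], because
    [(Y - X)^2 >= 0]; after [S] it is at most [2 C |X|]. So the full variance of [Y] gets replaced
    by the variance up to [S] and a tail of [X]. *)
Lemma sqr_shift_le (X Y : R -> R) (C : R) (S : nat) :
  mu.-integrable H (EFin \o (fun t => `|X t|)) -> l2 X -> l2 Y ->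
  (forall t, 0 <= t -> `|Y t| <= C) ->
  ip Y Y - ip (fun t => Y t - X t) (fun t => Y t - X t) <=
  \int[mu]_(t in `[0, S%:R]) (Y t ^+ 2) +
  2 * C * (\int[mu]_(t in H) `|X t| - \int[mu]_(t in `[0, S%:R]) `|X t|).
Proof.
move=> iX lX lY YC.
have mH : (measurable : set (set RR)) H := @measurable_halfline R.
pose D : set RR := `[0, S%:R]%classic.
have mD : measurable D by exact: measurable_itv.
have mHD : measurable (H `\` D) by exact: measurableD.
have DH : D `<=` H by move=> s; rewrite /D/= in_itv/= => /andP[].
have split_ (f : R -> R) : mu.-integrable H (EFin \o f) ->
    \int[mu]_(t in H) f t = \int[mu]_(t in D) f t + \int[mu]_(t in H `\` D) f t.
  move=> fi; rewrite -[in LHS](setDUK DH) Rintegral_setU//; first by rewrite setDUK.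
  by apply/disj_setPS => t [? []].
have iHD (f : R -> R) : mu.-integrable H (EFin \o f) -> mu.-integrable (H `\` D) (EFin \o f).
  by move=> fi; apply: integrableS fi => //; exact: subDsetl.
have iD (f : R -> R) : mu.-integrable H (EFin \o f) -> mu.-integrable D (EFin \o f).
  by move=> fi; apply: integrableS fi.
pose h t := 2 * (Y t * X t) - X t * X t.
have lYX := l2M_integrable lY lX; have lXX := l2M_integrable lX lX.
have ih : mu.-integrable H (EFin \o h).
  by have := integrableB mH (integrableZl mH 2 lYX) lXX; apply: eq_integrable.
have -> : ip Y Y - ip (fun t => Y t - X t) (fun t => Y t - X t) = \int[mu]_(t in H) h t.
  rewrite !(ipBl, ipBr)//; try exact: l2B.
  rewrite /h RintegralB//; last by have := integrableZl mH 2 lYX; apply: eq_integrable.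
  rewrite RintegralZl// -/(ip Y X) -/(ip X X) (ipC X Y); lra.
rewrite (split_ _ ih) (split_ _ iX) addrAC subrr add0r.
apply: lerD; last first.
  rewrite -RintegralZl//; last exact: iHD iX.
  apply: le_Rintegral => //; first exact: iHD.
    by apply: iHD; have := integrableZl mH (2 * C) iX; apply: eq_integrable.
  move=> t [/= t0 _]; rewrite /h.
  have := YC t t0; have := ler_norm (Y t * X t); rewrite normrM.
  have := normr_ge0 (X t); have := sqr_ge0 (X t); nra.
apply: le_Rintegral => //; first exact: iD.
  by have := iD _ (l2_sqr_integrable lY).
move=> t _; rewrite /h; have := sqr_ge0 (Y t - X t); nra.
Qed.

End MeanVarianceCost.

Section Objectives.
Context {R : realType} {d : measure_display} {T : measurableType d}.
Variables (P : probability T R) (F : R -> set (set T)) (W : R -> T -> R).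
Hypotheses (HF : filtration F) (HW : brownian P F W).
Variables (S0 sigma gamma lambda : R).
Local Notation mu := (@lebesgue_measure R).
Local Notation H := [set u : R | 0 <= u].
Local Notation RR := (measurableTypeR R).
Local Notation path_cost := (path_cost S0 gamma lambda).
Local Notation mv_cost := (mv_cost S0 sigma gamma lambda).
Local Notation revenue := (revenue S0 sigma gamma lambda W).
Local Notation Mlim := (Mlim W).

Lemma Mlim_measurable Y Yd : stochint F W (Mint W Y Yd) (Qint Y) ->
  measurable_fun setT (Mlim Y Yd).
Proof.
move=> MQ; apply: measurable_fine_limn_esup => n.
by have [] := stochint_measurable HF HW MQ (ler0n R n).
Qed.

Lemma det_revenue n (Zs : 'I_n -> R -> T -> R) z g (i : 'I_n) x (Y : R -> T -> R) y f :
  det_profile Zs z g -> admissible P F x Y ->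
  (forall t w, 0 <= t -> Y t w = y t) -> l2_path y f ->
  exists Z : T -> R, [/\ measurable_fun setT Z,
    forall b, (\int[P]_w (expR (b * Z w - b ^+ 2 * ip y y / 2))%:E = 1)%E &
    {ae P, forall w, revenue (upd Zs i Y) i w =
       path_cost x f (others i z) (others i g) + sigma * Z w}].
Proof.
move=> Zz AY Yy yf; have [_ [C [[aY Y0] YC _ _ _]]] := admissible_paths HF HW AY.
have pY w : l2_path (Y^~ w) f by apply: l2_path_eq yf => t t0; rewrite Yy.
have aYp w : ac_path (Y^~ w) f by have [] := pY w.
have MQ := ac_path_stochint HF HW aY YC aYp.
have aeY : {ae P, forall w, l2_path (Y^~ w) f /\
         (fun t => (Y t w) ^+ 2 * t * ln (ln t)) @ +oo --> 0}.
  by have [_ _ _ _] := AY; apply: filterS => w.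
have RZ := revenue_ae HF HW S0 sigma gamma lambda i Zz Y0 MQ aeY.
exists (Mlim Y (fun t _ => f t)); split; first exact: Mlim_measurable MQ.
- move=> b; have [_ _ ly _] := yf.
  have cM : {ae P, forall w, Mint W Y (fun t _ => f t) n0%:R w @[n0 --> \oo] -->
      Mlim Y (fun t _ => f t) w} by apply: filterS RZ => w [].
  apply: (stochint_terminal_exp HF HW MQ cM (Mlim_measurable MQ)
    (q := fun t => \int[mu]_(s in `[0, t]) (y s ^+ 2))).
  + move=> t w t0; apply: eq_Rintegral => s /set_mem /=; rewrite in_itv/= => /andP[s0 _].
    by rewrite Yy.
  + have := halfline_integral_cvg (l2_sqr_integrable ly).
    move=> /cvg_pinftyP /(_ (fun k => k%:R)) /(_ (@cvgr_idn R)).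
    by rewrite /ip; under [in X in _ -> X]eq_Rintegral do rewrite -expr2.
- by apply: filterS RZ => w [].
Qed.

Lemma mv_objective_affine (alpha c q : R) (Z V : T -> R) : measurable_fun setT Z -> 0 <= q ->
  (forall b, (\int[P]_w (expR (b * Z w - b ^+ 2 * q / 2))%:E = 1)%E) ->
  {ae P, forall w, V w = c + sigma * Z w} ->
  mv_objective P alpha V = (c - alpha / 2 * (sigma ^+ 2 * q))%:E.
Proof.
move=> mZ q0 ZE VZ.
have [igZ_ EZ] := gaussian_mean mZ q0 ZE; have [igZ2 EZ2] := gaussian_variance mZ q0 ZE.
have EV : ('E_P[V] = c%:E)%E.
  rewrite unlock (@eq_integral_ae _ _ _ P setT _ (fun w => (c + sigma * Z w)%:E)); last first.
    by apply: filterS VZ => w -> _.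
  rewrite meanE; last by apply: integrable_rvD; [exact: integrable_rv_cst|exact: integrable_rvZ].
  rewrite meanD; [|exact: integrable_rv_cst|exact: integrable_rvZ].
  by rewrite mean_cst meanZ// EZ mulr0 addr0.
rewrite /mv_objective /variance EV covariance.unlock EV/= expectation.unlock.
rewrite (@eq_integral_ae _ _ _ P setT _ (fun w => (sigma ^+ 2 * Z w ^+ 2)%:E)); last first.
  apply: filterS VZ => w Vw _; congr EFin.
  by rewrite -[LHS]/((V w - c) * (V w - c)) Vw; ring.
rewrite meanE; last exact: integrable_rvZ.
by rewrite meanZ// EZ2 -EFinM -EFinB.
Qed.

(** The certainty equivalent of a Gaussian revenue is its mean-variance value; this is what ties the
    two notions of equilibrium together on deterministic strategies. *)
Lemma cara_affine (alpha c q : R) (Z V : T -> R) : measurable_fun setT Z ->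
  alpha != 0 ->
  (forall b, (\int[P]_w (expR (b * Z w - b ^+ 2 * q / 2))%:E = 1)%E) ->
  {ae P, forall w, V w = c + sigma * Z w} ->
  ('E_P[fun w => cara alpha (V w)] = (cara alpha (c - alpha / 2 * (sigma ^+ 2 * q)))%:E)%E.
Proof.
move=> mZ a0 ZE VZ; pose a := - (alpha * sigma).
pose e w := expR (a * Z w - a ^+ 2 * q / 2).
have me : measurable_fun setT e.
  apply: measurableT_comp => //; apply: measurable_funB => //; exact: measurable_funM.
have ige : integrable_rv P e.
  apply: (@integrable_rv_ge0 _ _ _ P _ 1%E) => //; first by move=> w; exact: expR_ge0.
    by rewrite ltry.
  by rewrite ZE.
have Ee : mean P e = 1 by rewrite /mean ZE.
pose j := expR (- (alpha * (c - alpha / 2 * (sigma ^+ 2 * q)))).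
rewrite unlock (@eq_integral_ae _ _ _ P setT _ (fun w => (alpha^-1 + (- alpha^-1 * j) * e w)%:E)); last first.
  apply: filterS VZ => w -> _; rewrite /cara.
  have -> : expR (- (alpha * (c + sigma * Z w))) = j * e w.
    by rewrite /j /e -expRD /a; congr expR; field.
  by congr EFin; ring.
rewrite meanE; last by apply: integrable_rvD; [exact: integrable_rv_cst|exact: integrable_rvZ].
rewrite meanD; [|exact: integrable_rv_cst|exact: integrable_rvZ].
by rewrite mean_cst meanZ// Ee /cara /j; congr EFin; ring.
Qed.

(* With [a = - alpha sigma], [exp u >= 1 + u] bounds [exp (- alpha R)] below by
   [exp (- alpha J) * G * (1 - eps + a (M_oo - M_S))], where [G] is the exponential martingale
   of [a M] at time [S]; the increment [M_oo - M_S] is orthogonal to [G]. *)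
Lemma cara_optimal n (Zs : 'I_n -> R -> T -> R) z g (i : 'I_n) x alpha Y :
  0 < alpha -> 0 <= lambda -> det_profile Zs z g -> z i 0 = x ->
  euler_lagrange sigma gamma lambda alpha (z i) (g i) (others i z) (others i g) ->
  mu.-integrable H (EFin \o (fun t => `|z i t|)) ->
  admissible P F x Y ->
  ('E_P[fun w => cara alpha (revenue (upd Zs i Y) i w)] <=
    (cara alpha (mv_cost alpha x (z i) (g i) (others i z) (others i g)))%:E)%E.
Proof.
move=> a0 lam0 Zz z0 EL iz AY.
have [Yd [C [[aY Y0] YC aYp aeY [K EK]]]] := admissible_paths HF HW AY.
have MQ := ac_path_stochint HF HW aY YC aYp.
have RZ := revenue_ae HF HW S0 sigma gamma lambda i Zz Y0 MQ aeY.
have Gg := @l2_path_others _ _ i z g (fun j => (Zz j).2).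
have [_ zg] := Zz i; have [_ _ lz _] := zg.
set J := mv_cost _ _ _ _ _ _.
pose a := - (alpha * sigma).
(* [alpha ^+ 2 * sigma ^+ 2 / 2] times the tail term [2 * C * ...] of [sqr_shift_le]. *)
pose eps (S : nat) := alpha ^+ 2 * sigma ^+ 2 * C *
  (\int[mu]_(t in H) `|z i t| - \int[mu]_(t in `[0, S%:R]) `|z i t|).
have eps0 : eps S @[S --> \oo] --> 0.
  rewrite -[X in _ --> X](mulr0 (alpha ^+ 2 * sigma ^+ 2 * C)); apply: cvgMr.
  rewrite -[X in _ --> X](subrr (\int[mu]_(t in H) `|z i t|)).
  apply: cvgB; first exact: cvg_cst.
  by have /cvg_pinftyP/(_ (fun k => k%:R))/(_ (@cvgr_idn R)) := halfline_integral_cvg iz.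
have up (S : nat) : ('E_P[fun w => cara alpha (revenue (upd Zs i Y) i w)] <=
    (alpha^-1 * (1 - expR (- (alpha * J)) * (1 - eps S)))%:E)%E.
  have cM : {ae P, forall w, Mint W Y Yd n0%:R w @[n0 --> \oo] --> Mlim Y Yd w}.
    by apply: filterS RZ => w [].
  have [] := stochint_terminal_orth HF HW MQ cM (Mlim_measurable MQ) a S _ EK.
    by move=> t w t0; apply: Rintegral_ge0 => s _; exact: sqr_ge0.
  set G := (fun w => expR _); set GD := (fun w => G w * _) => igG EG igGD EGD.
  (* An integrable upper bound of the utility with an explicit mean; the utility itself is compared
     with it only as an integrand. *)
  pose U w := alpha^-1 + ((- alpha^-1 * expR (- (alpha * J)) * (1 - eps S)) * G w +
    (- alpha^-1 * expR (- (alpha * J)) * a) * GD w).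
  have igU : integrable_rv P U by apply: integrable_rvD; [exact: integrable_rv_cst|apply: integrable_rvD; exact: integrable_rvZ].
  have EU : mean P U = alpha^-1 * (1 - expR (- (alpha * J)) * (1 - eps S)).
    rewrite meanD; [|exact: integrable_rv_cst|by apply: integrable_rvD; exact: integrable_rvZ].
    rewrite meanD; [|exact: integrable_rvZ|exact: integrable_rvZ].
    by rewrite mean_cst !meanZ// EG EGD; ring.
  rewrite -EU -meanE// unlock; apply: le_integral_ae.
  apply: filterS2 aeY RZ => w [pY _] [_ ->] _; rewrite lee_fin.
  have [_ lf lY _] := pY.
  have mq := mv_cost_quadratic S0 zg pY z0 (Y0 w) Gg EL.
  have k0 := ip_ge0 (fun t => Yd t w - g i t).
  have sh := @sqr_shift_le R (z i) (Y^~ w) C S iz lz lY (fun t t0 => YC t w t0).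
  set r := _ + sigma * _.
  have key : expR (- (alpha * J)) * (G w * ((1 - eps S) + a * (Mlim Y Yd w - Mint W Y Yd S%:R w)))
      <= expR (- (alpha * r)).
    apply: (@le_trans _ _ (expR (- (alpha * J)) * (G w * expR (a * (Mlim Y Yd w - Mint W Y Yd S%:R w) - eps S)))).
      rewrite ler_wpM2l ?expR_ge0// ler_wpM2l ?expR_ge0//.
      by apply: le_trans (expR_ge1Dx _); lra.
    rewrite /G -!expRD ler_expR.
    have : 0 <= alpha * lambda * ip (fun t => Yd t w - g i t) (fun t => Yd t w - g i t).
      by rewrite mulr_ge0// mulr_ge0// ltW.
    have : alpha ^+ 2 * sigma ^+ 2 / 2 * (ip (Y^~ w) (Y^~ w) -
        ip (fun t => Y t w - z i t) (fun t => Y t w - z i t)) <=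
      alpha ^+ 2 * sigma ^+ 2 / 2 * (\int[mu]_(t in `[0, S%:R]) (Y t w ^+ 2) +
        2 * C * (\int[mu]_(t in H) `|z i t| - \int[mu]_(t in `[0, S%:R]) `|z i t|)).
      by rewrite ler_wpM2l// divr_ge0// mulr_ge0// sqr_ge0.
    move: mq; rewrite -/J /mv_cost -/(Qint Y S%:R w) /r /eps /a => mq; clear -mq; nra.
  have -> : U w = alpha^-1 * (1 - expR (- (alpha * J)) *
      (G w * ((1 - eps S) + a * (Mlim Y Yd w - Mint W Y Yd S%:R w)))).
    by rewrite /U /GD; ring.
  by rewrite /cara ler_wpM2l ?invr_ge0 ?(ltW a0)// lerD2l lerN2.
(* The utility is unbounded below, so its expectation may be [-oo]; any one of the bounds [up]
   excludes [+oo]. *)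
case E : ('E_P[_])%E up => [e| |] up.
- rewrite lee_fin; have c : alpha^-1 * (1 - expR (- (alpha * J)) * (1 - eps S)) @[S --> \oo] -->
      cara alpha J.
    have -> : cara alpha J = alpha^-1 * (1 - expR (- (alpha * J)) * (1 - 0)).
      by rewrite /cara subr0 mulr1.
    by apply: cvgMr; apply: cvgB; [exact: cvg_cst|apply: cvgMr; apply: cvgB eps0; exact: cvg_cst].
  apply: cvg_ge_cst c _; near=> S; by have := up S; rewrite lee_fin.
- by have := up 0%N; rewrite leye_eq.
- by rewrite leNye.
Unshelve. all: by end_near. Qed.

End Objectives.

Section Equilibrium.
Context {R : realType} {d : measure_display} {T : measurableType d}.
Variables (P : probability T R) (F : R -> set (set T)) (W : R -> T -> R).
Hypotheses (HF : filtration F) (HW : brownian P F W).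
Variables (S0 sigma gamma lambda : R).
Hypotheses (sigma0 : sigma != 0) (lambda0 : 0 < lambda).
Local Notation mu := (@lebesgue_measure R).
Local Notation H := [set u : R | 0 <= u].
Local Notation RR := (measurableTypeR R).
Local Notation mv_cost := (mv_cost S0 sigma gamma lambda).
Local Notation revenue := (revenue S0 sigma gamma lambda W).

Lemma upd_id n (Zs : 'I_n -> R -> T -> R) (i : 'I_n) : upd Zs i (Zs i) = Zs.
Proof. by apply/funext => j; rewrite /upd; case: eqP => // ->. Qed.

Lemma det_mv_objective n (Zs : 'I_n -> R -> T -> R) z g (i : 'I_n) alpha x (Y : R -> T -> R) y f :
  det_profile Zs z g -> admissible P F x Y ->
  (forall t w, 0 <= t -> Y t w = y t) -> l2_path y f ->
  mv_objective P alpha (revenue (upd Zs i Y) i) =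
  (mv_cost alpha x y f (others i z) (others i g))%:E.
Proof.
move=> Zz AY Yy yf.
have [Z [mZ ZE RZ]] := det_revenue HF HW S0 sigma gamma lambda i Zz AY Yy yf.
exact: mv_objective_affine mZ (ip_ge0 _) ZE RZ.
Qed.

(* Stated on both sides at once: rewriting them one by one makes unification unfold [revenue]. *)
Lemma det_mv_objective_le n (Zs : 'I_n -> R -> T -> R) z g (i : 'I_n) alpha x (Y : R -> T -> R) y f :
  det_profile Zs z g -> admissible P F x (Zs i) -> admissible P F x Y ->
  (forall t w, 0 <= t -> Y t w = y t) -> l2_path y f ->
  (mv_objective P alpha (revenue (upd Zs i Y) i) <= mv_objective P alpha (revenue Zs i))%E =
  (mv_cost alpha x y f (others i z) (others i g) <=
   mv_cost alpha x (z i) (g i) (others i z) (others i g)).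
Proof.
move=> Zz AZ AY Yy yf; rewrite -lee_fin.
have := det_mv_objective i alpha Zz AZ (Zz i).1 (Zz i).2; rewrite upd_id => <-.
by rewrite -(det_mv_objective i alpha Zz AY Yy yf).
Qed.

Lemma admissible_det_profile n (x : 'I_n -> R) (Ys : 'I_n -> R -> T -> R) :
  (forall i, admissible_det P F (x i) (Ys i)) ->
  exists z g, det_profile Ys z g /\ forall i, z i 0 = x i.
Proof.
move=> aY; have [w0 _] : exists w : T, True by apply: (@ae_witness _ _ _ P); exact: nearW.
have /choice[g pg] i : exists f, forall w, l2_path ((Ys i)^~ w) f.
  by have [_] := admissible_det_path HF HW (aY i).
exists (fun i t => Ys i t w0), g; split=> [j|i].
  by split=> [t w t0|//]; exact: (aY j).2.
by have [] := admissible_det_path HF HW (aY i).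
Qed.

(* The [gamma] terms telescope to [int K H = - H(0)^2 / 2 = 0], with [H] and [K] the total
   deviation and its derivative. *)
Lemma cross_terms_sum n (h k : 'I_n -> R -> R) : (forall i, l2_path (h i) (k i)) ->
  (forall i, h i 0 = 0) ->
  \sum_i (- gamma * ip (k i) (others i h) - lambda * ip (k i) (others i k)) =
  \sum_i lambda * ip (k i) (k i)
    - lambda * ip (fun t => \sum_i k i t) (fun t => \sum_i k i t).
Proof.
move=> hk h0; pose Hs t := \sum_i h i t; pose Ks t := \sum_i k i t.
have pHK : l2_path Hs Ks by apply: l2_path_sum.
have lk i : l2 (k i) by have [] := hk i.
have lh i : l2 (h i) by have [] := hk i.
have [_ lK lH _] := pHK.
have oth (u : 'I_n -> R -> R) i : others i u = fun t => \sum_j u j t - u i t.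
  by apply/funext => t; rewrite /others [in RHS](bigD1 i)//= addrAC subrr add0r.
have E i : - gamma * ip (k i) (others i h) - lambda * ip (k i) (others i k) =
    - gamma * ip (k i) Hs + (lambda * ip (k i) (k i) - lambda * ip (k i) Ks).
  rewrite !oth !ipBr// -/Hs -/Ks; have := l2_path_self (hk i).
  by rewrite h0 expr0n/= mul0r oppr0 ipC => ->; ring.
have sumK (f : R -> R) : l2 f -> \sum_i ip (k i) f = ip Ks f.
  by move=> lf; rewrite ipC /Ks (ip_sumr xpredT)//; apply: eq_bigr => i _; exact: ipC.
under eq_bigr do rewrite E.
rewrite big_split/= -mulr_sumr sumK// big_split/= sumrN -!mulr_sumr sumK//.
have := l2_path_self pHK; rewrite /Hs big1 ?expr0n/= ?mul0r ?oppr0//.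
by rewrite ipC => ->; ring.
Qed.

Lemma nash_of_euler_lagrange n (alpha x : 'I_n -> R) (z g : 'I_n -> R -> R) :
  (forall i, 0 < alpha i) -> (forall i, l2_path (z i) (g i)) -> (forall i, z i 0 = x i) ->
  (forall i, euler_lagrange sigma gamma lambda (alpha i) (z i) (g i) (others i z) (others i g)) ->
  (forall i, mu.-integrable H (EFin \o (fun t => `|z i t|))) ->
  (forall i, admissible_det P F (x i) (fun t _ => z i t)) ->
  unique_nash_mv_and_cara P S0 sigma gamma lambda W F x alpha (fun i t _ => z i t).
Proof.
move=> a0 zg z0 EL iz adm; pose Xs : 'I_n -> R -> T -> R := fun i t _ => z i t.
have Xz : det_profile Xs z g by [].
have Gg i := @l2_path_others R n i z g zg.
have sig2 : 0 < sigma ^+ 2 by rewrite lt_neqAle sqr_ge0 andbT eq_sym sqrf_eq0.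
have cost_le i (h k : R -> R) : 0 <= lambda * ip k k + alpha i / 2 * sigma ^+ 2 * ip h h.
  rewrite addr_ge0// mulr_ge0 ?ip_ge0// ?(ltW lambda0)// mulr_ge0 ?(ltW sig2)//.
  by rewrite divr_ge0// ltW.
split.
- move=> i; split; first exact: adm.
  move=> Y aY; have [Y0 _] := admissible_det_path HF HW aY.
  (* The lemma on profiles, applied to a profile with one agent, supplies a path and a density for
     [Y]. *)
  have [zY [gY [YzY zY0]]] := @admissible_det_profile 1 (fun=> x i) (fun=> Y) (fun=> aY).
  have [Yt pY] := YzY ord0.
  rewrite (det_mv_objective_le (alpha i) Xz (adm i).1 aY.1 Yt pY).
  rewrite (mv_cost_quadratic S0 (zg i) pY (z0 i) (zY0 ord0) (Gg i) (EL i)).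
  by have := cost_le i (fun t => zY ord0 t - z i t) (fun t => gY ord0 t - g i t); lra.
- move=> Ys nY.
  have aY i : admissible_det P F (x i) (Ys i) by have [] := nY i.
  have [y [f [Yy y0]]] := admissible_det_profile aY.
  have pY i := (Yy i).2.
  pose h i t := y i t - z i t; pose k i t := f i t - g i t.
  have hk i : l2_path (h i) (k i) by exact: l2_pathB.
  have h0 i : h i 0 = 0 by rewrite /h y0 z0 subrr.
  (* Against the opponents in [Ys], switching to [X*] does not pay. The quadratic formula gives the
     corresponding gap against the opponents in [X*], and [mv_cost_swap] passes from one to the
     other. *)
  have ineq i : 0 <= - lambda * ip (k i) (k i) - alpha i / 2 * sigma ^+ 2 * ip (h i) (h i)
      + (- gamma * ip (k i) (others i h) - lambda * ip (k i) (others i k)).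
    have := (nY i).2 (Xs i) (adm i).
    rewrite (det_mv_objective_le (alpha i) Yy (aY i).1 (adm i).1 (Xz i).1 (zg i)) => le1.
    have q1 := mv_cost_quadratic S0 (zg i) (pY i) (z0 i) (y0 i) (Gg i) (EL i).
    have := mv_cost_swap S0 sigma gamma lambda (alpha i) (x i) (zg i) (pY i)
      (l2_path_others i pY) (Gg i).
    have subo (u v : 'I_n -> R -> R) : (fun t => others i u t - others i v t) =
        others i (fun j t => u j t - v j t).
      by apply/funext => t; rewrite /others -sumrB.
    rewrite !subo -/h -/k -/(h i) -/(k i) => q2.
    by move: q1; rewrite -/(h i) -/(k i) => q1; lra.
  have : 0 <= \sum_i (- lambda * ip (k i) (k i) - alpha i / 2 * sigma ^+ 2 * ip (h i) (h i)
      + (- gamma * ip (k i) (others i h) - lambda * ip (k i) (others i k))).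
    by apply: sumr_ge0 => i _; exact: ineq.
  (* The terms [lambda * ip (k i) (k i)] now occur with both signs and cancel; all that is left is
     nonpositive, so each [ip (h i) (h i)] must vanish. *)
  rewrite big_split/= cross_terms_sum// sumrB => tot.
  have hz : \sum_i alpha i / 2 * sigma ^+ 2 * ip (h i) (h i) <= 0.
    move: tot; under eq_bigr do rewrite mulNr; rewrite sumrN.
    have := mulr_ge0 (ltW lambda0) (ip_ge0 (fun t => \sum_i k i t)); lra.
  have pos i : 0 <= alpha i / 2 * sigma ^+ 2 * ip (h i) (h i).
    by rewrite mulr_ge0 ?ip_ge0// mulr_ge0 ?(ltW sig2)// divr_ge0// ltW.
  have hz0 : \sum_i alpha i / 2 * sigma ^+ 2 * ip (h i) (h i) = 0.
    by apply/eqP; rewrite eq_le hz sumr_ge0.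
  move=> i t w t0; rewrite (Yy i).1//; apply/eqP; rewrite -subr_eq0; apply/eqP.
  have [ah _ lh _] := hk i.
  apply: (ip_eq0 (ac_path_continuous ah) lh) => //.
  have := psumr_eq0P (fun i _ => pos i) hz0 => /(_ i isT)/eqP.
  rewrite !mulf_eq0 (gt_eqF (a0 i)) (negbTE sigma0) invr_eq0 pnatr_eq0/= => /eqP//.
- move=> i; split; first exact: (adm i).1.
  move=> Y aY.
  have := cara_optimal HF HW S0 (a0 i) (ltW lambda0) Xz (z0 i) (EL i) (iz i) aY.
  move=> /le_trans; apply.
  have [Z [mZ ZE RZ]] := det_revenue HF HW S0 sigma gamma lambda i Xz (adm i).1 (Xz i).1 (zg i).
  rewrite upd_id in RZ.
  by rewrite (cara_affine mZ _ ZE RZ)// gt_eqF.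
Qed.

End Equilibrium.

(** * Equilibria that are combinations of two exponentials *)

Section ExponentialEquilibrium.
Context {R : realType} {d : measure_display} {T : measurableType d}.
Variables (P : probability T R) (F : R -> set (set T)) (W : R -> T -> R).
Hypotheses (HF : filtration F) (HW : brownian P F W).
Local Notation mu := (@lebesgue_measure R).
Local Notation H := [set u : R | 0 <= u].
Local Notation RR := (measurableTypeR R).

Lemma deterministic_admissible (z g : R -> R) (C : R) : l2_path z g ->
  (forall t, 0 <= t -> `|z t| <= C) ->
  (fun t => (z t) ^+ 2 * t * ln (ln t)) @ +oo --> 0 ->
  admissible_det P F (z 0) (fun t _ => z t).
Proof.
move=> [az lg lz cz] zC gz; have [Fs _] := HF; split; last by [].
have FT t : 0 <= t -> F t setT.
  by move=> t0; have [F0 FC _] := Fs t t0; rewrite -(setD0 setT); exact: FC.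
split.
- split=> // t t0 B mB; have [F0 _ _] := Fs t t0.
  have [zB|zB] := pselect (B (z t)).
    by rewrite (_ : _ @^-1` B = setT); [exact: FT|rewrite preimage_cst mem_set].
  by rewrite (_ : _ @^-1` B = set0)// preimage_cst memNset.
- exists (fun t _ => g t); split.
  + move=> t t0 B mB; apply: sub_sigma_algebra.
    exists (`[0, t]%classic `&` g @^-1` B), setT; split => //.
    * have := lg.1 _ B mB => /(_ (@measurable_halfline R)) mg.
      rewrite (_ : _ `&` _ = `[0, t]%classic `&` (H `&` g @^-1` B)).
        by apply: measurableI.
      by apply/seteqP; split=> s /=; rewrite in_itv/=; [move=> [/andP[-> ->]]|move=> [? []]].
    * exact: FT.
    * by apply/seteqP; split=> -[s w] /=; rewrite in_itv/=; tauto.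
  + by move=> w t t0; exact: az t t0.
  + by apply: nearW => w; exact: lg.2.
- by exists C => t w; exact: zC.
- have -> (c : \bar R) : (\int[P]_w c = c)%E.
    rewrite integral_cst//=.
    by rewrite probability_setT mule1.
  exact: lz.2.
- exact: nearW.
Qed.

Variables (S0 sigma gamma lambda : R).
Hypotheses (sigma0 : sigma != 0) (lambda0 : 0 < lambda).

(** The two systems compare the coefficients of [exp (a1 t)] and [exp (a2 t)] in the Euler-Lagrange
    equations. Everything else that an equilibrium requires follows from the decay of the
    exponentials. *)
Lemma exp_equilibrium n (alpha x : 'I_n -> R) (a1 a2 : R) (c1 c2 : 'I_n -> R) :
  (forall i, 0 < alpha i) -> a1 < 0 -> a2 < 0 -> (forall i, c1 i + c2 i = x i) ->
  (forall i, a1 * (gamma * \sum_(j < n | j != i) c1 j + 2 * lambda * a1 * c1 i +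
     lambda * a1 * \sum_(j < n | j != i) c1 j) = alpha i * sigma ^+ 2 * c1 i) ->
  (forall i, a2 * (gamma * \sum_(j < n | j != i) c2 j + 2 * lambda * a2 * c2 i +
     lambda * a2 * \sum_(j < n | j != i) c2 j) = alpha i * sigma ^+ 2 * c2 i) ->
  unique_nash_mv_and_cara P S0 sigma gamma lambda W F x alpha
    (fun i t _ => c1 i * expR (a1 * t) + c2 i * expR (a2 * t)).
Proof.
move=> al0 a10 a20 cx E1 E2.
pose z i t := c1 i * expR (a1 * t) + c2 i * expR (a2 * t).
pose g i t := c1 i * (a1 * expR (a1 * t)) + c2 i * (a2 * expR (a2 * t)).
have pz (u v : R) : l2_path (fun t => u * expR (a1 * t) + v * expR (a2 * t))
    (fun t => u * (a1 * expR (a1 * t)) + v * (a2 * expR (a2 * t))).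
  by apply: l2_pathD; apply: l2_pathZ; exact: l2_path_exp.
have zg i : l2_path (z i) (g i) by exact: pz.
have z0 i : z i 0 = x i by rewrite /z !mulr0 expR0 !mulr1.
have e1 (a t : R) : a < 0 -> 0 <= t -> expR (a * t) <= 1.
  by move=> a0 t0; rewrite -expR0 ler_expR; apply: mulr_le0_ge0 => //; exact: ltW.
have zb i t : `|z i t| <= `|c1 i| * expR (a1 * t) + `|c2 i| * expR (a2 * t).
  by rewrite (le_trans (ler_normD _ _))// !normrM !(ger0_norm (expR_ge0 _)).
have zC i t : 0 <= t -> `|z i t| <= `|c1 i| + `|c2 i|.
  move=> t0; apply: le_trans (zb i t) _; apply: lerD.
    by rewrite -[leRHS]mulr1 ler_wpM2l// e1.
  by rewrite -[leRHS]mulr1 ler_wpM2l// e1.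
have gr i : (fun t => (z i t) ^+ 2 * t * ln (ln t)) @ +oo --> 0.
  have cg (a c : R) : a < 0 -> (c * (expR (a * t) * t * ln (ln t))) @[t --> +oo] --> 0.
    by move=> a0; rewrite -(mulr0 c); apply: cvgMr; exact: exp_growth_cvg0.
  have c11 : a1 + a1 < 0 by lra.
  have c12 : a1 + a2 < 0 by lra.
  have c22 : a2 + a2 < 0 by lra.
  have E t : (z i t) ^+ 2 * t * ln (ln t) =
      c1 i ^+ 2 * (expR ((a1 + a1) * t) * t * ln (ln t)) +
      2 * c1 i * c2 i * (expR ((a1 + a2) * t) * t * ln (ln t)) +
      c2 i ^+ 2 * (expR ((a2 + a2) * t) * t * ln (ln t)).
    by rewrite !mulrDl !expRD /z; ring.
  have := cvgD (cvgD (cg _ (c1 i ^+ 2) c11) (cg _ (2 * c1 i * c2 i) c12)) (cg _ (c2 i ^+ 2) c22).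
  rewrite !addr0 (funext E) => h; exact: h.
apply: (@nash_of_euler_lagrange _ _ _ P F W HF HW S0 sigma gamma lambda sigma0 lambda0 n alpha x z g) => //.
- move=> i; rewrite /euler_lagrange.
  pose p1 := gamma * \sum_(j < n | j != i) c1 j + 2 * lambda * a1 * c1 i +
     lambda * a1 * \sum_(j < n | j != i) c1 j.
  pose p2 := gamma * \sum_(j < n | j != i) c2 j + 2 * lambda * a2 * c2 i +
     lambda * a2 * \sum_(j < n | j != i) c2 j.
  have oz t : others i z t = (\sum_(j < n | j != i) c1 j) * expR (a1 * t) +
      (\sum_(j < n | j != i) c2 j) * expR (a2 * t).
    by rewrite /others big_split/= !mulr_suml.
  have og t : others i g t = (\sum_(j < n | j != i) c1 j) * (a1 * expR (a1 * t)) +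
      (\sum_(j < n | j != i) c2 j) * (a2 * expR (a2 * t)).
    by rewrite /others big_split/= !mulr_suml.
  have := pz p1 p2.
  have -> : (fun t => p1 * expR (a1 * t) + p2 * expR (a2 * t)) =
      (fun t => gamma * others i z t + 2 * lambda * g i t + lambda * others i g t).
    by apply/funext => t; rewrite oz og /g /p1 /p2; ring.
  have -> // : (fun t => p1 * (a1 * expR (a1 * t)) + p2 * (a2 * expR (a2 * t))) =
      (fun t => alpha i * sigma ^+ 2 * z i t).
    apply/funext => t; rewrite /z !(mulrA p1) !(mulrA p2) [p1 * _]mulrC [p2 * _]mulrC /p1 /p2.
    by rewrite E1 E2 -!(mulrA (alpha i * _)) -mulrDr.

- move=> i.
  have l1 (a : R) : a < 0 -> mu.-integrable H (EFin \o (fun t => expR (a * t))).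
    move=> a0; have a2' : a / 2 < 0 by rewrite pmulr_llt0.
    have := l2_sqr_integrable (l2_exp a2'); apply: eq_integrable => //; first exact: measurable_halfline.
    by move=> t _ /=; rewrite -expRM_natl; congr (expR _)%:E; field.
  have mH : (measurable : set (set RR)) H := @measurable_halfline R.
  have ib := integrableD mH (integrableZl mH `|c1 i| (l1 _ a10)) (integrableZl mH `|c2 i| (l1 _ a20)).
  apply: (@le_integrable_R _ RR R mu H _ (fun t => `|c1 i| * expR (a1 * t) + `|c2 i| * expR (a2 * t))) => //.
  + by apply: measurableT_comp => //; have [_ _ lz _] := zg i; exact: lz.1.
  + by move=> t _; rewrite normr_id; exact: zb.
- by move=> i; rewrite -z0; apply: deterministic_admissible (zg i) (zC i) (gr i).
Qed.

End ExponentialEquilibrium.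

(** * Characteristic equations *)

Section Algebra.
Context {R : realType}.

(** The square root exceeds [|B|] because [A * C > 0]. Case (a) uses [C = alpha * sigma ^+ 2], once
    with [A = lambda] and [B = - gamma], once with [A = (n + 1) * lambda] and
    [B = (n - 1) * gamma]. *)
Lemma quadratic_neg_root (A B C : R) : 0 < A -> 0 < C ->
  let r := - B / (2 * A) - Num.sqrt (B ^+ 2 + 4 * A * C) / (2 * A) in
  r < 0 /\ A * r ^+ 2 + B * r = C.
Proof.
move=> A0 C0; set D := B ^+ 2 + _; set s := Num.sqrt D => r.
have AC : 0 < A * C by rewrite mulr_gt0.
have D0 : 0 <= D by have := sqr_ge0 B; rewrite /D; nra.
have s2 : s ^+ 2 = D by exact: sqr_sqrtr.
have s0 : 0 <= s by exact: sqrtr_ge0.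
have rE : r = (- B - s) / (2 * A) by rewrite /r -mulrBl.
split; last first.
  apply: (@mulfI _ (4 * A)); first by rewrite mulf_neq0 ?gt_eqF.
  transitivity ((2 * A * r + B) ^+ 2 - B ^+ 2); first by ring.
  have -> : 2 * A * r + B = - s by rewrite rE; field; rewrite gt_eqF.
  by rewrite sqrrN s2 /D; ring.
rewrite rE pmulr_llt0 ?invr_gt0 ?mulr_gt0// subr_lt0 ltNge; apply/negP => sB.
have := lerXn2r 2 s0 (le_trans s0 sB) sB; rewrite s2 sqrrN /D; nra.
Qed.

Section Quartic.
Variables (gamma lambda A1 A2 : R).
Hypotheses (g0 : 0 <= gamma) (l0 : 0 < lambda) (A10 : 0 < A1) (A20 : 0 < A2) (A12 : A1 != A2).

Let B := gamma ^+ 2 + 2 * lambda * (A1 + A2).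
(** The quartic of case (b) cleared of its denominator [3 * lambda ^+ 2], where [A1] and [A2] stand
    for [alpha_i * sigma ^+ 2]. *)
Let p (t : R) := 3 * lambda ^+ 2 * t ^+ 4 - 2 * gamma * lambda * t ^+ 3 - B * t ^+ 2 + A1 * A2.

Lemma quartic_detE t :
  p t = (2 * lambda * t ^+ 2 - A1) * (2 * lambda * t ^+ 2 - A2) - (lambda * t ^+ 2 + gamma * t) ^+ 2.
Proof. by rewrite /p /B; ring. Qed.

Let pcont (D : set R) : {within D, continuous p}.
Proof.
apply: continuous_subspaceT => t; rewrite /p.
apply: cvgD; last exact: cvg_cst.
apply: cvgB; last by apply: cvgMr; exact: exprn_continuous.
apply: cvgB; by apply: cvgMr; exact: exprn_continuous.
Qed.

(* Divided differences of [p t / t ^+ 2], which is strictly convex on the negative axis. *)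
Lemma quartic_two_neg_roots t1 t2 t3 : t1 < 0 -> t2 < 0 -> t3 < 0 ->
  p t1 = 0 -> p t2 = 0 -> p t3 = 0 -> t1 != t2 -> t3 = t1 \/ t3 = t2.
Proof.
move=> n1 n2 n3 p1 p2 p3 t12.
have [->|t31] := eqVneq t3 t1; first by left.
have [->|t32] := eqVneq t3 t2; first by right.
(* [K u v] is [u ^+ 2 * v ^+ 2] times the first divided difference of [p t / t ^+ 2]. The second
   divided difference, which appears below, is positive at three negative points. *)
exfalso; pose K u v := (3 * lambda ^+ 2 * (u + v) - 2 * gamma * lambda) * u ^+ 2 * v ^+ 2
  - A1 * A2 * (u + v).
have KE u v : p u = 0 -> p v = 0 -> u != v -> K u v = 0.
  move=> pu pv uv; apply: (@mulfI _ (u - v)); first by rewrite subr_eq0.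
  rewrite mulr0; transitivity (v ^+ 2 * p u - u ^+ 2 * p v); first by rewrite /K /p; ring.
  by rewrite pu pv !mulr0 subrr.
have k12 := KE _ _ p1 p2 t12.
have k13 : K t1 t3 = 0 by apply: KE => //; rewrite eq_sym.
have : (t2 - t3) * (3 * lambda ^+ 2 * t1 ^+ 2 * t2 ^+ 2 * t3 ^+ 2 +
    A1 * A2 * (t1 * (t2 + t3) + t2 * t3)) = 0.
  transitivity (t3 ^+ 2 * K t1 t2 - t2 ^+ 2 * K t1 t3); first by rewrite /K; ring.
  by rewrite k12 k13 !mulr0 subrr.
move/eqP; rewrite mulf_eq0 subr_eq0 eq_sym (negbTE t32)/= => /eqP.
apply/eqP; rewrite gt_eqF// ltr_wpDl//.
  by have := sqr_ge0 (lambda * t1 * t2 * t3); lra.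
have n23 : t2 + t3 < 0 by lra.
by rewrite mulr_gt0 ?mulr_gt0// addr_gt0 ?nmulr_rgt0.
Qed.

(** [p] is positive far to the left and at 0, and negative somewhere between. At
    [s = - sqrt (A / (2 lambda))], with [A] either [A1] or [A2], a diagonal entry of the matrix
    vanishes and [p s = - (lambda s^2 + gamma s)^2]. This is zero only if [lambda s = - gamma],
    which cannot happen for both choices since [A1] and [A2] differ. *)
Lemma quartic_neg_roots : exists t1 t2, [/\ t1 < 0, t2 < 0, t1 != t2, p t1 = 0 & p t2 = 0].
Proof.
have [s s0 ps] : exists2 s, s < 0 & p s < 0.
  pose r A := - Num.sqrt (A / (2 * lambda)).
  have rP A : 0 < A -> r A < 0 /\ 2 * lambda * r A ^+ 2 = A.
    move=> A0; have q0 : 0 < A / (2 * lambda) by rewrite divr_gt0 ?mulr_gt0.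
    split; first by rewrite oppr_lt0 sqrtr_gt0.
    by rewrite sqrrN sqr_sqrtr ?ltW//; field; rewrite gt_eqF.
  have [r1 e1] := rP _ A10; have [r2 e2] := rP _ A20.
  have pr A : A = A1 \/ A = A2 -> r A < 0 -> 2 * lambda * r A ^+ 2 = A ->
      lambda * r A + gamma != 0 -> exists2 s, s < 0 & p s < 0.
    move=> AA rA eA h; exists (r A) => //; rewrite quartic_detE.
    have -> : (2 * lambda * r A ^+ 2 - A1) * (2 * lambda * r A ^+ 2 - A2) = 0.
      by rewrite eA; case: AA => ->; rewrite subrr ?mul0r ?mulr0.
    rewrite sub0r oppr_lt0 lt_neqAle sqr_ge0 andbT eq_sym sqrf_eq0.
    rewrite expr2 mulrA -mulrDl mulf_neq0// lt_eqF//.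
  have [h1|h1] := eqVneq (lambda * r A1 + gamma) 0; last by apply: pr r1 e1 h1; left.
  have [h2|h2] := eqVneq (lambda * r A2 + gamma) 0; last by apply: pr r2 e2 h2; right.
  have r12 : r A1 = r A2.
    by apply: (@mulfI _ lambda); [rewrite gt_eqF|apply: (@addIr _ gamma); rewrite h1 h2].
  by move: A12; rewrite -e1 -e2 r12 eqxx.
have p0 : 0 < p 0 by rewrite /p !expr0n/= !mulr0 !subr0 add0r mulr_gt0.
(* With [S >= 1 + B / (3 lambda^2)], the quartic term outweighs the quadratic one for [t <= - S];
   the cubic term is nonnegative there. *)
pose S := 1 + B / (3 * lambda ^+ 2).
have l2 : 0 < 3 * lambda ^+ 2 by rewrite mulr_gt0// exprn_gt0.
have B0 : 0 <= B by rewrite addr_ge0 ?sqr_ge0// mulr_ge0 ?mulr_ge0 ?addr_ge0// ltW.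
have S1 : 1 <= S by rewrite lerDl divr_ge0// ltW.
have pS t : t <= - S -> 0 < p t.
  move=> tS; have t0 : t < 0 by apply: le_lt_trans tS _; rewrite oppr_lt0; lra.
  have tt : B <= 3 * lambda ^+ 2 * t ^+ 2.
    rewrite -ler_pdivrMl// mulrC; apply: (@le_trans _ _ S); first by rewrite lerDr.
    by nra.
  rewrite /p; have := mulr_gt0 A10 A20.
  have : 0 <= t ^+ 2 * (3 * lambda ^+ 2 * t ^+ 2 - B) by rewrite mulr_ge0 ?sqr_ge0// subr_ge0.
  have : 0 <= 2 * gamma * lambda * (- t) ^+ 3.
    by rewrite mulr_ge0 ?exprn_ge0 ?oppr_ge0 ?(ltW t0)// mulr_ge0 ?(ltW l0)// mulr_ge0.
  by move: (3 * lambda ^+ 2) (gamma * lambda) => a b; lra.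
have Ss : - S <= s.
  by rewrite leNgt; apply/negP => /ltW/pS; rewrite ltNge (ltW ps).
have ivt (a b : R) : a <= b -> p a * p b < 0 -> exists2 c, a <= c <= b & p c = 0.
  move=> ab pab; have [|c cab pc] := @IVT R p a b 0 ab (@pcont _); last first.
    by exists c => //; move: cab; rewrite in_itv.
  by rewrite ge_min le_max; move: pab; have [|] := leP (p a) 0; have [|] := leP (p b) 0 => //=; nra.
have [t1 /andP[t1S t1s] pt1] : exists2 c, - S <= c <= s & p c = 0.
  by apply: ivt => //; rewrite pmulr_rlt0// pS.
have [t2 /andP[t2s t20] pt2] : exists2 c, s <= c <= 0 & p c = 0.
  by apply: ivt; rewrite ?ltW// nmulr_rlt0.
exists t1, t2; split => //.
- exact: le_lt_trans t1s s0.
- rewrite lt_neqAle t20 andbT; apply/eqP => t2E.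
  by move: p0; rewrite -[in X in _ < X]t2E pt2 ltxx.
- apply/eqP => t12; have t1E : t1 = s by apply/eqP; rewrite eq_le t1s t12.
  by move: ps; rewrite -t1E pt1 ltxx.
Qed.

(** A vector orthogonal to the first row [(m1, e)] is [(e, - m1)], and the vanishing determinant
    takes care of the second row. If the first row is zero, [(1, 0)] does. *)
Lemma null_vector t : p t = 0 -> exists v1 v2 : R,
  [/\ (v1 != 0) || (v2 != 0),
    (2 * lambda * t ^+ 2 - A1) * v1 + (lambda * t ^+ 2 + gamma * t) * v2 = 0 &
    (2 * lambda * t ^+ 2 - A2) * v2 + (lambda * t ^+ 2 + gamma * t) * v1 = 0].
Proof.
rewrite quartic_detE; set m1 := _ - A1; set m2 := _ - A2.
set e := lambda * t ^+ 2 + gamma * t => pt.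
have [/andP[/eqP m10 /eqP e0]|] := boolP ((m1 == 0) && (e == 0)).
  by exists 1, 0; rewrite oner_eq0 m10 e0; split => //; ring.
rewrite negb_and orbC => h; exists e, (- m1); rewrite oppr_eq0; split => //; first by ring.
by transitivity (- (m1 * m2 - e ^+ 2)); [ring|rewrite pt oppr0].
Qed.

(** If the two null vectors were parallel, one [v] would lie in both kernels, and the quadratic form
    of the matrix at [v], which is [a u^2 + b u - c] as a function of [u], would vanish at both
    roots. Then [c = - a t s], impossible since [a >= 0], [c > 0] and the roots have the same
    sign. *)
Lemma null_vectors_independent t s v1 v2 w1 w2 : t < 0 -> s < 0 -> t != s ->
  (v1 != 0) || (v2 != 0) -> (w1 != 0) || (w2 != 0) ->
  (2 * lambda * t ^+ 2 - A1) * v1 + (lambda * t ^+ 2 + gamma * t) * v2 = 0 ->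
  (2 * lambda * t ^+ 2 - A2) * v2 + (lambda * t ^+ 2 + gamma * t) * v1 = 0 ->
  (2 * lambda * s ^+ 2 - A1) * w1 + (lambda * s ^+ 2 + gamma * s) * w2 = 0 ->
  (2 * lambda * s ^+ 2 - A2) * w2 + (lambda * s ^+ 2 + gamma * s) * w1 = 0 ->
  v1 * w2 - v2 * w1 != 0.
Proof.
move=> t0 s0 ts v0 w0 T1 T2 S1 S2; apply/eqP => D0.
have Dvw : v2 * w1 = v1 * w2 by apply/esym/eqP; rewrite -subr_eq0 D0.
have par m e : m * w1 + e * w2 = 0 -> m * v1 + e * v2 = 0.
  move=> h; case/orP: w0 => w0; apply: (mulfI w0); rewrite mulr0.
    transitivity (v1 * (m * w1 + e * w2)); last by rewrite h mulr0.
    by rewrite mulrDr (mulrCA w1 e) (mulrC w1 v2) Dvw; ring.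
  transitivity (v2 * (m * w1 + e * w2)); last by rewrite h mulr0.
  by rewrite mulrDr (mulrCA w2 m) (mulrC w2 v1) -Dvw; ring.
have {}S1 := par _ _ S1.
have {}S2 : (2 * lambda * s ^+ 2 - A2) * v2 + (lambda * s ^+ 2 + gamma * s) * v1 = 0.
  by rewrite addrC; apply: par; rewrite addrC.
pose a := 2 * lambda * (v1 ^+ 2 + v2 ^+ 2 + v1 * v2).
pose b := 2 * gamma * v1 * v2; pose c := A1 * v1 ^+ 2 + A2 * v2 ^+ 2.
have quad u : (2 * lambda * u ^+ 2 - A1) * v1 + (lambda * u ^+ 2 + gamma * u) * v2 = 0 ->
    (2 * lambda * u ^+ 2 - A2) * v2 + (lambda * u ^+ 2 + gamma * u) * v1 = 0 ->
    a * u ^+ 2 + b * u = c.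
  move=> U1 U2; apply/eqP; rewrite -subr_eq0; apply/eqP.
  transitivity (v1 * ((2 * lambda * u ^+ 2 - A1) * v1 + (lambda * u ^+ 2 + gamma * u) * v2) +
    v2 * ((2 * lambda * u ^+ 2 - A2) * v2 + (lambda * u ^+ 2 + gamma * u) * v1)).
    by rewrite /a /b /c; ring.
  by rewrite U1 U2 !mulr0 addr0.
have qt := quad t T1 T2; have qs := quad s S1 S2.
have ab : a * (t + s) + b = 0.
  apply: (@mulfI _ (t - s)); first by rewrite subr_eq0.
  by rewrite mulr0 -(subrr c) -{1}qt -qs; ring.
have v2pos : 0 < v1 ^+ 2 + v2 ^+ 2.
  by case/orP: v0 => h; [apply: ltr_pwDl|apply: ltr_wpDl];
    rewrite ?sqr_ge0// lt_neqAle sqr_ge0 andbT eq_sym sqrf_eq0.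
have a0 : 0 <= a.
  by rewrite mulr_ge0 ?mulr_ge0 ?(ltW l0)//; have := sqr_ge0 (v1 + v2); nra.
have c0 : 0 < c.
  have q1 : 0 <= A1 * v1 ^+ 2 by rewrite mulr_ge0 ?sqr_ge0// ltW.
  have q2 : 0 <= A2 * v2 ^+ 2 by rewrite mulr_ge0 ?sqr_ge0// ltW.
  rewrite lt_neqAle addr_ge0// andbT eq_sym paddr_eq0//.
  by rewrite !mulf_eq0 (gt_eqF A10) (gt_eqF A20)/= !orbb negb_and.
have : c = - (a * (t * s)) by rewrite -qt (_ : b = - (a * (t + s))); [ring|apply/eqP; rewrite -subr_eq0 opprK addrC ab].
have : 0 <= a * (t * s) by rewrite mulr_ge0// ltW// nmulr_rgt0.
lra.
Qed.

End Quartic.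

End Algebra.

Section TwoAgents.
Context {R : realType}.

Lemma others_ord2 (u : 'I_2 -> R) :
  (\sum_(j < 2 | j != ord0) u j = u ord_max) * (\sum_(j < 2 | j != ord_max) u j = u ord0).
Proof.
split; rewrite big_mkcond !big_ord_recl big_ord0 /= ?addr0 ?add0r//.
by congr u; exact: val_inj.
Qed.

Lemma forall_ord2 (A : 'I_2 -> Prop) : A ord0 -> A ord_max -> forall i, A i.
Proof.
move=> A0 A1 [[|[|//]] h]; first by rewrite (_ : Ordinal h = ord0)//; exact: val_inj.
by rewrite (_ : Ordinal h = ord_max)//; exact: val_inj.
Qed.

End TwoAgents.

Theorem theorem3p1 (R : realType) (d : measure_display) (T : measurableType d)
    (P : probability T R) (F : R -> set (set T)) (W : R -> T -> R)
    (S0 sigma gamma lambda : R) :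
  filtration F -> brownian P F W ->
  sigma != 0 -> 0 <= gamma -> 0 < lambda ->
  (* case (a) *)
  (forall (n : nat) (alpha : R) (x : 'I_n -> R), 0 < alpha ->
     let xbar := n%:R^-1 * \sum_(j < n) x j in
     let theta := gamma / (2 * lambda)
                  - Num.sqrt (gamma ^+ 2 + 4 * alpha * sigma ^+ 2 * lambda) / (2 * lambda) in
     let rho := - ((n%:R - 1) * gamma) / (2 * (n%:R + 1) * lambda)
                - Num.sqrt ((n%:R - 1) ^+ 2 * gamma ^+ 2 + 4 * (n%:R + 1) * alpha * sigma ^+ 2 * lambda)
                  / (2 * (n%:R + 1) * lambda) in
     exists Xs : 'I_n -> R -> T -> R,
       unique_nash_mv_and_cara P S0 sigma gamma lambda W F x (fun _ => alpha) Xs /\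
       forall i t w, 0 <= t ->
         Xs i t w = (x i - xbar) * expR (theta * t) + xbar * expR (rho * t)) /\
  (* case (b) *)
  (forall (alpha x : 'I_2 -> R),
     0 < alpha ord0 -> 0 < alpha ord_max -> alpha ord0 != alpha ord_max ->
     let q := fun tau : R =>
       tau ^+ 4 - (2 * gamma) / (3 * lambda) * tau ^+ 3
       - (gamma ^+ 2 + 2 * lambda * sigma ^+ 2 * (alpha ord0 + alpha ord_max))
           / (3 * lambda ^+ 2) * tau ^+ 2
       + sigma ^+ 4 * alpha ord0 * alpha ord_max / (3 * lambda ^+ 2) in
     exists Xs : 'I_2 -> R -> T -> R,
       unique_nash_mv_and_cara P S0 sigma gamma lambda W F x alpha Xs /\
       exists tau1 tau2 : R,
         [/\ tau1 < 0, tau2 < 0 & tau1 != tau2] /\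
         [/\ q tau1 = 0, q tau2 = 0 &
             (forall tau, tau < 0 -> q tau = 0 -> tau = tau1 \/ tau = tau2)] /\
         (forall i, exists a b : R, forall t w, 0 <= t ->
               Xs i t w = a * expR (tau1 * t) + b * expR (tau2 * t))).
Proof.
move=> HF HW sigma0 gamma0 lambda0.
have sig2 : 0 < sigma ^+ 2 by rewrite lt_neqAle sqr_ge0 andbT eq_sym sqrf_eq0.
split=> [n alpha x a0 xbar theta rho|alpha x a0 a1 a01 q].
- have as0 : 0 < alpha * sigma ^+ 2 by rewrite mulr_gt0.
  have [th0 thE] := quadratic_neg_root (- gamma) lambda0 as0.
  have n0 : 0 < (n%:R + 1) * lambda by rewrite mulr_gt0// ltr_wpDl.
  have [rh0 rhE] := quadratic_neg_root ((n%:R - 1) * gamma) n0 as0.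
  move: th0 thE rh0 rhE.
  have -> : - - gamma / (2 * lambda) - Num.sqrt ((- gamma) ^+ 2 + 4 * lambda * (alpha * sigma ^+ 2)) /
      (2 * lambda) = theta.
    by rewrite /theta opprK sqrrN; congr (_ - Num.sqrt (_ + _) / _); ring.
  have -> : - ((n%:R - 1) * gamma) / (2 * ((n%:R + 1) * lambda)) -
      Num.sqrt (((n%:R - 1) * gamma) ^+ 2 + 4 * ((n%:R + 1) * lambda) * (alpha * sigma ^+ 2)) /
      (2 * ((n%:R + 1) * lambda)) = rho.
    by rewrite /rho -!(mulrA 2); congr (_ - Num.sqrt _ / _); ring.
  move=> th0 thE rh0 rhE.
  exists (fun i t _ => (x i - xbar) * expR (theta * t) + xbar * expR (rho * t)); split; last by [].
  (* The deviations from the mean sum to zero, so the others contribute [- c1 i] and the system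
     reduces to [lambda theta^2 - gamma theta = alpha sigma^2]. For the mean part the others
     contribute [(n - 1) xbar], and [rho] solves the second quadratic. *)
  apply: (exp_equilibrium HF HW) => // i; first by rewrite subrK.
  (* The index [i] itself shows that [n] is positive, so division by [n] is sound; for [n = 0] there
     is nothing to check. *)
  + have npos : (0 < n)%N by case: i => m; case: (n).
    have sum0 : \sum_(j < n) (x j - xbar) = 0.
      rewrite sumrB sumr_const card_ord -mulr_natl mulrA mulfV ?mul1r ?subrr//.
      by rewrite pnatr_eq0 -lt0n.
    have -> : \sum_(j < n | j != i) (x j - xbar) = - (x i - xbar).
      by move: sum0; rewrite (bigD1 i)//= addrC => /eqP; rewrite addr_eq0 => /eqP.
    by rewrite -thE; ring.
  + have -> : \sum_(j < n | j != i) xbar = (n%:R - 1) * xbar.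
      have := sumr_const 'I_n xbar; rewrite (bigD1 i)//= card_ord => E.
      by apply: (@addrI _ xbar); rewrite E -mulr_natl; ring.
    by rewrite -rhE; ring.
- pose A1 := alpha ord0 * sigma ^+ 2; pose A2 := alpha ord_max * sigma ^+ 2.
  have A10 : 0 < A1 by rewrite mulr_gt0.
  have A20 : 0 < A2 by rewrite mulr_gt0.
  have A12 : A1 != A2 by apply: contra a01 => /eqP/(mulIf (lt0r_neq0 sig2))/eqP.
  have [t1 [t2 [t10 t20 t12 p1 p2]]] := quartic_neg_roots gamma0 lambda0 A10 A20 A12.
  have qE t : q t = 0 <-> 3 * lambda ^+ 2 * t ^+ 4 - 2 * gamma * lambda * t ^+ 3 -
      (gamma ^+ 2 + 2 * lambda * (A1 + A2)) * t ^+ 2 + A1 * A2 = 0.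
    have E : 3 * lambda ^+ 2 * q t = 3 * lambda ^+ 2 * t ^+ 4 - 2 * gamma * lambda * t ^+ 3 -
      (gamma ^+ 2 + 2 * lambda * (A1 + A2)) * t ^+ 2 + A1 * A2.
      by rewrite /q /A1 /A2; field; rewrite gt_eqF.
    rewrite -E; split=> [->|/eqP]; first by rewrite mulr0.
    by rewrite mulf_eq0 mulf_eq0 sqrf_eq0 pnatr_eq0 (gt_eqF lambda0)/= => /eqP.
  have [v1 [v2 [v0 V1 V2]]] := null_vector p1.
  have [w1 [w2 [w0 W1 W2]]] := null_vector p2.
  have D0 := null_vectors_independent lambda0 A10 A20 t10 t20 t12 v0 w0 V1 V2 W1 W2.
  set D := v1 * w2 - v2 * w1 in D0.
  (* Cramer's rule for the combination [u1 v + u2 w] of the null vectors that matches the initial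
     positions. *)
  pose u1 := (x ord0 * w2 - x ord_max * w1) / D.
  pose u2 := (v1 * x ord_max - v2 * x ord0) / D.
  pose c1 (i : 'I_2) := u1 * (if i == ord0 then v1 else v2).
  pose c2 (i : 'I_2) := u2 * (if i == ord0 then w1 else w2).
  exists (fun i t _ => c1 i * expR (t1 * t) + c2 i * expR (t2 * t)); split.
    apply: (exp_equilibrium HF HW) => //; apply: forall_ord2; rewrite ?others_ord2 /c1 /c2 /=.
    + exact: a0.
    + exact: a1.
    + by rewrite /u1 /u2 /D; field.
    + by rewrite /u1 /u2 /D; field.
    + apply/eqP; rewrite -subr_eq0; apply/eqP.
      by transitivity (u1 * 0); [rewrite -V1 /A1; ring|rewrite mulr0].
    + apply/eqP; rewrite -subr_eq0; apply/eqP.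
      by transitivity (u1 * 0); [rewrite -V2 /A2; ring|rewrite mulr0].
    + apply/eqP; rewrite -subr_eq0; apply/eqP.
      by transitivity (u2 * 0); [rewrite -W1 /A1; ring|rewrite mulr0].
    + apply/eqP; rewrite -subr_eq0; apply/eqP.
      by transitivity (u2 * 0); [rewrite -W2 /A2; ring|rewrite mulr0].
  exists t1, t2; split; first by [].
  split; first split; [exact: (qE t1).2 p1|exact: (qE t2).2 p2| |].
    move=> t t0 qt; have pt := (qE t).1 qt.
    exact: (quartic_two_neg_roots A10 A20 t10 t20 t0 p1 p2 pt t12).
  by move=> i; exists (c1 i), (c2 i).
Qed.
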